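(* Let $3\le N\le6$, $R>0$, $B_R=B(0,R)\subset\mathbb{R}^N$ and $2^*=\frac{2N}{N-2}$. Let $(p_k)_{k\ge0}$ satisfy $p_k\ge2^*$ for all $k\ge0$ and $\lim_{k\to+\infty}p_k=2^*$. Let $(u_k)_{k\ge0}$ be a sequence of positive radial $C^2(\overline{B_R})$ solutions of $$-\Delta u_k+u_k=u_k^{p_k-1}\ \text{ in }B_R,\qquad\partial_\nu u_k=0\ \text{ on }\partial B_R,$$ such that $\|u_k\|_{L^{\alpha_k}(B_R)}\le C$ for some $C>0$ and all $k\ge0$, where $\alpha_k=\max\left(2^*,\frac N2p_k-N\right)$, and let $u_0$ be its weak limit in $H^1(B_R)$ (up to a subsequence). Assume that $(u_k)_{k\ge0}$ blows up, that is $\lim_{k\to+\infty}\|u_k\|_{L^\infty(B_R)}=+\infty$. Then: - if $4\le N\le6$, then $u_0>0$, and if $N=6$ one has moreover $u_0(0)\ge\frac12$; - if $N=3$ and $u_0\equiv0$, then $R\le R^*$.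
   Context: $\Delta=\sum_i\partial_{x_i}^2$ and $\partial_\nu$ is the outward normal derivative. The weak limit $u_0$ is a $C^2(\overline{B_R})$ radial solution of the same problem with exponent $2^*$. The radius $R^*$ (dimension $N=3$): let $G_1$ be the Green's function of $-\Delta+1$ in $B_R\subset\mathbb{R}^3$ with Neumann boundary condition; $x\mapsto G_1(0,x)$ is radial and $G_1(0,r)=\frac{1}{4\pi r}+H_1+o(1)$ as $r\to0$ for a number $H_1=H_1(R)\in\mathbb{R}$, the mass of $G_1$ at $0$. $R^*$ is the unique value of $R>0$ for which $H_1(R)=0$. *)

(* Defs.v *)
From HB Require Import structures.
From mathcomp Require Import all_boot all_order all_algebra.
From mathcomp Require Import all_classical all_reals all_analysis.

Set Implicit Arguments.
Unset Strict Implicit.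
Unset Printing Implicit Defensive.

Import Order.TTheory GRing.Theory Num.Theory.
Import numFieldNormedType.Exports.

Local Open Scope classical_set_scope.
Local Open Scope ring_scope.

Section lebesgue_measure_rV.
Context {R : realType}.

Definition rV_display : measure_display.
Proof. exact: default_measure_display. Qed.

Definition rV_coord n (i : 'I_n) (x : 'rV[R]_n) : R := x ord0 i.

(* The Borel sigma-algebra of R^n, generated by the coordinates *)
Let rV_set0 n : g_sigma_preimage (@rV_coord n) set0.
Proof. exact: sigma_algebra0. Qed.

Let rV_setC n A : g_sigma_preimage (@rV_coord n) A ->
  g_sigma_preimage (@rV_coord n) (~` A).
Proof. exact: sigma_algebraC. Qed.

Let rV_bigcup n (F : (set 'rV[R]_n)^nat) :
  (forall i, g_sigma_preimage (@rV_coord n) (F i)) ->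
  g_sigma_preimage (@rV_coord n) (\bigcup_i (F i)).
Proof. exact: sigma_algebra_bigcup. Qed.

HB.instance Definition _ n := @isMeasurable.Build rV_display 'rV[R]_n
  (g_sigma_preimage (@rV_coord n)) (@rV_set0 n) (@rV_setC n) (@rV_bigcup n).

Lemma measurable_rV_coord n (i : 'I_n) :
  measurable_fun [set: 'rV[R]_n] (@rV_coord n i).
Proof.
move=> _ Y mY; rewrite setTI; apply: sub_sigma_algebra => /=.
rewrite -bigcup_seq/=; exists i => /=; first by rewrite mem_index_enum.
by exists Y => //; rewrite setTI.
Qed.

Lemma measurable_rVP d (T : measurableType d) n (f : T -> 'rV[R]_n) :
  (forall i, measurable_fun [set: T] (@rV_coord n i \o f)) ->
  measurable_fun [set: T] f.
Proof.
move=> mf.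
apply: (@measurability _ _ _ _ _ _
  (\big[setU/set0]_(i < n) preimage_set_system setT (@rV_coord n i) measurable)) => //.
move=> _ [A mA <-]; move: mA; rewrite -bigcup_seq => -[i _ [B mB <-]].
by have := mf i measurableT B mB; rewrite !setTI.
Qed.

Definition rV_cons n (p : R * 'rV[R]_n) : 'rV[R]_n.+1 :=
  \row_i (if unlift ord0 i is Some j then p.2 ord0 j else p.1).

Definition rV_uncons n (x : 'rV[R]_n.+1) : R * 'rV[R]_n :=
  (x ord0 ord0, \row_j x ord0 (lift ord0 j)).

Lemma rV_consK n : cancel (@rV_cons n) (@rV_uncons n).
Proof.
move=> [a x]; congr pair; rewrite /= ?mxE ?unlift_none//.
by apply/rowP => j; rewrite !mxE liftK.
Qed.

Lemma measurable_rV_cons n :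
  measurable_fun [set: measurableTypeR R * 'rV[R]_n] (@rV_cons n).
Proof.
apply: measurable_rVP => i.
rewrite (_ : _ \o _ = fun p : measurableTypeR R * 'rV[R]_n =>
  (if unlift ord0 i is Some j then rV_coord j p.2 else p.1)); last first.
  by apply/funext => p; rewrite /= /rV_coord mxE.
case: (unlift _ _) => [j|]; last exact: measurable_fst.
exact: (measurableT_comp (measurable_rV_coord j) measurable_snd).
Qed.

Lemma measurable_rV_uncons n :
  measurable_fun [set: 'rV[R]_n.+1]
    (@rV_uncons n : _ -> (measurableTypeR R * 'rV[R]_n)%type).
Proof.
apply/measurable_fun_pairP; split; first exact: (measurable_rV_coord ord0).
apply: measurable_rVP => j.
rewrite (_ : _ \o _ = rV_coord (lift ord0 j)); first exact: measurable_rV_coord.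
by apply/funext => x; rewrite /= /rV_coord mxE.
Qed.

Section cons.
Context n (m : {sigma_finite_measure set 'rV[R]_n -> \bar R}).

Definition lebesgue_rV_cons : set 'rV[R]_n.+1 -> \bar R :=
  pushforward (@lebesgue_measure R \x m)%E (@rV_cons n).

Let cons0 : lebesgue_rV_cons set0 = 0%E.
Proof. by rewrite /lebesgue_rV_cons /pushforward preimage_set0 measure0. Qed.

Let cons_ge0 A : (0 <= lebesgue_rV_cons A)%E.
Proof. by rewrite /lebesgue_rV_cons /pushforward. Qed.

Let cons_sigma_additive : semi_sigma_additive lebesgue_rV_cons.
Proof.
move=> F mF tF mUF.
have mc := @measurable_rV_cons n.
exact: (@measure_semi_sigma_additive _ _ _ (pushforward (@lebesgue_measure R \x m)%E (@rV_cons n))).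
Qed.

HB.instance Definition _ := isMeasure.Build _ _ _ lebesgue_rV_cons
  cons0 cons_ge0 cons_sigma_additive.

Let cons_sigma_finite : sigma_finite setT lebesgue_rV_cons.
Proof.
have /sigma_finiteP[F [TF ndF Foo]] := sigma_finiteT (@lebesgue_measure R).
have /sigma_finiteP[G [TG ndG Goo]] := sigma_finiteT m.
exists (fun k => @rV_uncons n @^-1` (F k `*` G k)).
  apply/esym; rewrite -subTset => x _.
  have [i _ Fi] : (\bigcup_i F i) (rV_uncons x).1 by rewrite -TF.
  have [j _ Gj] : (\bigcup_i G i) (rV_uncons x).2 by rewrite -TG.
  exists (maxn i j) => //; split.
    by move: Fi; exact/subsetPset/ndF/leq_maxl.
  by move: Gj; exact/subsetPset/ndG/leq_maxr.
move=> k; have [mF Fk] := Foo k; have [mG Gk] := Goo k; split.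
  by rewrite -[X in measurable X]setTI; apply: measurable_rV_uncons => //;
    exact: measurableX.
rewrite /lebesgue_rV_cons /pushforward -comp_preimage.
rewrite (_ : _ \o _ = id); last by apply/funext => p; exact: rV_consK.
by rewrite preimage_id product_measure1E// lte_mul_pinfty// ge0_fin_numE.
Qed.

HB.instance Definition _ := Measure_isSigmaFinite.Build _ _ _ lebesgue_rV_cons
  cons_sigma_finite.

End cons.

(* Product of n copies of the Lebesgue measure on R *)
Fixpoint lebesgue_rV n : {sigma_finite_measure set 'rV[R]_n -> \bar R} :=
  if n is n'.+1 return {sigma_finite_measure set 'rV[R]_n -> \bar R}
  then lebesgue_rV_cons (lebesgue_rV n')
  else \d_(0 : 'rV[R]_0).

End lebesgue_measure_rV.

Section neumann_problem.
Context {R : realType}.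

(* The norm of 'rV[R]_n in the library is the sup norm. *)
Definition enorm n (x : 'rV[R]_n) : R := Num.sqrt (\sum_i x ord0 i ^+ 2).

Definition eball n (r : R) : set 'rV[R]_n := [set x | enorm x < r].

Definition eclosed_ball n (r : R) : set 'rV[R]_n := [set x | enorm x <= r].

Definition esphere n (r : R) : set 'rV[R]_n := [set x | enorm x = r].

Definition basis_vec n (i : 'I_n) : 'rV[R]_n := delta_mx ord0 i.

Definition partial n (i : 'I_n) (f : 'rV[R]_n -> R) : 'rV[R]_n -> R :=
  'D_(basis_vec i) f.

Definition laplacian n (f : 'rV[R]_n -> R) (x : 'rV[R]_n) : R :=
  \sum_i partial i (partial i f) x.

Definition extends_continuously n (O K : set 'rV[R]_n) (f : 'rV[R]_n -> R) :=
  exists2 g : 'rV[R]_n -> R, {within K, continuous g} & {in O, f =1 g}.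

(* f is of class C^2 in the open set O and all its derivatives of order at
   most 2 have continuous extensions to K, where O is contained in K and K in
   the closure of O; the values of f outside K play no role. *)
Definition C2_upto n (O K : set 'rV[R]_n) (f : 'rV[R]_n -> R) :=
  [/\ {within K, continuous f},
      forall i x, O x -> derivable f x (basis_vec i),
      forall i, extends_continuously O K (partial i f),
      forall i j x, O x -> derivable (partial i f) x (basis_vec j) &
      forall i j, extends_continuously O K (partial j (partial i f))].

(* The derivative at a boundary point x of the ball of radius r along the
   outward unit normal x / r: f need not be defined outside the closed ball, so
   the difference quotients are taken from inside. *)
Definition is_normal_derivative n (r : R) (f : 'rV[R]_n -> R) (x : 'rV[R]_n)
    (l : R) :=
  h^-1 * (f (x + (h / r) *: x) - f x) @[h --> 0^'-] --> l.

Definition radial_on n (K : set 'rV[R]_n) (f : 'rV[R]_n -> R) :=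
  forall x y, K x -> K y -> enorm x = enorm y -> f x = f y.

(* u is a classical solution of - Laplacian u + u = u ^ (p - 1) in the ball of
   radius r with homogeneous Neumann boundary condition.  Since powR is
   meaningful on nonnegative reals only, nonnegativity is required. *)
Definition neumann_solution n (r p : R) (u : 'rV[R]_n -> R) :=
  [/\ C2_upto (@eball n r) (@eclosed_ball n r) u,
      forall x, eball r x -> 0 <= u x,
      forall x, eball r x -> - laplacian u x + u x = u x `^ (p - 1) &
      forall x, esphere r x -> is_normal_derivative r u x 0].

Definition iter_partial n (s : seq 'I_n) (f : 'rV[R]_n -> R) :
    'rV[R]_n -> R :=
  foldr (@partial n) f s.

Definition test_function n (O : set 'rV[R]_n) (phi : 'rV[R]_n -> R) :=
  [/\ forall s, continuous (iter_partial s phi),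
      forall s i x, derivable (iter_partial s phi) x (basis_vec i),
      compact (closure [set x | phi x != 0]) &
      closure [set x | phi x != 0] `<=` O].

Definition lebesgue_norm n (O : set 'rV[R]_n) (p : \bar R)
    (f : 'rV[R]_n -> R) : \bar R :=
  'N[lebesgue_rV n]_p [EFin \o (f \_ O)].

Definition L2 n (O : set 'rV[R]_n) (f : 'rV[R]_n -> R) :=
  f \_ O \in Lfun (lebesgue_rV n) 2%:E.

Definition weak_gradient n (O : set 'rV[R]_n) (v : 'rV[R]_n -> R)
    (g : 'I_n -> 'rV[R]_n -> R) :=
  forall phi, test_function O phi -> forall i,
    \int[lebesgue_rV n]_(x in O) (v x * partial i phi x) =
    - \int[lebesgue_rV n]_(x in O) (g i x * phi x).

Definition in_H1 n (O : set 'rV[R]_n) (v : 'rV[R]_n -> R)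
    (g : 'I_n -> 'rV[R]_n -> R) :=
  [/\ L2 O v, forall i, L2 O (g i) & weak_gradient O v g].

Definition H1_inner n (O : set 'rV[R]_n)
    (u : 'rV[R]_n -> R) (du : 'I_n -> 'rV[R]_n -> R)
    (v : 'rV[R]_n -> R) (dv : 'I_n -> 'rV[R]_n -> R) : R :=
  \int[lebesgue_rV n]_(x in O) (u x * v x + \sum_i du i x * dv i x).

(* Weak convergence in the Hilbert space H^1(O) of functions whose classical
   gradient is their weak gradient. *)
Definition weak_cvg_H1 n (O : set 'rV[R]_n) (u : nat -> 'rV[R]_n -> R)
    (u0 : 'rV[R]_n -> R) :=
  forall v dv, in_H1 O v dv ->
    H1_inner O (u k) (fun i => partial i (u k)) v dv @[k --> \oo] -->
    H1_inner O u0 (fun i => partial i u0) v dv.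

(* G is the function G_1(y, .), where G_1 is the Green's function of
   - Laplacian + 1 in the ball of radius r with Neumann boundary condition:
   - Laplacian G + G is the Dirac mass at y, in the sense of distributions, and
   the normal derivative of G is zero. *)
Definition neumann_green n (r : R) (y : 'rV[R]_n) (G : 'rV[R]_n -> R) :=
  [/\ (lebesgue_rV n).-integrable (eball r) (EFin \o G),
      C2_upto (eball r `\ y) (eclosed_ball r `\ y) G,
      forall phi, test_function (eball r) phi ->
        \int[lebesgue_rV n]_(x in eball r)
          (G x * (- laplacian phi x + phi x)) = phi y &
      forall x, esphere r x -> is_normal_derivative r G x 0].

(* G_1(0, x) = 1 / (4 pi |x|) + H + o(1) as x tends to 0 in R^3 *)
Definition green_mass (r H : R) :=
  exists2 G : 'rV[R]_3 -> R, neumann_green r 0 G &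
    G x - (4 * pi * enorm x)^-1 @[x --> (0 : 'rV[R]_3)^'] --> H.

Definition is_critical_radius (r : R) :=
  unique (fun s : R => 0 < s /\ green_mass s 0) r.

Definition critical_exponent (n : nat) : R := 2 * n%:R / (n%:R - 2).

End neumann_problem.

(* Main.v *)
Require Import Defs.
From mathcomp Require Import all_boot all_order all_algebra.
From mathcomp Require Import all_classical all_reals all_analysis.
From mathcomp Require Import measurable_realfun ess_sup_inf ring lra.

(* Write u(x) = U(|x|) for a radial solution and N for the dimension.  The
   Pohozaev functional
     P(s) = s^N (U'^2/2 - U^2/2 + U^p/p) + (N-2)/2 s^(N-1) U U'
   satisfies P(0) = 0 and, because p >= 2N/(N-2), P' <= - s^(N-1) U^2; so
   P <= 0, which forces |U'| <= ((N-2)/s + 1) U.  This is a Harnack inequality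
   away from the origin, uniform in the solution and in p.

   If the weak limit u0 vanishes, Harnack's inequality and the convergence of
   the integrals of v u_k^(p_k-1) for test functions v give solutions that are
   arbitrarily small on [e, r].  There U solves an almost linear equation with
   U'(r) = 0, so U / U(r) is close to the solution G of the linear equation,
   which is singular at 0.  If N >= 4, the integral of s^(N-1) G^2 diverges,
   which contradicts P(s) <= P(e) - (integral of t^(N-1) U^2 over [e, s]).  If
   N = 3, then s G(s) = A cosh s + B sinh s and P(s) / U(r)^2 is close to
   - A B / 2 for small s, so B >= 0, that is r sinh r <= cosh r; on the other
   hand a Green function with zero mass forces R* sinh R* >= cosh R*, by the
   maximum principle applied to the comparison functions
   (a cosh |x| + b sinh |x|) / |x|.

   If N = 6, the Pohozaev functional of U - 1/2 (1/2 is the constant for which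
   the linear part of the equation cancels when p = 3) is strictly decreasing
   as long as U > 1/2, and it is nonnegative where U = 1/2: a solution with
   U(0) > 1/2 stays above 1/2, and this passes to the weak limit. *)

Set Implicit Arguments.
Unset Strict Implicit.
Unset Printing Implicit Defensive.

Import Order.TTheory GRing.Theory Num.Theory.
Import numFieldNormedType.Exports.

Local Open Scope classical_set_scope.
Local Open Scope ring_scope.

(** * Lebesgue measure on row vectors *)

Section measure_rV.
Context {R : realType}.
Local Notation mu n := (lebesgue_rV n : measure _ R).

(** Weak convergence in H^1 gives no pointwise control of the solutions, least of all near the
    origin, where they may concentrate. One kind of statement does cross the limit: if u_k >= c on
    an open set, the right-hand side of the equation is at least c^(p_k-1) there, while the
    left-hand side is linear and converges once it is tested against bump functions. Harnack's
    inequality makes this one-sided fact sufficient: a solution that exceeds a fixed level at one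
    radius of [e, r] is bounded below on all of [e, r]. The value U(r) then serves as the unit in
    which all other quantities are measured, so no rescaled sequence has to converge.

    The bound N <= 6 amounts to 2* >= 3. Hence U^(p-1) <= c U wherever U <= c <= 1, uniformly in p,
    and this makes the equation almost linear where U is small.

    For N = 6, blow-up enters through the energy of the radial equation, seen as a damped motion: a
    start U(0) <= 1/2 has nonpositive energy, which cannot increase along the radius and keeps U <=
    p/2. Since p_k tends to 3, unbounded solutions must start above 1/2. *)

Definition box n (a : 'rV[R]_n) (h : R) : set 'rV[R]_n :=
  [set x | forall i, `|x ord0 i - a ord0 i| <= h].

Definition obox n (a : 'rV[R]_n) (h : R) : set 'rV[R]_n :=
  [set x | forall i, `|x ord0 i - a ord0 i| < h].

Lemma coord_itv_measurable n (i : 'I_n) (A : set R) : measurable A ->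
  measurable [set x : 'rV[R]_n | A (x ord0 i)].
Proof.
move=> mA; rewrite (_ : [set _ | _] = setT `&` rV_coord i @^-1` A).
  exact: measurable_rV_coord.
by rewrite setTI.
Qed.

Lemma measurable_box n (a : 'rV[R]_n) h : measurable (box a h).
Proof.
rewrite (_ : box a h =
    \bigcap_(i in [set: 'I_n]) [set x | `[a ord0 i - h, a ord0 i + h]%classic (x ord0 i)]).

  apply: fin_bigcap_measurable => // i _.
  exact: coord_itv_measurable.
apply/seteqP; split => x /= + i; first by move/(_ i); rewrite /= in_itv/= ler_distl.
by move/(_ i I); rewrite /= in_itv/= ler_distl.
Qed.

Lemma measurable_obox n (a : 'rV[R]_n) h : measurable (obox a h).
Proof.
rewrite (_ : obox a h =
    \bigcap_(i in [set: 'I_n]) [set x | `]a ord0 i - h, a ord0 i + h[%classic (x ord0 i)]).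
  apply: fin_bigcap_measurable => // i _.
  exact: coord_itv_measurable.
apply/seteqP; split => x /= + i; first by move/(_ i); rewrite /= in_itv/= ltr_distl.
by move/(_ i I); rewrite /= in_itv/= ltr_distl.
Qed.

Lemma nbhs_rVP n (x : 'rV[R]_n) (A : set 'rV[R]_n) :
  nbhs x A <-> exists2 e, 0 < e & obox x e `<=` A.
Proof.
split=> [/nbhs_ballP[e /= e0 eA]|[e e0 eA]].
  exists e => // y xy; apply: eA; split => // i j.
  by rewrite ord1 /ball/= distrC; exact: xy.
apply/nbhs_ballP; exists e => //= y [_ xy]; apply: eA => i.
by have := xy ord0 i; rewrite /ball/= distrC.
Qed.

(** An open set is the union of the countably many cubes with rational centre and radius 1/(m+1)
    that it contains. This ties the topology to the sigma-algebra generated by the coordinates. *)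
Lemma open_measurable_rV n (A : set 'rV[R]_n) : open A -> measurable A.
Proof.
move=> oA.
pose B (q : 'rV[rat]_n * nat) := obox (map_mx ratr q.1 : 'rV[R]_n) q.2.+1%:R^-1.
rewrite (_ : A = \bigcup_(q in [set q | B q `<=` A]) B q); last first.
  apply/seteqP; split => [x Ax|x [q /= qA Bx]]; last exact: qA.
  have /nbhs_rVP[e e0 eA] : nbhs x A by exact: open_nbhs_nbhs.
  have [m] : exists m, m.+1%:R^-1 < e / 2.
    have e20 : 0 < e / 2 by rewrite divr_gt0.
    have := @archi_boundP _ (e / 2)^-1; rewrite invr_ge0 => /(_ (ltW e20)).
    set k := Num.bound _ => ek; exists k.
    rewrite -[ltRHS]invrK ltf_pV2 ?posrE ?invr_gt0//.
    by rewrite (lt_le_trans ek)// ler_nat.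
  move=> me.
  have m0 : 0 < m.+1%:R^-1 :> R by rewrite invr_gt0 ltr0n.
  have /choice[q hq] : forall i, exists q : rat, `|x ord0 i - ratr q| < m.+1%:R^-1.
    move=> i; have /rat_in_itvoo[q] : x ord0 i - m.+1%:R^-1 < x ord0 i + m.+1%:R^-1.
      by rewrite ltrD2l (lt_trans _ m0)// oppr_lt0.
    by rewrite in_itv/= => qi; exists q; rewrite distrC ltr_distl.
  exists (\row_i q i, m) => /=; last by move=> i /=; rewrite !mxE.
  move=> y By; apply: eA => i; have /= := By i; rewrite !mxE/= => yq.
  rewrite (_ : _ - _ = (y ord0 i - ratr (q i)) - (x ord0 i - ratr (q i))); last by ring.
  rewrite (le_lt_trans (ler_normB _ _))//.
  by rewrite (lt_trans (ltrD yq (hq i)))// [ltRHS](splitr e) ltrD.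

rewrite bigcup_mkcond; apply: countable_bigcupT_measurable => [|q].
  exact: countableP.
by case: ifP => // _; exact: measurable_obox.
Qed.

Lemma continuous_measurable_rV n (f : 'rV[R]_n -> R) :
  continuous f -> measurable_fun [set: 'rV[R]_n] f.
Proof.
move=> cf; apply: (measurability _ (measurable_realfun.RGenOpens.measurableE R)) => //.
move=> _ [_ [a [b ->] <-]]; rewrite setTI; apply: open_measurable_rV.
by apply: open_comp => // x _; exact: cf.
Qed.

Lemma lebesgue_rV_box n (a : 'rV[R]_n) h : 0 <= h ->
  mu n (box a h) = ((h *+ 2) ^+ n)%:E.
Proof.
move=> h0; elim: n a => [|n IH] a.
  rewrite /= diracE mem_set// => -[].
  by [].
rewrite /= /lebesgue_rV_cons /pushforward.
rewrite (_ : _ @^-1` _ = `[a ord0 ord0 - h, a ord0 ord0 + h]%classic `*`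
    box (rV_uncons a).2 h); last first.
  apply/seteqP; split => -[x y] /=.
    move=> H; split; first by have := H ord0; rewrite mxE unlift_none/= in_itv/= ler_distl.
    by move=> i; have := H (lift ord0 i); rewrite !mxE liftK.
  rewrite in_itv/= -ler_distl => -[Hx Hy] i; rewrite mxE.
  by case: unliftP => [j|] ->//=; have := Hy j; rewrite mxE.
rewrite product_measure1E//; [|exact: measurable_box].
rewrite [X in (_ * X)%E](IH _).
rewrite [X in (X * _)%E](lebesgue_measure_itv `[a ord0 ord0 - h, a ord0 ord0 + h]).
rewrite /= lte_fin; case: ifPn => [_|].
  by rewrite -EFinB -EFinM exprS; congr (_ * _)%:E; rewrite mulr2n; ring.
rewrite -leNgt => hle; have -> : h = 0 by lra.
by rewrite mul0rn mul0e expr0n.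
Qed.


Lemma compact_box n (a : 'rV[R]_n) h : compact (box a h).
Proof.
have : compact [set v : 'rV[R]_n | forall i, `[a ord0 i - h, a ord0 i + h]%classic (v ord0 i)].
  by apply: (@rV_compact _ _ (fun i => `[a ord0 i - h, a ord0 i + h]%classic)) => i;
    exact: segment_compact.
congr compact; apply/seteqP; split => x /= + i => /(_ i);
  by rewrite /= in_itv/= ler_distl.
Qed.

Lemma integrable_continuous_box n (f : 'rV[R]_n -> R) a M : 0 <= M -> continuous f ->
  (forall x, ~ box a M x -> f x = 0) -> (mu n).-integrable setT (EFin \o f).
Proof.
move=> M0 cf f0; have mf := continuous_measurable_rV cf.
have fE : f = f \_ (box a M).
  apply/funext => x; rewrite patchE; case: ifPn => //.
  by rewrite notin_setE => /f0.
rewrite fE -restrict_EFin; have mb := measurable_box a M.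
apply/integrable_restrict => //; rewrite setTI; apply: measurable_bounded_integrable => //.
- by rewrite [ltLHS](lebesgue_rV_box _ M0) ltry.
- exact: measurable_funTS.
- have : compact (f @` box a M).
    apply: continuous_compact; last exact: compact_box.
    exact: continuous_subspaceT.
  move=> /compact_bounded [C [Cr HC]]; exists C; split => // x Cx y by_.
  by apply: HC => //; exists y.
Qed.

Lemma line_derivable (V : normedModType R) (f : V -> R) x v t :
  derivable f (x + (t : R) *: v) v = derivable (fun s : R => f (x + s *: v)) t 1.
Proof.
rewrite /derivable; set F := (fun h => _); set G := (X in _ = X).
suff -> : F = (fun h : R => h^-1 *: (((fun s : R => f (x + s *: v)) \o shift t) (h *: 1) - f (x + t *: v))) by [].
apply/funext => h; rewrite /F /=.
have -> : h *: (1 : R) = h by exact: mulr1.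
by rewrite scalerDl addrCA.
Qed.

Lemma line_derive (V : normedModType R) (f : V -> R) x v t :
  'D_v f (x + (t : R) *: v) = 'D_1 (fun s : R => f (x + s *: v)) t.
Proof.
rewrite /derive; set F := (fun h => _); set G := (X in _ = X).
suff -> : F = (fun h : R => h^-1 *: (((fun s : R => f (x + s *: v)) \o shift t) (h *: 1) - f (x + t *: v))) by [].
apply/funext => h; rewrite /F /=.
have -> : h *: (1 : R) = h by exact: mulr1.
by rewrite scalerDl addrCA.
Qed.

Lemma rV_cons_line n t (y : 'rV[R]_n) :
  rV_cons (t, y) = rV_cons (0, y) + t *: basis_vec ord0.
Proof.
apply/rowP => i; rewrite !mxE; case: unliftP => [j|] ->.
  by rewrite /= mulr0 addr0.
by rewrite eqxx mulr1 add0r.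
Qed.

Lemma rV_cons_lift n a (y : 'rV[R]_n) j h :
  rV_cons (a, h *: basis_vec j + y) = h *: basis_vec (lift ord0 j) + rV_cons (a, y).
Proof.
apply/rowP => i; rewrite !mxE; case: unliftP => [k|] -> /=.
  by rewrite !mxE (inj_eq lift_inj).
by rewrite mulr0 add0r.
Qed.

Lemma continuous_rVP n (T : topologicalType) (f : T -> 'rV[R]_n) x :
  (forall i, {for x, continuous (fun y => f y ord0 i)}) -> {for x, continuous f}.
Proof.
move=> cf A /nbhs_rVP[e e0 eA].
suff : \forall y \near x, forall i, `|f y ord0 i - f x ord0 i| < e.
  by apply: filterS => y Hy; apply: eA.
apply: filter_forall => i.
have /cvgrPdist_lt/(_ e e0) := cf i.
by apply: filterS => y; rewrite distrC.
Qed.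

Lemma continuous_rV_cons n : continuous (@rV_cons R n).
Proof.
move=> [a z]; apply: continuous_rVP => i.
have E : (fun y : R * 'rV[R]_n => rV_cons y ord0 i) =
    (fun y => if unlift ord0 i is Some j then y.2 ord0 j else y.1).
  by apply/funext => y; rewrite mxE.
rewrite /prop_for /continuous_at E [rV_cons (a, z) ord0 i]mxE /=.
case: (unlift _ _) => [j|]; last exact: (@cvg_fst _ _ (nbhs a) (nbhs z)).
rewrite (_ : (fun y : R * 'rV[R]_n => y.2 ord0 j) = (fun z : 'rV[R]_n => z ord0 j) \o snd)//.
by apply: continuous_comp; [exact: (@cvg_snd _ _ (nbhs a) (nbhs z))|exact: coord_continuous].
Qed.

Lemma partial_support n i (f : 'rV[R]_n -> R) a M :
  (forall x, ~ box a M x -> f x = 0) -> forall x, ~ box a M x -> partial i f x = 0.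
Proof.
move=> f0 x nx; rewrite /partial.
have bo : open (~` box a M).
  by apply: closed_openC; apply: compact_closed; [exact: norm_hausdorff|exact: compact_box].
rewrite (@near_eq_derive _ _ _ f (cst 0)) ?derive_cst//.
  near=> y; apply: f0; near: y.
  exact: open_nbhs_nbhs.
Unshelve. all: by end_near. Qed.

(** Induction on the dimension with Fubini: if [i] is the first coordinate, the inner integral is
    computed by the fundamental theorem of calculus; otherwise the first coordinate is frozen and
    the induction hypothesis applies to the slice. *)
Lemma integral_partial0 n i (f : 'rV[R]_n -> R) M : 0 <= M -> continuous f ->
  (forall x, derivable f x (basis_vec i)) -> continuous (partial i f) ->
  (forall x, ~ box 0 M x -> f x = 0) ->
  (\int[mu n]_x (partial i f x)%:E)%E = 0%E.
Proof.
elim: n i f => [|n IH] i f M0 cf df cdf f0; first by case: i {df cdf}.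
have df0 := @partial_support n.+1 i f 0 M f0.
have intF := integrable_continuous_box M0 cdf df0.
have mF := continuous_measurable_rV cdf.
have mc := @measurable_rV_cons R n.
have mFE : measurable_fun [set: 'rV[R]_n.+1] (EFin \o partial i f) by exact/measurable_EFinP.
have intF' : (@lebesgue_measure R \x lebesgue_rV n)%E.-integrable setT
    ((EFin \o partial i f) \o @rV_cons R n).
  apply/integrableP; split.
    exact: (measurableT_comp mFE mc).
  have /integrableP[_] := intF; apply: le_lt_trans.
  rewrite [leRHS](ge0_integral_pushforward mc _ _ _) //.
  exact: measurableT_comp.
rewrite [LHS](@integral_pushforward _ _ _ _ _ _ mc _ setT) //=.
rewrite preimage_setT; case: (unliftP ord0 i) => [j|] ij.
- rewrite -[LHS]integral12_prod_meas1//= integral0_eq// => a _.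
  pose g y := f (rV_cons (a, y)).
  have EE y : (fun h : R => h^-1 *: ((g \o shift y) (h *: basis_vec j) - g y)) =
      (fun h => h^-1 *: ((f \o shift (rV_cons (a, y))) (h *: basis_vec (lift ord0 j)) -
                         f (rV_cons (a, y)))).
    by apply/funext => h; rewrite /= /g rV_cons_lift.
  have dE y : derivable g y (basis_vec j) = derivable f (rV_cons (a, y)) (basis_vec i).
    by rewrite /derivable ij EE.
  have pE y : partial j g y = partial i f (rV_cons (a, y)).
    by rewrite /partial /derive ij EE.
  have ca : continuous (fun y : 'rV[R]_n => (a, y)).
    by move=> y; exact: (@cvg_pair _ _ _ (nbhs y) (nbhs a) (nbhs y) _ _ _ (fun=> a) id (cvg_cst a) cvg_id).
  change ((\int[mu n]_y (partial i f (rV_cons (a, y)))%:E)%E = 0%E).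
  under eq_integral do rewrite -pE.
  apply: IH M0 _ _ _ _ => //.
  + by move=> y; apply: continuous_comp; [apply: continuous_comp; [exact: ca|exact: continuous_rV_cons]|exact: cf].
  + by move=> y; rewrite dE; exact: df.
  + rewrite (_ : partial j g = partial i f \o (@rV_cons R n \o (fun y => (a, y)))).
      by move=> y; apply: continuous_comp; [apply: continuous_comp; [exact: ca|exact: continuous_rV_cons]|exact: cdf].
    by apply/funext => y; rewrite pE.
  + move=> y ny; apply: f0 => nb; apply: ny => k.
    by have := nb (lift ord0 k); rewrite !mxE liftK /=.
- rewrite -[LHS]integral21_prod_meas1//= integral0_eq// => y _.
  pose g (t : R) := f (rV_cons (0, y) + t *: basis_vec ord0).
  rewrite ij in df cdf df0 *.
  have dg t : derivable g t 1 by rewrite -line_derivable; exact: df.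
  have g'E t : derive1 g t = partial ord0 f (rV_cons (t, y)).
    by rewrite derive1E -line_derive /partial [in RHS]rV_cons_line.
  have outside t : ~ (`[-M, M]%classic t) -> ~ box 0 M (rV_cons (t, y)).
    move=> nt b; apply: nt; have := b ord0; rewrite !mxE unlift_none/= subr0.
    by rewrite in_itv/= ler_norml.
  have ct : continuous (fun t : R => (t, y)).
    by move=> t; exact: (@cvg_pair _ _ _ (nbhs t) (nbhs t) (nbhs y) _ _ _ id (fun=> y) cvg_id (cvg_cst y)).
  pose g' (t : R) : R := partial ord0 f (rV_cons (t, y)).
  have cg' : continuous g'.
    by move=> t; apply: (continuous_comp (f := @rV_cons R n \o (fun t => (t, y))));
      [apply: continuous_comp; [exact: ct|exact: continuous_rV_cons]|exact: cdf].
  change ((\int[lebesgue_measure]_t (g' t)%:E)%E = 0%E).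
  have gE t : g t = f (rV_cons (t, y)) by rewrite /g [in RHS]rV_cons_line.
  (* The segment is wider than the support by 1 on each side, so that [f] is known to vanish at its
     endpoints. *)
  rewrite (_ : (\int[_]_x _)%E = (\int[lebesgue_measure]_(x in `[(- (M + 1))%R, (M + 1)%R]) (g' x)%:E)%E).
    rewrite (continuous_FTC2 (F := g)) //.
    + rewrite !gE (f0 (rV_cons (M + 1, y))); last first.
        by apply: outside; rewrite /= in_itv/= => /andP[h1 h2]; lra.
      rewrite (f0 (rV_cons (- (M + 1), y))) ?subee//.
      by apply: outside; rewrite /= in_itv/= => /andP[h1 h2]; lra.
    + by lra.
    + exact: continuous_subspaceT.
    + have cg t : {for t, continuous g} by apply: differentiable_continuous; apply/derivable1_diffP; exact: dg.
      split => //; first by apply: cvg_at_right_filter; exact: cg.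
      by apply: cvg_at_left_filter; exact: cg.
  rewrite [RHS]integral_mkcond; apply: eq_integral => t _; rewrite patchE; case: ifPn => //.
  rewrite notin_setE/= in_itv/= => nt; rewrite /g' df0//; apply: outside => /=.
  rewrite in_itv/= => /andP[? ?]; apply: nt; apply/andP; split; lra.
Qed.

End measure_rV.

(** * Integration by parts *)

Section ibp.
Context {R : realType}.
Local Notation mu n := (lebesgue_rV n : measure _ R).

Lemma coord_le_norm n (x : 'rV[R]_n) i : `|x ord0 i| <= `|x|.
Proof.
rewrite [leRHS]/Num.norm /= mx_normrE.
by apply/bigmax_geP; right => /=; exists (ord0, i).
Qed.

Section compact_support.
Context n (O : set 'rV[R]_n).

Definition csupp (phi : 'rV[R]_n -> R) :=
  compact (closure [set x | phi x != 0]) /\ closure [set x | phi x != 0] `<=` O.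

Lemma nonsupp_near (phi : 'rV[R]_n -> R) x : ~ closure [set x | phi x != 0] x ->
  \forall y \near x, phi y = 0.
Proof.
move=> nx; have : open (~` closure [set x | phi x != 0]).
  by apply: closed_openC; exact: closed_closure.
move=> oc; have : nbhs x (~` closure [set x | phi x != 0]) by exact: open_nbhs_nbhs.
apply: (@filterS _ (nbhs x)) => y ny.
by apply/eqP/negPn/negP => py; apply: ny; exact: subset_closure.
Qed.

Lemma csupp_partial (phi : 'rV[R]_n -> R) i : csupp phi -> csupp (partial i phi).
Proof.
move=> [cphi sphi].
suff sub : closure [set x | partial i phi x != 0] `<=` closure [set x | phi x != 0].
  split; last exact: subset_trans sphi.
  by apply: (subclosed_compact _ cphi) => //; exact: closed_closure.
rewrite [X in _ `<=` X](closure_id _).1; last exact: closed_closure.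
apply: closure_subset => x /= px; apply: contrapT => nx.
move: px; rewrite /partial (@near_eq_derive _ _ _ phi (cst 0)) ?derive_cst ?eqxx//.
exact: nonsupp_near.
Qed.

Lemma csupp_box (phi : 'rV[R]_n -> R) : csupp phi ->
  exists2 M, 0 <= M & forall x, ~ box 0 M x -> phi x = 0.
Proof.
move=> [/compact_bounded[M [_ HM]] _].
exists (`|M| + 1) => [|x nx]; first by rewrite addr_ge0.
apply/eqP/negPn/negP => px; apply: nx => i; rewrite mxE subr0.
rewrite (le_trans (coord_le_norm _ _))//; apply: HM.
  by rewrite (le_lt_trans (ler_norm _))// ltrDl.
exact: subset_closure.
Qed.

Lemma csupp_mul_continuous (f phi : 'rV[R]_n -> R) : csupp phi ->
  {in O, continuous f} -> continuous phi -> continuous (fun x => f x * phi x).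
Proof.
move=> [_ sphi] cf cphi x.
have [Ox|nx] := pselect (closure [set x | phi x != 0] x).
  by apply: cvgM (cphi x); apply: cf; rewrite inE; exact: sphi.
have near0 : \forall y \near x, f y * phi y = 0.
  by have := nonsupp_near nx; apply: (@filterS _ (nbhs x)) => y ->; rewrite mulr0.
have E : f x * phi x = 0 by exact: (@nbhs_singleton _ x (fun y => f y * phi y = 0)).
by rewrite /continuous_at E; exact: (@cvg_near_cst _ _ 0 _ (nbhs x)).
Qed.

Lemma csupp_integrable (f phi : 'rV[R]_n -> R) : csupp phi ->
  {in O, continuous f} -> continuous phi ->
  (mu n).-integrable setT (EFin \o (fun x => f x * phi x)).
Proof.
move=> sphi cf cphi; have [M M0 HM] := csupp_box sphi.
apply: (@integrable_continuous_box _ _ _ 0 M) => //; first exact: csupp_mul_continuous.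
by move=> x /HM ->; rewrite mulr0.
Qed.

Lemma csupp_notin (phi : 'rV[R]_n -> R) x : csupp phi -> ~ O x -> phi x = 0.
Proof.
move=> [_ sphi] nx; apply/eqP/negPn/negP => px; apply: nx; apply: sphi.
exact: subset_closure.
Qed.

Lemma csupp_RintegralT (f phi : 'rV[R]_n -> R) : csupp phi ->
  \int[mu n]_(x in O) (f x * phi x) = \int[mu n]_x (f x * phi x).
Proof.
move=> sphi; rewrite Rintegral_mkcond; congr (fine (integral _ _ _)).
apply/funext => x; rewrite patchE; case: ifPn => //.
by rewrite notin_setE => nx; rewrite (csupp_notin sphi)// mulr0.
Qed.

(** Regularity of [f] is required on [O] only: [phi] vanishes near every point outside its support,
    so the product is regular on the whole space whatever [f] is there, and its partial derivative
    has integral 0. *)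
Lemma integration_by_parts_csupp (f phi : 'rV[R]_n -> R) i : csupp phi ->
  {in O, continuous f} -> (forall x, O x -> derivable f x (basis_vec i)) ->
  {in O, continuous (partial i f)} ->
  continuous phi -> (forall x, derivable phi x (basis_vec i)) ->
  continuous (partial i phi) ->
  \int[mu n]_x (partial i f x * phi x) = - \int[mu n]_x (f x * partial i phi x).
Proof.
move=> sphi cf df cdf cphi dphi cdphi.
pose psi x := f x * phi x.
have sdphi := csupp_partial i sphi.
have dpsi x : is_derive x (basis_vec i) psi (partial i f x * phi x + f x * partial i phi x).
  have [Ox|nx] := pselect (closure [set x | phi x != 0] x).
    have /df/derivableP dfx : O x by apply: sphi.2.
    have /derivableP dpx := dphi x.
    by apply: is_derive_eq; rewrite addrC mulrC.
  have near0 := nonsupp_near nx.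
  have -> : partial i phi x = 0.
    by rewrite /partial (@near_eq_derive _ _ _ phi (cst 0)) ?derive_cst.
  rewrite (@nbhs_singleton _ x (fun y => phi y = 0) near0) !mulr0 addr0.
  apply: (@near_eq_is_derive _ _ _ (cst 0)) => //.
  by move: near0; apply: (@filterS _ (nbhs x)) => y py; rewrite /psi py mulr0.
have pE : partial i psi = (fun x => partial i f x * phi x + f x * partial i phi x).
  by apply/funext => x; exact: derive_val.
have [M M0 HM] := csupp_box sphi.
have c1 := csupp_mul_continuous sphi cdf cphi.
have c2 := csupp_mul_continuous sdphi cf cdphi.
have : (\int[mu n]_x (partial i psi x)%:E)%E = 0%E.
  apply: (integral_partial0 M0).
  - exact: csupp_mul_continuous.
  - by move=> x; exact: ex_derive.
  - by rewrite pE => x; exact: cvgD (c1 x) (c2 x).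
  - by move=> x /HM; rewrite /psi => ->; rewrite mulr0.
have i1 := csupp_integrable sphi cdf cphi.
have i2 := csupp_integrable sdphi cf cdphi.
move=> /(congr1 fine) /=; rewrite -/(Rintegral _ _ _) pE RintegralD//.
by move/eqP; rewrite addr_eq0 => /eqP.
Qed.

End compact_support.
End ibp.

(** * Bump functions *)

Section directional.
Context {R : realType}.

Lemma is_derive_line (V : normedModType R) (f : V -> R) x v d :
  is_derive x v f d <-> is_derive (0 : R) 1 (fun t : R => f (x + t *: v)) d.
Proof.
have D := line_derivable f x v 0; have E := line_derive f x v 0.
rewrite scale0r addr0 in D E.
by split=> -[df dfE]; split; rewrite ?D -?E// -?D// E.
Qed.

Lemma is_derive_chain (V : normedModType R) (g : V -> R) (f : R -> R) x v dg df :
  is_derive x v g dg -> is_derive (g x) 1 f df ->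
  is_derive x v (fun y => f (g y)) (df * dg).
Proof.
move=> /is_derive_line gx fx; apply/is_derive_line.
apply: is_derive1_comp => //.
by rewrite scale0r addr0.
Qed.

Lemma is_derive_coord n (x : 'rV[R]_n) i j :
  is_derive x (basis_vec j) (fun y : 'rV[R]_n => y ord0 i) (i == j)%:R.
Proof.
apply/is_derive_line.
rewrite (_ : (fun t : R => _) = (fun t : R => x ord0 i + t * (i == j)%:R)).
  by apply: is_derive_eq; rewrite /GRing.scale/=; ring.
by apply/funext => t; rewrite !mxE.
Qed.

End directional.

(** * A smooth function that is flat at the origin *)

Section flat.
Context {R : realType}.
Implicit Types t : R.

(* Linear combinations of these functions are stable under differentiation,
   whence the smoothness of [flat 0]. *)
Definition flat (n : nat) t : R := if 0 < t then t ^- n * expR (- t^-1) else 0.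

Lemma flat_le n t : 0 < t -> flat n t <= (n.+2)`!%:R * t ^+ 2.
Proof.
move=> t0; rewrite /flat t0.
have := expR_ge1Dxn n.+1 (ltW (_ : 0 < t^-1)); rewrite invr_gt0 => /(_ t0) H.
have f0 : 0 < (n.+2)`!%:R :> R by rewrite ltr0n fact_gt0.
have {}H : t^-1 ^+ n.+2 <= (n.+2)`!%:R * expR t^-1.
  by rewrite mulrC -ler_pdivrMr// (le_trans _ H)// lerDr.
rewrite expRN ler_pdivrMr ?expR_gt0//.
have -> : t ^- n = t ^+ 2 * t^-1 ^+ n.+2.
  by rewrite -exprVn !exprS expr0; field; rewrite gt_eqF.
by rewrite [X in _ <= X * _]mulrC -[leRHS]mulrA ler_pM2l ?exprn_gt0.
Qed.

Lemma flat_ge0 n t : 0 <= flat n t.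
Proof.
rewrite /flat; case: ifPn => // t0; rewrite mulr_ge0 ?expR_ge0//.
by rewrite invr_ge0 exprn_ge0// ltW.
Qed.

Lemma flat_gt0 n t : 0 < t -> 0 < flat n t.
Proof. by move=> t0; rewrite /flat t0 mulr_gt0 ?expR_gt0// invr_gt0 exprn_gt0. Qed.

Lemma flat_eq0 n t : t <= 0 -> flat n t = 0.
Proof. by rewrite /flat ltNge => ->. Qed.

Lemma is_derive_flat n t : is_derive t 1 (flat n) (flat n.+2 t - n%:R * flat n.+1 t).
Proof.
have [t0|t0|t0] := ltgtP t 0.
- rewrite !flat_eq0 ?ltW// mulr0 subr0.
  apply: (@near_eq_is_derive _ _ _ (cst 0)).
  near=> s; rewrite flat_eq0//= ltW//; near: s.
  exact: lt_nbhsl.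
- apply: (@near_eq_is_derive _ _ _ (fun s : R => s ^- n * expR (- s^-1))).
    near=> s; rewrite /flat ifT//; near: s; exact: lt_nbhsr.
  rewrite /flat t0.
  have tn0 : t != 0 by rewrite gt_eqF.
  have dV : is_derive t 1 (fun s : R => s^-1) (- t ^- 2).
    apply: (is_derive_eq (is_deriveV (f := id) tn0 (is_derive_id t 1))).
    by rewrite /GRing.scale/= mulr1.
  have dN : is_derive t 1 (fun s : R => - s^-1) (t ^- 2).
    by apply: is_derive_eq; rewrite opprK.
  have dE : is_derive t 1 (fun s : R => expR (- s^-1)) (expR (- t^-1) * t ^- 2).
    exact: is_derive1_comp.
  have dX : is_derive t 1 (fun s : R => s ^- n) (- n%:R * t ^- n.+1).
    rewrite (_ : (fun s => _) = (fun s : R => s^-1) ^+ n); last first.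
      by apply/funext => s; rewrite exprfctE exprVn.
    apply: is_derive_eq; rewrite /GRing.scale/=.
    case: (n) => [|m]; first by rewrite oppr0 !mul0r.
    by rewrite /= -!exprVn !exprS; ring.
  apply: is_derive_eq; rewrite /GRing.scale/= !exprS; field.
  by rewrite expf_neq0.
- rewrite t0 !flat_eq0// mulr0 subr0; apply/is_derive1_caratheodory.
  (* The difference quotient of [flat n] at 0 is [flat n.+1] itself, and the quadratic bound
     [flat_le] squeezes it to 0. *)
  exists (flat n.+1); split; last by rewrite flat_eq0//.
    move=> z; rewrite subr0 (flat_eq0 _ (lexx 0)) subr0.
    have [z0|z0] := leP z 0; first by rewrite !flat_eq0// mul0r.
    have zn0 : z != 0 by rewrite gt_eqF.
    by rewrite /flat z0 exprS; field; rewrite ?zn0 ?expf_neq0.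
  rewrite /prop_for /continuous_at flat_eq0//.
  apply: (@squeeze_cvgr _ _ _ _ (cst 0) (fun z => (n.+3)`!%:R * z ^+ 2)).
  - near=> z; rewrite flat_ge0/=; have [z0|z0] := leP z 0; last exact: flat_le.
    by rewrite flat_eq0// mulr_ge0// sqr_ge0.
  - exact: cvg_cst.
  - rewrite -[X in _ --> X](mulr0 (n.+3)`!%:R); apply: cvgMr.
    by rewrite -[X in _ --> X](expr0n R 2); exact: exprn_continuous.
Unshelve. all: by end_near. Qed.

End flat.

Section smooth_rV.
Context {R : realType} {n : nat}.
Implicit Types f g : 'rV[R]_n -> R.

(** Smoothness is graded by a finite order so that stability under products follows by induction:
    the derivative of a product of order [k.+1] only involves products of order [k]. *)
Fixpoint Ck (k : nat) f : Prop :=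
  continuous f /\
  if k is k'.+1 then
    (forall i x, derivable f x (basis_vec i)) /\ forall i, Ck k' (partial i f)
  else True.

Lemma CkW k f : Ck k.+1 f -> Ck k f.
Proof.
elim: k f => [|k IH] f; first by case.
by move=> [cf [df pf]]; split => //; split => // i; apply: IH; exact: pf.
Qed.

Lemma Ck_cst k (c : R) : Ck k (fun=> c).
Proof.
elim: k c => [|k IH] c; first by split => //; exact: cst_continuous.
split; first exact: cst_continuous.
split=> [i x|i]; first exact: derivable_cst.
rewrite (_ : partial _ _ = fun=> 0) //.
by apply/funext => x; rewrite /partial derive_cst.
Qed.

Lemma CkD k f g : Ck k f -> Ck k g -> Ck k (fun x => f x + g x).
Proof.
elim: k f g => [|k IH] f g [cf H] [cg H'].
  by split => // x; exact: cvgD (cf x) (cg x).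
split; first by move=> x; exact: cvgD (cf x) (cg x).
move: H H' => [df pf] [dg pg]; split => [i x|i]; first exact: derivableD.
rewrite (_ : partial _ _ = (fun x => partial i f x + partial i g x)); first exact: IH (pf i) (pg i).
by apply/funext => x; rewrite /partial [LHS]deriveD.
Qed.

Lemma CkM k f g : Ck k f -> Ck k g -> Ck k (fun x => f x * g x).
Proof.
elim: k f g => [|k IH] f g Hf Hg; have [cf H] := Hf; have [cg H'] := Hg.
  by split => // x; exact: cvgM (cf x) (cg x).
split; first by move=> x; exact: cvgM (cf x) (cg x).
move: H H' => [df pf] [dg pg]; split => [i x|i]; first exact: derivableM.
rewrite (_ : partial _ _ = (fun x => f x * partial i g x + g x * partial i f x)).
  by apply: CkD; [exact: IH (CkW Hf) (pg i)|exact: IH (CkW Hg) (pf i)].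
by apply/funext => x; rewrite /partial [LHS]deriveM.
Qed.

Lemma Ck_prod k (F : 'I_n -> 'rV[R]_n -> R) s : (forall i, Ck k (F i)) ->
  Ck k (fun x => \prod_(i <- s) F i x).
Proof.
move=> HF; elim: s => [|i s IH].
  by under eq_fun do rewrite big_nil; exact: Ck_cst.
by under eq_fun do rewrite big_cons; exact: CkM.
Qed.

Lemma Ck_flat k m i (a c : R) : Ck k (fun x => flat m (c * x ord0 i + a)).
Proof.
have D p (x : 'rV[R]_n) j : is_derive x (basis_vec j) (fun x => flat p (c * x ord0 i + a))
    ((flat p.+2 (c * x ord0 i + a) - p%:R * flat p.+1 (c * x ord0 i + a)) * (c * (i == j)%:R)).
  have H := is_derive_coord x i j.
  have H2 : is_derive x (basis_vec j) (fun y : 'rV[R]_n => c * y ord0 i + a) (c * (i == j)%:R).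
    by apply: is_derive_eq; rewrite /GRing.scale/=; ring.
  exact: (is_derive_chain H2 (is_derive_flat p _)).
have C p : continuous (fun x : 'rV[R]_n => flat p (c * x ord0 i + a)).
  move=> x; apply: (@continuous_comp _ _ _ (fun x : 'rV[R]_n => c * x ord0 i + a) (flat p)).
    exact: cvgD (cvgM (cvg_cst c) (@coord_continuous R 1 n ord0 i x)) (cvg_cst a).
  apply: differentiable_continuous; apply/derivable1_diffP.
  by have := is_derive_flat p (c * x ord0 i + a) => ?; exact: ex_derive.
elim: k m => [|k IH] m; split => //.
split => [j x|j]; first by have := D m x j => ?; exact: ex_derive.
rewrite (_ : partial _ _ = (fun x => (flat m.+2 (c * x ord0 i + a) +
    - m%:R * flat m.+1 (c * x ord0 i + a)) * (c * (i == j)%:R))).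
  by apply: CkM; [apply: CkD; [exact: IH|apply: CkM; [exact: Ck_cst|exact: IH]]|exact: Ck_cst].
by apply/funext => x; have := D m x j => ?; rewrite /partial derive_val mulNr.
Qed.

Lemma Ck_test_function (O : set 'rV[R]_n) f : (forall k, Ck k f) -> csupp O f ->
  test_function O f.
Proof.
move=> Cf [cs ss].
have HC s : forall k, Ck k (iter_partial s f).
  by elim: s => [|i s IH] k //=; have [_ [_]] := IH k.+1; exact.
split => //= [s|s i x]; first by have [] := HC s 0%N.
by have [_ [+ _]] := HC s 1%N; exact.
Qed.

(** The coefficients [1] and [-1] give both factors the shape [flat m (c * x ord0 i + a)] treated by
    [Ck_flat]; the product is positive exactly in the open cube. *)
Definition bump (a : 'rV[R]_n) (h : R) (x : 'rV[R]_n) : R :=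
  \prod_(i < n) (flat 0 (1 * x ord0 i + (h - a ord0 i)) *
                 flat 0 (-1 * x ord0 i + (h + a ord0 i))).

Lemma bump_ge0 a h x : 0 <= bump a h x.
Proof. by apply: prodr_ge0 => i _; rewrite mulr_ge0// flat_ge0. Qed.

Lemma bump_gt0 a h x : obox a h x -> 0 < bump a h x.
Proof.
move=> ax; apply: prodr_gt0 => i _; have := ax i; rewrite ltr_norml => /andP[h1 h2].
by apply: mulr_gt0; apply: flat_gt0; lra.
Qed.

Lemma bump_eq0 a h x : ~ box a h x -> bump a h x = 0.
Proof.
move=> /existsNP[i /negP]; rewrite -ltNge => ax; rewrite /bump (bigD1 i)//=.
have [h1|h1] := leP (1 * x ord0 i + (h - a ord0 i)) 0; first by rewrite (flat_eq0 _ h1) !mul0r.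
rewrite (@flat_eq0 _ 0 (-1 * _ + _)) ?mulr0 ?mul0r//.
rewrite leNgt; apply/negP => h2; move: ax; rewrite ltNge => /negP; apply.
by rewrite ler_norml; apply/andP; split; lra.
Qed.

Lemma bump_test_function (O : set 'rV[R]_n) a h : box a h `<=` O ->
  test_function O (bump a h).
Proof.
move=> aO; apply: Ck_test_function => [k|].
  by apply: (@Ck_prod k (fun i x => _ * _)) => i; apply: CkM; exact: Ck_flat.
have bsub : closure [set x | bump a h x != 0] `<=` box a h.
  rewrite [X in _ `<=` X](closure_id _).1; last first.
    by apply: compact_closed; [exact: norm_hausdorff|exact: compact_box].
  apply: closure_subset => x /= bx; apply: contrapT => nx.
  by move: bx; rewrite bump_eq0// eqxx.
split; last exact: subset_trans aO.
by apply: (subclosed_compact _ (@compact_box R n a h) bsub); exact: closed_closure.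
Qed.

End smooth_rV.

Lemma continuous_at_sum {R : realType} (T : topologicalType) (I : Type) (s : seq I)
    (F : I -> T -> R) x : (forall i, {for x, continuous (F i)}) ->
  {for x, continuous (fun y => \sum_(i <- s) F i y)}.
Proof.
move=> cF; elim: s => [|i s IH].
  rewrite /prop_for /continuous_at big_nil (_ : (fun y => _) = cst 0).
    exact: cvg_cst.
  by apply/funext => y; rewrite big_nil.
rewrite /prop_for /continuous_at big_cons.
rewrite (_ : (fun y => _) = (fun y => F i y + \sum_(j <- s) F j y)).
  exact: cvgD (cF i) IH.
by apply/funext => y; rewrite big_cons.
Qed.

(** * Functions of class C^2 on an open set, tested against smooth functions *)

Section C2_functions.
Context {R : realType} {n : nat}.
Local Notation mu := (lebesgue_rV n : measure _ R).
Implicit Types (f phi : 'rV[R]_n -> R) (O K : set 'rV[R]_n).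

Definition C2_in O f :=
  [/\ {in O, continuous f},
      forall i x, O x -> derivable f x (basis_vec i),
      forall i, {in O, continuous (partial i f)},
      forall i j x, O x -> derivable (partial i f) x (basis_vec j) &
      forall i j, {in O, continuous (partial j (partial i f))}].

Lemma continuous_within_open O K f : open O -> O `<=` K ->
  {within K, continuous f} -> {in O, continuous f}.
Proof.
move=> oO OK cf x xO; have Ox : O x by rewrite inE in xO.
have : {within O, continuous f} by exact: continuous_subspaceW cf.
by rewrite continuous_open_subspace// => /(_ x xO).
Qed.

Lemma extends_continuously_in O K f : open O -> O `<=` K ->
  extends_continuously O K f -> {in O, continuous f}.
Proof.
move=> oO OK [g cg fg] x xO; have Ox : O x by rewrite inE in xO.
have cgx := continuous_within_open oO OK cg xO.
rewrite /continuous_at (fg x xO).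
apply: cvg_trans cgx; apply: (@near_eq_cvg _ _ (nbhs x) _ g f).
have : nbhs x O by exact: open_nbhs_nbhs.
by apply: (@filterS _ (nbhs x)) => y Oy; rewrite fg// inE.
Qed.

Lemma C2_upto_in O K f : open O -> O `<=` K -> C2_upto O K f -> C2_in O f.
Proof.
move=> oO OK [cf df cdf ddf cddf]; split => //.
- exact: (continuous_within_open oO OK cf).
- by move=> i; exact: (extends_continuously_in oO OK (cdf i)).
- by move=> i j; exact: (extends_continuously_in oO OK (cddf i j)).
Qed.

Lemma C2_in_sub O O' f : O' `<=` O -> C2_in O f -> C2_in O' f.
Proof.
move=> OO [cf df cdf ddf cddf]; split.
- by move=> x; rewrite inE => /OO Ox; apply: cf; rewrite inE.
- by move=> i x /OO; exact: df.
- by move=> i x; rewrite inE => /OO Ox; apply: cdf; rewrite inE.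
- by move=> i j x /OO; exact: ddf.
- by move=> i j x; rewrite inE => /OO Ox; apply: cddf; rewrite inE.
Qed.

Lemma laplacian_continuous O f : C2_in O f -> {in O, continuous (laplacian f)}.
Proof.
move=> [_ _ _ _ cddf] x xO.
by apply: continuous_at_sum => i; exact: cddf.
Qed.

Lemma test_function_sub O O' phi : O' `<=` O -> test_function O' phi -> test_function O phi.
Proof. by move=> OO [h1 h2 h3 h4]; split => //; exact: subset_trans OO. Qed.

Lemma test_function_csupp O phi : test_function O phi -> csupp O phi.
Proof. by case. Qed.

Lemma test_function_continuous O phi : test_function O phi -> continuous phi.
Proof. by move=> [h1 _ _ _]; exact: (h1 [::]). Qed.

Lemma test_function_derivable O phi i x : test_function O phi ->
  derivable phi x (basis_vec i).
Proof. by move=> [_ h2 _ _]; exact: (h2 [::]). Qed.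

Lemma test_function_partial O phi i : test_function O phi ->
  test_function O (partial i phi).
Proof.
move=> t; have [c1 c2] := csupp_partial i (test_function_csupp t).
case: t => h1 h2 _ _.
have E s : iter_partial s (partial i phi) = iter_partial (rcons s i) phi.
  by rewrite /iter_partial foldr_rcons.
by split => // [s|s j x]; rewrite E; [exact: h1|exact: h2].
Qed.

Lemma ibp_test O f phi i : test_function O phi ->
  {in O, continuous f} -> (forall x, O x -> derivable f x (basis_vec i)) ->
  {in O, continuous (partial i f)} ->
  \int[mu]_x (partial i f x * phi x) = - \int[mu]_x (f x * partial i phi x).
Proof.
move=> t cf df cdf; apply: (integration_by_parts_csupp (test_function_csupp t)) => //.
- exact: test_function_continuous t.
- by move=> x; exact: test_function_derivable t.
- exact: test_function_continuous (test_function_partial i t).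
Qed.

Lemma test_integrable O f phi : test_function O phi -> {in O, continuous f} ->
  mu.-integrable setT (EFin \o (fun x => f x * phi x)).
Proof.
by move=> t cf; apply: (csupp_integrable (test_function_csupp t)) => //;
  exact: test_function_continuous t.
Qed.

Lemma test_RintegralT O O' f phi : O' `<=` O -> test_function O' phi ->
  \int[mu]_(x in O) (f x * phi x) = \int[mu]_x (f x * phi x).
Proof.
by move=> OO t; apply: csupp_RintegralT; apply: test_function_csupp;
  exact: test_function_sub t.
Qed.

Lemma integrable_sumr (I : Type) (s : seq I) (F : I -> 'rV[R]_n -> R) :
  (forall i, mu.-integrable setT (EFin \o F i)) ->
  mu.-integrable setT (EFin \o (fun x => \sum_(i <- s) F i x)).
Proof.
move=> iF; elim: s => [|i s IH].
  by under [X in EFin \o X]eq_fun do rewrite big_nil; exact: integrable0.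
under [X in EFin \o X]eq_fun do rewrite big_cons.
exact: (integrableD measurableT (iF i) IH).
Qed.

Lemma Rintegral_sumr (I : Type) (s : seq I) (F : I -> 'rV[R]_n -> R) :
  (forall i, mu.-integrable setT (EFin \o F i)) ->
  \int[mu]_x (\sum_(i <- s) F i x) = \sum_(i <- s) \int[mu]_x F i x.
Proof.
move=> iF; elim: s => [|i s IH].
  by under eq_Rintegral do rewrite big_nil; rewrite big_nil /Rintegral integral0.
under eq_Rintegral do rewrite big_cons.
by rewrite big_cons -IH RintegralD//; exact: integrable_sumr.
Qed.

Lemma laplacian_test O f phi : test_function O phi -> C2_in O f ->
  \int[mu]_x (f x * laplacian phi x) = \int[mu]_x (laplacian f x * phi x).
Proof.
move=> t [cf df cdf ddf cddf]; rewrite /laplacian.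
under eq_Rintegral do rewrite mulr_sumr.
under [RHS]eq_Rintegral do rewrite mulr_suml.
rewrite !Rintegral_sumr; last 2 first.
- by move=> i; exact: test_integrable t (cddf i i).
- by move=> i; exact: test_integrable (test_function_partial i (test_function_partial i t)) cf.
apply: eq_bigr => i _.
have ti := test_function_partial i t.
by rewrite (ibp_test t (cdf i) (ddf i i) (cddf i i)) (ibp_test ti cf (df i) (cdf i)) opprK.
Qed.

End C2_functions.

(** * Weak limits *)

Section weak_limits.
Context {R : realType} {n : nat}.
Local Notation mu := (lebesgue_rV n : measure _ R).
Implicit Types (f phi : 'rV[R]_n -> R) (O K : set 'rV[R]_n).

Lemma Rintegral_gt0_rV f a : mu.-integrable setT (EFin \o f) -> continuous f ->
  (forall x, 0 <= f x) -> 0 < f a -> 0 < \int[mu]_x f x.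
Proof.
move=> intf cf f0 fa.
have : \forall x \near a, f a / 2 < f x.
  by apply: (cvgr_gt (f a) (cf a)); rewrite ltr_pdivrMr// ltr_pMr// ltr1n.
move=> /nbhs_rVP[e e0 He].
have mb : measurable (box a (e / 2)) by exact: measurable_box.
have mf := continuous_measurable_rV cf.
have : (((f a / 2) * (e / 2 *+ 2) ^+ n)%:E <= \int[mu]_x (f x)%:E)%E.
  rewrite EFinM -(lebesgue_rV_box a); last by rewrite divr_ge0// ltW.
  rewrite -[leLHS](integral_cst mu mb).
  apply: (@le_trans _ _ (\int[mu]_(x in box a (e / 2)) (f x)%:E)%E).
    apply: ge0_le_integral => //=.
    - by move=> x _; rewrite lee_fin divr_ge0// ltW.
    - exact/measurable_EFinP/measurable_funTS.
    - move=> x bx; rewrite lee_fin ltW//; apply: He => i.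
      by rewrite (le_lt_trans (bx i))// ltr_pdivrMr// ltr_pMr// ltr1n.
  apply: ge0_subset_integral => //; first exact/measurable_EFinP.
  by move=> x _; rewrite lee_fin.
have fin := integrable_fin_num measurableT intf.
rewrite -[X in (_ <= X)%E]fineK// lee_fin; apply: lt_le_trans.
by rewrite mulr_gt0 ?divr_gt0// exprn_gt0// mulrn_wgt0// divr_gt0.
Qed.

(** The fundamental lemma of the calculus of variations, in the form used below: a strict pointwise
    inequality between continuous functions is detected by a nonnegative test function supported
    near the point. *)
Lemma bump_integral_gt0 O f a : open O -> {in O, continuous f} -> O a -> 0 < f a ->
  exists phi, [/\ test_function O phi, forall x, 0 <= phi x & 0 < \int[mu]_x (f x * phi x)].
Proof.
move=> oO cf Oa fa.
have cfa : f @ a --> f a by apply: cf; rewrite inE.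
have : \forall x \near a, 0 < f x by apply: (cvgr_gt (f a) cfa).
move=> /nbhs_rVP[e1 e10 H1].
have /nbhs_rVP[e2 e20 H2] : nbhs a O by exact: open_nbhs_nbhs.
pose h := Num.min e1 e2 / 2.
have m0 : 0 < Num.min e1 e2 by rewrite lt_min e10.
have h0 : 0 < h by rewrite divr_gt0.
have hm : h < Num.min e1 e2 by rewrite ltr_pdivrMr// ltr_pMr// ltr1n.
have box1 x : box a h x -> 0 < f x.
  by move=> bx; apply: H1 => i; rewrite (le_lt_trans (bx i))// (lt_le_trans hm)// ge_min lexx.
have box2 : box a h `<=` O.
  by move=> x bx; apply: H2 => i; rewrite (le_lt_trans (bx i))// (lt_le_trans hm)// ge_min lexx orbT.
have t := bump_test_function box2.
exists (bump a h); split => //; first exact: bump_ge0.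
apply: (@Rintegral_gt0_rV _ a).
- exact: test_integrable t cf.
- apply: (csupp_mul_continuous (test_function_csupp t) cf).
  exact: test_function_continuous t.
- move=> x; have [bx|nbx] := pselect (box a h x); last by rewrite bump_eq0// mulr0.
  by rewrite mulr_ge0 ?bump_ge0// ltW// box1.
- by rewrite mulr_gt0// bump_gt0// => i; rewrite subrr normr0.
Qed.

Lemma test_function_L2 O phi : test_function O phi -> L2 O phi.
Proof.
move=> t; have [M M0 HM] := csupp_box (test_function_csupp t).
have cphi := test_function_continuous t.
rewrite /L2 (_ : phi \_ O = phi); last first.
  apply/funext => x; rewrite patchE; case: ifPn => //; rewrite notin_setE => nO.
  by rewrite (csupp_notin (test_function_csupp t) nO).
have mphi := continuous_measurable_rV cphi.
apply/andP; split; rewrite inE//= /finite_norm unlock /Lnorm.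
apply: poweR_lty.
have c2 : continuous (fun x => phi x * phi x) by move=> x; exact: cvgM (cphi x) (cphi x).
have i2 : mu.-integrable setT (EFin \o (fun x => phi x * phi x)).
  by apply: (integrable_continuous_box M0 c2) => x /HM ->; rewrite mul0r.
have := integrable_lty measurableT i2.
congr (_ < _)%E; apply: eq_integral => x _ /=.
by rewrite -[X in _ = (_ `^ X)%:E]/(2%:R) powR_mulrn// -normrX expr2 ger0_norm// -expr2 sqr_ge0.
Qed.

Lemma test_function_H1 O phi : test_function O phi ->
  in_H1 O phi (fun i => partial i phi).
Proof.
move=> t; split => [|i|psi tpsi i]; first exact: test_function_L2.
  exact: test_function_L2 (test_function_partial i t).
rewrite (test_RintegralT _ (@subset_refl _ O) (test_function_partial i tpsi)).
rewrite (test_RintegralT _ (@subset_refl _ O) tpsi).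
rewrite (ibp_test tpsi) ?opprK//.
- by move=> x _; exact: test_function_continuous t x.
- by move=> x _; exact: test_function_derivable t.
- by move=> x _; exact: test_function_continuous (test_function_partial i t) x.
Qed.

Lemma H1_inner_test O O' f phi : open O -> C2_in O f -> O' `<=` O -> test_function O' phi ->
  H1_inner O f (fun i => partial i f) phi (fun i => partial i phi) =
  \int[mu]_x ((f x - laplacian f x) * phi x).
Proof.
move=> oO Cf OO t'; have t := test_function_sub OO t'.
have [cf df cdf ddf cddf] := Cf.
have ti i := test_function_partial i t.
rewrite /H1_inner Rintegral_mkcond.
rewrite (_ : _ \_ O = fun x => f x * phi x + \sum_i partial i f x * partial i phi x); last first.
  apply/funext => x; rewrite patchE; case: ifPn => //; rewrite notin_setE => nO.
  rewrite (csupp_notin (test_function_csupp t) nO) mulr0 big1 ?addr0// => i _.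
  by rewrite (csupp_notin (test_function_csupp (ti i)) nO) mulr0.
have I1 := test_integrable t cf.
have I2 i := test_integrable (ti i) (cdf i).
have I3 := test_integrable t (laplacian_continuous Cf).
have I4 i := test_integrable t (cddf i i).
have [S1 S2] : mu.-integrable setT (EFin \o (fun x => \sum_i partial i f x * partial i phi x)) /\
    \int[mu]_x (\sum_i partial i f x * partial i phi x) = - \int[mu]_x (laplacian f x * phi x).
  split.
    by apply: integrable_sumr => i; exact: I2.
  rewrite Rintegral_sumr// /laplacian.
  under [in RHS]eq_Rintegral do rewrite mulr_suml.
  rewrite Rintegral_sumr// -sumrN; apply: eq_bigr => i _.
  by rewrite (ibp_test t (cdf i) (ddf i i) (cddf i i)) opprK.
rewrite RintegralD// S2.
under [RHS]eq_Rintegral do rewrite mulrBl.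
by rewrite RintegralB.
Qed.

Lemma continuous_enorm : continuous (@enorm R n).
Proof.
move=> x; apply: (@continuous_comp _ _ _ (fun x : 'rV[R]_n => \sum_i x ord0 i ^+ 2) Num.sqrt).
  apply: continuous_at_sum => i.
  apply: (@continuous_comp _ _ _ (fun x : 'rV[R]_n => x ord0 i) (fun y => y ^+ 2)).
    exact: coord_continuous.
  exact: exprn_continuous.
exact: sqrt_continuous.
Qed.

Lemma open_eball r : open (eball r : set 'rV[R]_n).
Proof.
rewrite (_ : eball r = @enorm R n @^-1` [set y | y < r]); last by [].
by apply: open_comp; [move=> x _; exact: continuous_enorm|exact: open_lt].
Qed.

Lemma eball_sub_closed r : eball r `<=` (eclosed_ball r : set 'rV[R]_n).
Proof. by move=> x; rewrite /eball /eclosed_ball /= => /ltW. Qed.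

Lemma neumann_solution_C2 r p f : neumann_solution r p f -> C2_in (eball r) f.
Proof. by case=> /(C2_upto_in (open_eball (r := r)) (eball_sub_closed (r := r))). Qed.

(** If [u0 x < c], the equation makes [u0 - laplacian u0] smaller than [c]^ (q - 1)[near]x[, which a
    bump function detects. On the other hand]u k - laplacian (u k)[is at least]c [^ (p k - 1)] on
    [O]; tested against the same bump, both sides converge, and the inequality survives in the
    limit. *)
Lemma weak_lower_bound (r q c : R) (p : nat -> R) (u : nat -> 'rV[R]_n -> R)
    (u0 : 'rV[R]_n -> R) O :
  1 < q -> (forall k, 1 <= p k) -> p k @[k --> \oo] --> q ->
  (forall k, neumann_solution r (p k) (u k)) -> neumann_solution r q u0 ->
  weak_cvg_H1 (eball r) u u0 -> open O -> O `<=` eball r -> 0 < c ->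
  (\forall k \near \oo, forall x, O x -> c <= u k x) ->
  forall x, O x -> c <= u0 x.
Proof.
move=> q1 p1 pq su su0 uu0 oO Or c0 cu x Ox; rewrite leNgt; apply/negP => ux.
have C0 := neumann_solution_C2 su0.
have [_ u0_ge0 u0_eq _] := su0.
have C0' := C2_in_sub Or C0.
have cs : {in O, continuous (fun y => u0 y - laplacian u0 y)}.
  by move=> y yO; have [cf _ _ _ _] := C0'; exact: cvgB (cf y yO) (laplacian_continuous C0' yO).
have ch : {in O, continuous (fun y => c `^ (q - 1) - (u0 y - laplacian u0 y))}.
  by move=> y yO; exact: cvgB (cvg_cst _) (cs y yO).
have hx : 0 < c `^ (q - 1) - (u0 x - laplacian u0 x).
  rewrite subr_gt0 addrC u0_eq; last exact: Or.
  have u0x : 0 <= u0 x by apply: u0_ge0; exact: Or.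
  by apply: gt0_ltr_powR; rewrite ?subr_gt0 ?nnegrE//; exact: ltW.
have [phi [tphi phi0 Iphi]] := bump_integral_gt0 oO ch Ox hx.
have cc (a : R) : {in O, continuous (fun _ : 'rV[R]_n => a)} by move=> y _; exact: (@cst_continuous _ _ a y).
move: Iphi; under eq_Rintegral do rewrite mulrBl.
rewrite RintegralB//; [|exact: test_integrable tphi (cc _)|exact: test_integrable tphi cs].
apply/negP; rewrite -leNgt subr_le0.
have := uu0 phi _ (test_function_H1 (test_function_sub Or tphi)).
rewrite (H1_inner_test (open_eball (r := r)) C0 Or tphi) => L1.
have L2 : \int[mu]_x (c `^ (p k - 1) * phi x) @[k --> \oo] -->
    \int[mu]_x (c `^ (q - 1) * phi x).
  have I1 : mu.-integrable setT (EFin \o phi).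
    have := test_integrable tphi (cc 1).
    by under [X in EFin \o X]eq_fun do rewrite mul1r.
  have E a : \int[mu]_x (a * phi x) = a * \int[mu]_x (phi x) by rewrite RintegralZl.
  rewrite E; under eq_fun do rewrite E.
  have cpow : continuous (fun y : R => c `^ y).
    move=> y; rewrite /powR gt_eqF//.
    apply: (@continuous_comp _ _ _ (fun y : R => y * ln c) expR); last exact: continuous_expR.
    exact: mulrr_continuous.
  have pq1 : p k - 1 @[k --> \oo] --> q - 1 by apply: cvgB => //; exact: cvg_cst.
  by apply: cvgMl; exact: (cvg_comp (fun k => p k - 1) (powR c) pq1 (cpow (q - 1))).
apply: (ler_cvg_to L2 L1); near=> k.
have Ck := neumann_solution_C2 (su k).
have Ck' := C2_in_sub Or Ck.
rewrite (H1_inner_test (open_eball (r := r)) Ck Or tphi).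
apply: le_Rintegral => //.
+ exact: test_integrable tphi (cc _).
+ apply: (test_integrable tphi) => y yO.
  by have [cf _ _ _ _] := Ck'; exact: cvgB (cf y yO) (laplacian_continuous Ck' yO).
+ move=> y _; have [Oy|nOy] := pselect (O y); last first.
    by rewrite (csupp_notin (test_function_csupp tphi) nOy) !mulr0.
  have [_ _ eqk _] := su k; rewrite ler_wpM2r//.
  rewrite [leRHS]addrC eqk; last exact: Or.
  have cuk : c <= u k y by apply: (near cu k).
  by rewrite ge0_ler_powR ?subr_ge0 ?p1// nnegrE (le_trans (ltW c0)).
Unshelve. all: by end_near. Qed.

(** A test function supported away from the pole does not see the Dirac mass, and two integrations
    by parts turn the equation in the sense of distributions into a pointwise one. *)
Lemma green_pde (r : R) (G : 'rV[R]_n -> R) : neumann_green r 0 G ->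
  forall x, eball r x -> x != 0 -> laplacian G x = G x.
Proof.
move=> [_ CG dG _] x rx x0.
have oO : open (eball r `\ (0 : 'rV[R]_n)).
  by rewrite setDE; apply: openI; [exact: open_eball|apply: closed_openC; apply: accessible_closed_set1; apply: hausdorff_accessible; exact: norm_hausdorff].
have CO : C2_in (eball r `\ (0 : 'rV[R]_n)) G.
  by apply: (C2_upto_in oO _ CG) => y [ry y0]; split => //; exact: eball_sub_closed.
have Or : eball r `\ (0 : 'rV[R]_n) `<=` eball r by move=> y [].
have Ox : (eball r `\ (0 : 'rV[R]_n)) x by split => //=; exact/eqP.
have cG : {in eball r `\ (0 : 'rV[R]_n), continuous G} by case: CO.
have cs : {in eball r `\ (0 : 'rV[R]_n), continuous (fun y => G y - laplacian G y)}.
  by move=> y yO; exact: cvgB (cG y yO) (laplacian_continuous CO yO).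
have I0 phi : test_function (eball r `\ (0 : 'rV[R]_n)) phi ->
    \int[mu]_x ((G x - laplacian G x) * phi x) = 0.
  move=> t; have [_ _ _ _ cddG] := CO.
  have := dG _ (test_function_sub Or t).
  rewrite (csupp_notin (test_function_csupp t)); last by move=> [_ /=].
  move=> <-; rewrite [RHS]Rintegral_mkcond.
  have I1 := test_integrable t cG.
  have I2 := test_integrable t (laplacian_continuous CO).
  have I3 : mu.-integrable setT (EFin \o (fun x => G x * laplacian phi x)).
    rewrite /laplacian; under [X in EFin \o X]eq_fun do rewrite mulr_sumr.
    apply: integrable_sumr => i.
    exact: test_integrable (test_function_partial i (test_function_partial i t)) cG.
  under eq_Rintegral do rewrite mulrBl.
  rewrite [LHS]RintegralB// -(laplacian_test t CO) -RintegralB//.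
  apply: eq_Rintegral => y _; rewrite patchE; case: ifPn => [_|]; first by ring.
  rewrite notin_setE => nB.
  have nO : ~ (eball r `\ (0 : 'rV[R]_n)) y by move=> [].
  rewrite (csupp_notin (test_function_csupp t) nO) /laplacian big1 ?mulr0 ?subrr// => i _.
  exact: csupp_notin (test_function_csupp (test_function_partial i (test_function_partial i t))) nO.
have [h|h|//] := ltgtP (laplacian G x) (G x).
  have [|phi [t _]] := bump_integral_gt0 oO cs Ox; first by rewrite subr_gt0.
  by rewrite I0// ltxx.
have cs' : {in eball r `\ (0 : 'rV[R]_n), continuous (fun y => - (G y - laplacian G y))}.
  by move=> y yO; exact: cvgN (cs y yO).
have [|phi [t _]] := bump_integral_gt0 oO cs' Ox; first by rewrite opprB subr_gt0.
under eq_Rintegral do rewrite mulNr -mulN1r.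
rewrite RintegralZl//; last exact: test_integrable t cs.
by rewrite I0// mulr0 ltxx.
Qed.

End weak_limits.

(** * Radial functions *)

Section radial.
Context {R : realType} {n : nat}.
Implicit Types (x y : 'rV[R]_n).

Lemma enorm_ge0 x : 0 <= enorm x.
Proof. exact: sqrtr_ge0. Qed.

Lemma enorm_sq x : enorm x ^+ 2 = \sum_i x ord0 i ^+ 2.
Proof. by rewrite sqr_sqrtr// sumr_ge0// => i _; exact: sqr_ge0. Qed.

Lemma enormZ (a : R) x : enorm (a *: x) = `|a| * enorm x.
Proof.
rewrite /enorm; under eq_bigr do rewrite mxE exprMn.
by rewrite -mulr_sumr sqrtrM ?sqr_ge0// sqrtr_sqr.
Qed.

Lemma enorm0 : enorm (0 : 'rV[R]_n) = 0.
Proof. by rewrite /enorm big1 ?sqrtr0// => i _; rewrite mxE expr0n. Qed.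

Lemma enorm_gt0 x : x != 0 -> 0 < enorm x.
Proof.
move=> x0; rewrite lt_neqAle enorm_ge0 andbT; apply: contra x0 => /eqP/esym e0.
have := enorm_sq x; rewrite e0 expr0n/= => /esym/eqP.
rewrite psumr_eq0 => [/allP H|i _]; last exact: sqr_ge0.
apply/eqP/rowP => i; rewrite mxE; apply/eqP; rewrite -sqrf_eq0.
by apply: (implyP (H i _)); rewrite ?mem_index_enum.
Qed.

Lemma enorm_basis i : enorm (basis_vec i : 'rV[R]_n) = 1.
Proof.
rewrite /enorm (bigD1 i)//= big1 ?addr0 => [|j ji]; first by rewrite mxE !eqxx expr1n sqrtr1.
by rewrite mxE (negPf ji) andbF expr0n.
Qed.

Lemma is_derive_enorm x i : 0 < enorm x ->
  is_derive x (basis_vec i) (@enorm R n) (x ord0 i / enorm x).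
Proof.
move=> x0.
have dS : is_derive x (basis_vec i) (fun y => \sum_j y ord0 j ^+ 2) (2 * x ord0 i).
  rewrite (_ : (fun y => _) = \sum_j (fun y : 'rV[R]_n => y ord0 j ^+ 2)); last first.
    by apply/funext => y; rewrite fct_sumE.
  have dj j : is_derive x (basis_vec i) (fun y : 'rV[R]_n => y ord0 j ^+ 2)
      (2 * x ord0 j * (j == i)%:R).
    have := is_derive_coord x j i => ?.
    by apply: is_derive_eq; rewrite /GRing.scale/=; ring.
  apply: is_derive_eq; rewrite (bigD1 i)//= big1 ?addr0 ?eqxx ?mulr1// => j ji.
  by rewrite (negPf ji) mulr0.
have S0 : 0 < \sum_j x ord0 j ^+ 2 by rewrite -enorm_sq exprn_gt0.
apply: (is_derive_eq (is_derive_chain dS (is_derive1_sqrt S0))).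
by rewrite -/(enorm x); field; rewrite gt_eqF.
Qed.

Section radial_function.
Variables (f : 'rV[R]_n -> R) (k k' : R -> R).

(** The identity with [k] is asked near [x] only, because a solution is radial on the ball and
    arbitrary elsewhere. *)
Lemma is_derive_radial x i : 0 < enorm x -> (\forall y \near x, f y = k (enorm y)) ->
  is_derive (enorm x) 1 k (k' (enorm x)) ->
  is_derive x (basis_vec i) f (k' (enorm x) * (x ord0 i / enorm x)).
Proof.
move=> x0 fk dk.
apply: (@near_eq_is_derive _ _ _ (fun y => k (enorm y))).
  by apply: (@filterS _ (nbhs x)) fk => y ->.
exact: is_derive_chain (is_derive_enorm i x0) dk.
Qed.

Lemma is_derive2_radial x i (k'' : R) : 0 < enorm x -> (\forall y \near x, f y = k (enorm y)) ->
  (\forall s \near enorm x, is_derive (s : R) 1 k (k' s)) -> is_derive (enorm x) 1 k' k'' ->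
  is_derive x (basis_vec i) (partial i f)
    (k'' * (x ord0 i / enorm x) ^+ 2 +
     k' (enorm x) * ((enorm x)^-1 - x ord0 i ^+ 2 / enorm x ^+ 3)).
Proof.
move=> x0 fk dk dk'.
have near1 : \forall y \near x, (\forall z \near y, f z = k (enorm z)) /\
    is_derive (enorm y) 1 k (k' (enorm y)) /\ 0 < enorm y.
  have h1 : \forall y \near x, \forall z \near y, f z = k (enorm z).
    exact: (near_join fk).
  have h2 : \forall y \near x, is_derive (enorm y) 1 k (k' (enorm y)).
    exact: (@continuous_enorm R n x _ dk).
  have h3 : \forall y \near x, 0 < enorm y.
    exact: (cvgr_gt (enorm x) (@continuous_enorm R n x)).
  by apply: (@filterS2 _ (nbhs x)) (filterI h2 h3) h1 => y [].
apply: (@near_eq_is_derive _ _ _ (fun y => k' (enorm y) * (y ord0 i / enorm y))).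
  apply: (@filterS _ (nbhs x)) near1 => y [fy [dy y0]].
  have := is_derive_radial i y0 fy dy => ?.
  by rewrite /partial derive_val.
have d1 := is_derive_enorm i x0.
have d2 := is_derive_coord x i i; rewrite eqxx in d2.
have xn0 : enorm x != 0 by rewrite gt_eqF.
have d3 : is_derive x (basis_vec i) (fun y => (enorm y)^-1)
    (- (enorm x) ^- 2 * (x ord0 i / enorm x)).
  apply: (is_derive_chain (f := fun s => s^-1) d1).
  apply: (is_derive_eq (is_deriveV (f := id) xn0 (is_derive_id _ _))).
  by rewrite /GRing.scale/= mulr1.
have d4 := is_derive_chain d1 dk'.
apply: is_derive_eq; rewrite /GRing.scale/=; field.
exact: xn0.
Qed.

Lemma laplacian_radial x (k'' : R) : 0 < enorm x -> (\forall y \near x, f y = k (enorm y)) ->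
  (\forall s \near enorm x, is_derive (s : R) 1 k (k' s)) -> is_derive (enorm x) 1 k' k'' ->
  laplacian f x = k'' + (n%:R - 1) / enorm x * k' (enorm x).
Proof.
move=> x0 fk dk dk'; rewrite /laplacian.
have xn0 : enorm x != 0 by rewrite gt_eqF.
under eq_bigr => i _.
  have := is_derive2_radial i x0 fk dk dk' => ?.
  rewrite [partial _ _ _]derive_val.
  rewrite (_ : _ + _ = (k'' / enorm x ^+ 2 - k' (enorm x) / enorm x ^+ 3) * x ord0 i ^+ 2 +
    k' (enorm x) / enorm x); last by field; exact: xn0.
  over.
rewrite big_split/= -mulr_sumr -enorm_sq sumr_const card_ord -mulr_natl.
by field; exact: xn0.
Qed.

End radial_function.
End radial.

(** * From a radial solution to its one-variable profile *)

Section profile.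
Context {R : realType}.

Lemma within_continuous_comp (S T U : topologicalType) (A : set S) (B : set T)
    (g : S -> T) (f : T -> U) : continuous g -> (forall x, A x -> B (g x)) ->
  {within B, continuous f} -> {within A, continuous (fun x => f (g x))}.
Proof.
move=> cg AB /subspace_continuousP cf; apply/subspace_continuousP => x Ax P Pfx.
have H : nbhs (g x) [set y | B y -> P (f y)] by exact: (cf _ (AB _ Ax) _ Pfx).
have := cg x _ H; rewrite /= !nbhs_simpl /within /=.
by apply: (@filterS _ (nbhs x)) => y By Ay; apply: By; exact: AB.
Qed.

(* [U] is the profile of a solution [u x = U `|x|]; [V] is its derivative, set
   to 0 at the endpoint [r], where only the normal derivative is known. *)
Record radial_profile (N : nat) (r p : R) (U V : R -> R) : Prop := RadialProfile {
  profile_continuous : {within `[0, r], continuous U};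
  profile_derivative_continuous : {within `[0, r], continuous V};
  profile_derive : forall s, 0 < s < r -> is_derive s 1 U (V s);
  profile_derive2 : forall s, 0 < s < r ->
    is_derive s 1 V (U s - U s `^ (p - 1) - (N%:R - 1) / s * V s);
  profile_derivative0 : V 0 = 0;
  profile_derivative_end : V r = 0;
  profile_ge0 : forall s, 0 <= s <= r -> 0 <= U s }.

(** By the mean value theorem the inner difference quotients at [r] are values of [g] close to [r].
    This is how the Neumann condition, a statement on difference quotients, becomes the vanishing of
    the continuous extension of the derivative. *)
Lemma left_derivative_limit (U g : R -> R) (r l : R) : 0 < r ->
  {within `[0, r], continuous U} -> {within `[0, r], continuous g} ->
  (forall s, 0 < s < r -> is_derive s 1 U (g s)) ->
  h^-1 * (U (r + h) - U r) @[h --> 0^'-] --> l -> g r = l.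
Proof.
move=> r0 cU cg dU Ul; apply/eqP; rewrite -subr_eq0 -normr_eq0; apply/eqP.
apply/eqP; rewrite eq_le normr_ge0 andbT; apply/ler_addgt0Pr => e e0; rewrite add0r.
have e20 : 0 < e / 2 by rewrite divr_gt0.
have /subspace_continuousP/(_ r) := cg; rewrite /= in_itv/= lexx (ltW r0) => /(_ isT).
move=> /cvgrPdist_lt/(_ _ e20); rewrite near_withinE => g1.
move/cvgrPdist_lt : Ul => /(_ _ e20) U1.
have /nbhs_ballP[d /= d0 Hd] := g1.
near (0 : R)^'- => h.
have h0 : h < 0 by near: h; exact: nbhs_left_lt.
have hd : `|h| < d.
  near: h; exists d => //= z; rewrite /= sub0r normrN => ? _; done.
have hr : - r < h by near: h; apply: nbhs_left_gt; rewrite oppr_lt0.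
have H1 : `|l - h^-1 * (U (r + h) - U r)| < e / 2 by near: h.
have rh : r + h < r by rewrite gtrDl.
have dU' x : x \in `]r + h, r[ -> is_derive x 1 U (g x).
  rewrite in_itv/= => /andP[x1 x2]; apply: dU; rewrite x2 andbT.
  by rewrite (lt_trans _ x1)// -ltrBlDl sub0r.
have cU' : {within `[r + h, r], continuous U}.
  apply: continuous_subspaceW cU => x; rewrite /= !in_itv/= => /andP[x1 ->].
  by rewrite andbT (le_trans _ x1)// -lerBlDl sub0r ltW.
have [c] := MVT rh dU' cU'.
rewrite in_itv/= => /andP[c1 c2] UE.
have cr0 : 0 <= c by rewrite ltW// (lt_trans _ c1)// -ltrBlDl sub0r.
have : `|g r - g c| < e / 2.
  apply: Hd; last by rewrite /= in_itv/= cr0 ltW.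
  rewrite /ball/= ger0_norm ?subr_ge0 ?ltW//.
  by rewrite (le_lt_trans _ hd)// ltr0_norm//; lra.
have E : h^-1 * (U (r + h) - U r) = g c.
  by rewrite -opprB UE; field; rewrite lt_eqF.
rewrite E in H1 => H2.
rewrite (_ : g r - l = (g r - g c) - (l - g c)); last by ring.
by rewrite (le_trans (ler_normB _ _))// ltW// [ltRHS](splitr e) ltrD.
Unshelve. all: by end_near. Qed.

Lemma is_derive_ray (W : normedModType R) (f : W -> R) e (s : R) : derivable f (s *: e) e ->
  is_derive s 1 (fun t : R => f (t *: e)) ('D_e f (s *: e)).
Proof.
have D := line_derivable f 0 e s; have E := line_derive f 0 e s.
have F : (fun t : R => f (0 + t *: e)) = (fun t : R => f (t *: e)).
  by apply/funext => t; rewrite add0r.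
rewrite add0r F in D E; rewrite D => ?.
by split => //; rewrite E.
Qed.

Lemma neumann_profile n (r p : R) (u : 'rV[R]_n.+1 -> R) : 0 < r ->
  neumann_solution r p u -> radial_on (eclosed_ball r) u ->
  radial_profile n.+1 r p (fun s => u (s *: basis_vec ord0))
    (fun s => if s < r then partial ord0 u (s *: basis_vec ord0) else 0).
Proof.
move=> r0 su ru; have C2u := neumann_solution_C2 su.
have [[cu _ eu _ _] u_ge0 u_eq u_bd] := su; have [_ du _ ddu _] := C2u.
set e := basis_vec ord0; set U := fun s : R => _; set V := fun s : R => if _ then _ else _.
have eL (s : R) : enorm (s *: e) = `|s| by rewrite enormZ enorm_basis mulr1.
have cL : continuous (fun s : R => s *: e) by exact: scalel_continuous.
have bL (s : R) : `|s| < r -> eball r (s *: e) by rewrite /eball /= eL.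
have KL (s : R) : `[0, r]%classic s -> eclosed_ball r (s *: e).
  by rewrite /= in_itv/= => /andP[s0 sr]; rewrite /eclosed_ball/= eL ger0_norm.
have dU (s : R) : `|s| < r -> is_derive s 1 U (partial ord0 u (s *: e)).
  by move=> sr; exact: is_derive_ray (du ord0 _ (bL _ sr)).
have dV (s : R) : `|s| < r ->
    is_derive s 1 (fun t : R => partial ord0 u (t *: e)) (partial ord0 (partial ord0 u) (s *: e)).
  by move=> sr; exact: is_derive_ray (ddu ord0 ord0 _ (bL _ sr)).
have lt_abs s : 0 < s < r -> `|s| < r.
  by move=> /andP[s0 sr]; rewrite ger0_norm// ltW.
have dUV s : 0 < s < r -> is_derive s 1 U (V s).
  by move=> sr; have /andP[_ s2] := sr; rewrite /V s2; apply: dU; exact: lt_abs.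
have cU : {within `[0, r], continuous U} by exact: within_continuous_comp cu.
have [g cg gu] := eu ord0.
have cgL : {within `[0, r], continuous (fun s : R => g (s *: e))}.
  exact: within_continuous_comp cg.
have gE (s : R) : `|s| < r -> g (s *: e) = partial ord0 u (s *: e).
  by move=> sr; rewrite gu// inE; exact: bL.
have gr : g (r *: e) = 0.
  apply: (@left_derivative_limit U (fun s : R => g (s *: e)) r 0 r0 cU cgL).
    by move=> s sr; rewrite gE ?lt_abs//; apply: dU; exact: lt_abs.
  have /u_bd : esphere r (r *: e) by rewrite /esphere/= eL gtr0_norm.
  rewrite /is_normal_derivative.
  suff -> : (fun h : R => h^-1 * (u (r *: e + (h / r) *: (r *: e)) - u (r *: e))) =
    (fun h => h^-1 * (U (r + h) - U r)) by [].
  apply/funext => h; rewrite /U scalerA -scalerDl; congr (_ * (u (_ *: _) - _)).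
  by field; rewrite gt_eqF.
have uU (y : 'rV[R]_n.+1) : eball r y -> u y = U (enorm y).
  move=> yr; apply: ru; rewrite ?eL ?ger0_norm ?enorm_ge0//; first exact: eball_sub_closed.
  by rewrite /eclosed_ball/= eL ger0_norm ?enorm_ge0// ltW.
split => //.
(* On [0, r] the function [V] coincides with the continuous extension of the derivative, since that
   extension vanishes at [r]. *)
- apply: subspace_eq_continuous cgL => s; rewrite inE/= in_itv/= => /andP[s0 sr].
  rewrite /V /from_subspace /=; case: ifPn => [sr'|]; first by rewrite gE// ger0_norm.
  by rewrite -leNgt => rs; have -> : s = r by apply/le_anti/andP.
- move=> s sr; have /andP[s0 s_lt] := sr; have sa := lt_abs _ sr.
  have near_lt : \forall t \near s, 0 < t < r.
    by near=> t; apply/andP; split; near: t; [exact: lt_nbhsr|exact: lt_nbhsl].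
  have dVs : is_derive s 1 V (partial ord0 (partial ord0 u) (s *: e)).
    apply: (near_eq_is_derive _ (dV s sa)); near=> t.
    have /andP[_] : 0 < t < r by near: t; exact: near_lt.
    by rewrite /V => ->.
  have En : enorm (s *: e) = s by rewrite eL gtr0_norm.
  have := @laplacian_radial R n.+1 u U V (s *: e) (partial ord0 (partial ord0 u) (s *: e)).
  rewrite En s0 => /(_ isT) lap.
  suff <- : partial ord0 (partial ord0 u) (s *: e) =
      U s - U s `^ (p - 1) - (n.+1%:R - 1) / s * V s by [].
  have := u_eq _ (bL _ sa); rewrite lap //.
  + by rewrite -/(U s) => <-; ring.
  + near=> y; apply: uU; near: y; apply: open_nbhs_nbhs; split; first exact: open_eball.
    exact: bL.
  + by near=> t; apply: dUV; near: t; exact: near_lt.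
- rewrite /V r0 scale0r.
  have r0' : `|0 : R| < r by rewrite normr0.
  have := dU 0 r0'; rewrite scale0r => d0.
  (* Along a line through the origin a radial function is even, so its derivative at 0 equals its
     own opposite. *)
  have dN : is_derive (0 : R) 1 (fun s => U (- s)) (partial ord0 u 0 * -1).
    by apply: (@is_derive1_comp _ U -%R); rewrite oppr0.
  have dN' : is_derive (0 : R) 1 U (partial ord0 u 0 * -1).
    apply: (near_eq_is_derive _ dN); near=> s.
    have sr : `|s| < r.
      by near: s; exists r => //= z /=; rewrite sub0r normrN.
    apply: ru; rewrite ?eL ?normrN//; by rewrite /eclosed_ball/= eL ?normrN ltW.
  have := @derive_val _ _ _ _ _ _ _ dN'; rewrite (@derive_val _ _ _ _ _ _ _ d0); lra.
- by rewrite /V ltxx.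
- move=> s /andP[s0]; rewrite le_eqVlt => /predU1P[->|sr]; last first.
    by apply: u_ge0; apply: bL; rewrite ger0_norm.
  have /(continuous_within_itvP _ r0)[_ _ cr'] := cU.
  apply: (cvgr_to_ge cr'); near=> x; apply: u_ge0; apply: bL.
  rewrite ger0_norm; near: x; [exact: nbhs_left_lt|exact: nbhs_left_ge].
Unshelve. all: by end_near. Qed.

End profile.

(** * One variable calculus *)

Section one_variable.
Context {R : realType}.
Implicit Types (f g df : R -> R) (A : set R).

Lemma within_continuousD A f g : {within A, continuous f} -> {within A, continuous g} ->
  {within A, continuous (fun x => f x + g x)}.
Proof. by move=> cf cg x; exact: cvgD (cf x) (cg x). Qed.

Lemma within_continuousM A f g : {within A, continuous f} -> {within A, continuous g} ->
  {within A, continuous (fun x => f x * g x)}.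
Proof. by move=> cf cg x; exact: cvgM (cf x) (cg x). Qed.

Lemma within_continuousN A f : {within A, continuous f} ->
  {within A, continuous (fun x => - f x)}.
Proof. by move=> cf x; exact: cvgN (cf x). Qed.

Lemma within_continuousC A (c : R) : {within A, continuous (fun=> c)}.
Proof. by apply: continuous_subspaceT => x; exact: cvg_cst. Qed.

Lemma within_continuous_id A : {within A, continuous (fun x : R => x)}.
Proof. by apply: continuous_subspaceT => x; exact: cvg_id. Qed.

Lemma within_continuousX A f k : {within A, continuous f} ->
  {within A, continuous (fun x => f x ^+ k)}.
Proof.
move=> cf; elim: k => [|k IH].
  by under [fun x => _]eq_fun do rewrite expr0; exact: within_continuousC.
by under [fun x => _]eq_fun do rewrite exprS; exact: within_continuousM.
Qed.

Lemma within_continuous_post A f g : {within A, continuous f} -> continuous g ->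
  {within A, continuous (fun x => g (f x))}.
Proof. by move=> cf cg x; apply: (continuous_comp (cf x)); exact: cg. Qed.

Lemma is_derive_le f df a b x y : {within `[a, b], continuous f} ->
  (forall s, a < s < b -> is_derive s 1 f (df s)) ->
  (forall s, a < s < b -> df s <= 0) -> a <= x -> x <= y -> y <= b -> f y <= f x.
Proof.
move=> cf dF df0 ax; rewrite le_eqVlt => /predU1P[->//|xy] yb.
have dF' s : s \in `]x, y[ -> is_derive s 1 f (df s).
  rewrite in_itv/= => /andP[xs sy]; apply: dF.
  by rewrite (le_lt_trans ax xs) (lt_le_trans sy yb).
have cf' : {within `[x, y], continuous f}.
  apply: continuous_subspaceW cf => s; rewrite /= !in_itv/= => /andP[xs sy].
  by rewrite (le_trans ax xs) (le_trans sy yb).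
have [c] := MVT xy dF' cf'.
rewrite in_itv/= => /andP[xc cy] E; rewrite -subr_le0 E mulr_le0_ge0 ?subr_ge0 ?(ltW xy)//.
by apply: df0; rewrite (le_lt_trans ax xc) (lt_le_trans cy yb).
Qed.

Lemma is_derive_ge f df a b x y : {within `[a, b], continuous f} ->
  (forall s, a < s < b -> is_derive s 1 f (df s)) ->
  (forall s, a < s < b -> 0 <= df s) -> a <= x -> x <= y -> y <= b -> f x <= f y.
Proof.
move=> cf dF df0 ax xy yb; rewrite -lerN2.
apply: (@is_derive_le (fun s => - f s) (fun s => - df s) a b) => //.
- exact: within_continuousN.
- by move=> s /dF ?; exact: is_deriveN.
- by move=> s /df0; rewrite oppr_le0.
Qed.

Lemma is_derive_lt f df a b : a < b -> {within `[a, b], continuous f} ->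
  (forall s, a < s < b -> is_derive s 1 f (df s)) ->
  (forall s, a < s < b -> df s < 0) -> f b < f a.
Proof.
move=> ab cf dF df0.
have dF' s : s \in `]a, b[ -> is_derive s 1 f (df s) by rewrite in_itv/=; exact: dF.
have [c] := MVT ab dF' cf.
rewrite in_itv/= => /df0 d E.
by rewrite -subr_lt0 E nmulr_rlt0// subr_gt0.
Qed.

Lemma is_derive_exprn (k : nat) (x : R) : is_derive x 1 (fun t : R => t ^+ k.+1) (k.+1%:R * x ^+ k).
Proof.
have -> : (fun t : R => t ^+ k.+1) = (id : R -> R) ^+ k.+1 by apply/funext => t; rewrite exprfctE.
by apply: is_derive_eq; rewrite /GRing.scale/= mulr1.
Qed.

(** Taking the positive part makes the power differentiable on the whole line for [p >= 2], so that
    the chain rule applies to [U] even at points where it might vanish. *)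
Definition ppow (p y : R) : R := Num.max y 0 `^ p.

Lemma ppowE p y : 0 <= y -> ppow p y = y `^ p.
Proof. by move=> y0; rewrite /ppow max_l. Qed.

Lemma ppow_ge0 p y : 0 <= ppow p y.
Proof. exact: powR_ge0. Qed.

Lemma is_derive_ppow (p y : R) : 2 <= p -> is_derive y 1 (ppow p) (p * ppow (p - 1) y).
Proof.
move=> p2; have p0 : p != 0 by lra.
have p10 : p - 1 != 0 by lra.
have [y0|y0|->] := ltgtP y 0.
- rewrite {2}/ppow max_r ?(ltW y0)// powR0// mulr0.
  apply: (@near_eq_is_derive _ _ _ (cst 0)) => //.
  near=> z; rewrite /ppow max_r ?powR0//= ltW//; near: z; exact: lt_nbhsl.
- rewrite ppowE ?ltW//; apply: (@near_eq_is_derive _ _ _ (fun z => z `^ p)); last exact: is_derive1_powR.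
  near=> z; rewrite ppowE// ltW//; near: z; exact: lt_nbhsr.
rewrite {2}/ppow max_r// powR0// mulr0; apply/is_derive1_caratheodory.
(* The slope function at 0 is squeezed between 0 and [|z|], because [p - 1 >= 1]. *)
exists (ppow (p - 1)); split.
- move=> z; rewrite subr0 {2}/ppow max_r// powR0// subr0.
  have [z0|z0] := leP z 0; first by rewrite /ppow max_r// !powR0// mul0r.
  by rewrite !ppowE ?ltW// mulrC mulr_powRB1// ?ltW//; lra.
- rewrite /prop_for /continuous_at {2}/ppow max_r// powR0//.
  apply: (@squeeze_cvgr _ _ _ _ (cst 0) (fun z => `|z|)).
  + have n1 : \forall z \near (0 : R), z <= 1.
      by near=> z; rewrite ltW//; near: z; exact: lt_nbhsl.
    near=> z; rewrite ppow_ge0/=; have [z0|z0] := leP z 0.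
      by rewrite /ppow max_r// powR0// normr_ge0.
    rewrite (ppowE _ (ltW z0)) gtr0_norm// ge1r_powR//; last lra.
    by rewrite z0/=; near: z.
  + exact: cvg_cst.
  + rewrite -[X in _ --> X](@normr0 _ R); exact: norm_continuous.
- by rewrite /ppow max_r// powR0.
Unshelve. all: by end_near. Qed.
End one_variable.

(** * The radial equation *)

Ltac within_cont := repeat lazymatch goal with
  | |- {within _, continuous (fun x => @?f x + @?g x)} =>
      apply: (@within_continuousD _ _ f g)
  | |- {within _, continuous (fun x => - @?f x)} => apply: (@within_continuousN _ _ f)
  | |- {within _, continuous (fun x => @?f x * @?g x)} =>
      apply: (@within_continuousM _ _ f g)
  | |- {within _, continuous (fun x => @?f x ^+ ?k)} => apply: (@within_continuousX _ _ f k)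
  end; first [assumption | exact: within_continuous_id | exact: within_continuousC].

Section profile_ode.
Context {R : realType}.
Variables (n : nat) (r p : R) (U V : R -> R).
Hypotheses (r0 : 0 < r) (UV : radial_profile n.+3 r p U V).
Hypothesis p3 : 3 <= p.
Local Notation d := (n.+3%:R : R).

Let p0 : 0 < p. Proof. by have := p3; lra. Qed.
Let pn0 : p != 0. Proof. by rewrite gt_eqF. Qed.
Let p2 : 2 <= p. Proof. by have := p3; lra. Qed.
Let p12 : 2 <= p - 1. Proof. by have := p3; lra. Qed.

Let cU := profile_continuous UV.
Let cV := profile_derivative_continuous UV.
Let dU := profile_derive UV.

Let X s := ppow (p - 1) (U s).
Let Y s := ppow p (U s).

Let U_ge0 s : 0 <= s <= r -> 0 <= U s. Proof. exact: (profile_ge0 UV). Qed.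

Let dV s : 0 < s < r -> is_derive s 1 V (U s - X s - (d - 1) / s * V s).
Proof.
move=> sr; have := profile_derive2 UV sr; rewrite /X ppowE// U_ge0//.
by case/andP: sr => /ltW -> /ltW ->.
Qed.

Let Y_E s : 0 <= s <= r -> Y s = U s * X s.
Proof. by move=> /U_ge0 Us; rewrite /Y /X !ppowE// mulr_powRB1. Qed.

Let dY s : 0 < s < r -> is_derive s 1 Y (p * X s * V s).
Proof.
move=> sr; apply: (@is_derive1_comp _ (ppow p) U); last exact: dU.
exact: is_derive_ppow.
Qed.

Let continuous_ppow q : 2 <= q -> continuous (@ppow R q).
Proof.
move=> q2 x; apply: differentiable_continuous; apply/derivable1_diffP.
by have := is_derive_ppow x q2 => ?; exact: ex_derive.
Qed.

Let cY : {within `[0, r], continuous Y}.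
Proof. by apply: within_continuous_post => //; exact: continuous_ppow. Qed.

Let Y_ge0 s : 0 <= Y s. Proof. exact: ppow_ge0. Qed.

(** The equation read as a motion in the potential [Y / p - U ^+ 2 / 2], with [(d - 1) / s * V] as
    friction; the friction dissipates this energy. *)
Definition energy s := V s ^+ 2 / 2 - U s ^+ 2 / 2 + Y s / p.

Let within_cE : {within `[0, r], continuous energy}.
Proof. by rewrite /energy; within_cont. Qed.

Let d_energy s : 0 < s < r -> is_derive s 1 energy (- ((d - 1) / s * V s ^+ 2)).
Proof.
move=> sr; have := dU sr => ?; have := dV sr => ?; have := dY sr => ?.
have s0 : s != 0 by case/andP: sr => s0 _; rewrite gt_eqF.
rewrite /energy; apply: is_derive_eq; rewrite /GRing.scale/=; field.
by rewrite s0 pn0.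
Qed.

Lemma energy_nonincreasing s t : 0 <= s -> s <= t -> t <= r -> energy t <= energy s.
Proof.
apply: is_derive_le within_cE d_energy _ => x /andP[x0 _].
by rewrite oppr_le0 mulr_ge0 ?sqr_ge0// divr_ge0 ?ltW//.
Qed.

Definition pohozaev s := s ^+ n.+3 * energy s + (d - 2) / 2 * (s ^+ n.+2 * (U s * V s)).

Let within_cP : {within `[0, r], continuous pohozaev}.
Proof. by rewrite /pohozaev; within_cont. Qed.

(** The weight [(d - 2) / 2] is the one that cancels the terms in [V ^+ 2]. The coefficient left in
    front of [Y] is zero at the critical exponent and negative above it. *)
Lemma is_derive_pohozaev s : 0 < s < r -> is_derive s 1 pohozaev
  (- (s ^+ n.+2 * U s ^+ 2) + (d / p - (d - 2) / 2) * (s ^+ n.+2 * Y s)).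
Proof.
move=> sr; have := dU sr => ?; have := dV sr => ?; have := d_energy sr => ?.
have s0 : s != 0 by case/andP: sr => s0 _; rewrite gt_eqF.
have srw : 0 <= s <= r by case/andP: sr => /ltW -> /ltW ->.
have dn : n.+2%:R = d - 1 by rewrite [d]mulrSr addrK.
have := is_derive_exprn n.+2 s => ?; have := is_derive_exprn n.+1 s => ?.
rewrite /pohozaev; apply: is_derive_eq.
rewrite /GRing.scale/= dn /energy (Y_E srw) !exprS; field.
by rewrite s0 pn0.
Qed.

Hypothesis pd : d / p <= (d - 2) / 2.

Lemma pohozaev_le0 s : 0 <= s <= r -> pohozaev s <= 0.
Proof.
move=> /andP[s0 sr].
have <- : pohozaev 0 = 0 by rewrite /pohozaev !exprS !mul0r mulr0 addr0.
apply: (is_derive_le within_cP is_derive_pohozaev) => // x /andP[/ltW x0 _].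
have x1 : 0 <= x ^+ n.+2 by rewrite exprn_ge0.
have h1 : 0 <= x ^+ n.+2 * U x ^+ 2 by apply: mulr_ge0 => //; exact: sqr_ge0.
have h2 : (d / p - (d - 2) / 2) * (x ^+ n.+2 * Y x) <= 0.
  by rewrite mulr_le0_ge0 ?subr_le0//; apply: mulr_ge0.
by rewrite -[leRHS]addr0 lerD// oppr_le0.
Qed.

(** Dividing [pohozaev s <= 0] by a power of [s] and dropping the nonnegative term in [Y] leaves
    [V^2 <= U^2 + a U |V|] with [a = (d - 2) / s]. A value [|V| > (a + 1) U] would also exceed [U]
    and violate this quadratic inequality. *)
Lemma profile_derivative_bound s : 0 < s <= r -> `|V s| <= ((d - 2) / s + 1) * U s.
Proof.
move=> /andP[s0 sr]; have srw : 0 <= s <= r by rewrite ltW.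
have := pohozaev_le0 srw; rewrite /pohozaev exprS -mulrA.
rewrite (_ : _ + _ = s ^+ n.+2 * (s * energy s + (d - 2) / 2 * (U s * V s))); last by ring.
rewrite pmulr_rle0 ?exprn_gt0// /energy => H.
have Us := U_ge0 srw.
have Ys : 0 <= Y s / p by rewrite divr_ge0// ltW.
have a0 : 0 <= (d - 2) / s by rewrite divr_ge0 ?ltW// subr_ge0 ler_nat.
set a := (d - 2) / s in a0 *.
have aE : d - 2 = a * s by rewrite /a divfK// gt_eqF.
have {}H : V s ^+ 2 <= U s ^+ 2 + a * (U s * `|V s|).
  have : s * (V s ^+ 2 - U s ^+ 2 + a * (U s * V s)) <= 0.
    have : 0 <= s * (Y s / p) by rewrite mulr_ge0// ltW.
    move: H; rewrite aE; lra.
  rewrite pmulr_rle0// => {}H.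
  have : - (U s * V s) <= U s * `|V s| by rewrite -mulrN ler_wpM2l// ler_normr lexx orbT.
  move=> /(ler_wpM2l a0); rewrite mulrN; lra.
rewrite -real_normK ?num_real// in H.
rewrite leNgt; apply/negP => lt.
have v0 : 0 <= `|V s| by [].
have h1 : U s <= `|V s|.
  by rewrite (le_trans _ (ltW lt))// mulrDl mul1r lerDr mulr_ge0.
have h2 : (a + 1) * U s * `|V s| < `|V s| * `|V s|.
  rewrite ltr_pM2r// (le_lt_trans _ lt)// mulr_ge0//; lra.
have h3 : U s * U s <= U s * `|V s| by rewrite ler_wpM2l.
move: H h2 h3; rewrite !expr2; lra.
Qed.

Lemma is_derive_expRM (c x : R) : is_derive x 1 (fun t : R => expR (c * t)) (expR (c * x) * c).
Proof.
apply: (@is_derive1_comp _ expR (fun t : R => c * t)).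
by apply: is_derive_eq; rewrite /GRing.scale/=; ring.
Qed.

Lemma within_continuous_expRM A (c : R) : {within A, continuous (fun t : R => expR (c * t))}.
Proof.
apply: within_continuous_post; last exact: continuous_expR.
exact: (within_continuousM (@within_continuousC _ A c) (@within_continuous_id _ A)).
Qed.

(** On [e, r] the derivative bound reads [|V| <= C U] with a constant [C], so [U e^(C s)] is
    nondecreasing and [U e^(- C s)] nonincreasing. Using these products rather than the logarithm of
    [U] avoids assuming [U] positive. *)
Lemma harnack e s t : 0 < e -> e <= s <= r -> e <= t <= r ->
  U s <= expR (((d - 2) / e + 1) * r) * U t.
Proof.
move=> e0 /andP[es sr] /andP[et tr]; set C := (d - 2) / e + 1.
have d2 : 0 <= d - 2 by rewrite subr_ge0 ler_nat.
have C0 : 0 <= C by rewrite addr_ge0// divr_ge0// ltW.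
have er x : e < x < r -> 0 < x < r by move=> /andP[/(lt_trans e0) -> ->].
have cUe : {within `[e, r], continuous U}.
  by apply: continuous_subspaceW cU => x; rewrite /= !in_itv/= => /andP[/(le_trans (ltW e0)) -> ->].
have VC x : e < x < r -> `|V x| <= C * U x.
  move=> /[dup] xr /andP[x1 x2].
  have x0 := lt_trans e0 x1.
  apply: (le_trans (profile_derivative_bound _)); first by rewrite x0 ltW.
  apply: ler_wpM2r; first by rewrite U_ge0// (ltW x0) (ltW x2).
  by rewrite lerD2r ler_wpM2l// lef_pV2 ?posrE// ltW.
have mono (c : R) x : e < x < r ->
    is_derive x 1 (fun x => U x * expR (c * x)) ((V x + c * U x) * expR (c * x)).
  move=> xr; have := dU (er _ xr) => ?; have := is_derive_expRM c x => ?.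
  by apply: is_derive_eq; rewrite /GRing.scale/=; ring.
have cm c : {within `[e, r], continuous (fun x => U x * expR (c * x))}.
  by have := @within_continuous_expRM `[e, r]%classic c => ?; within_cont.
have U0 x : e <= x -> x <= r -> 0 <= U x.
  by move=> h1 h2; rewrite U_ge0// (le_trans (ltW e0) h1).
have [st|/ltW ts] := leP s t.
  have := @is_derive_ge _ (fun x => U x * expR (C * x)) _ e r s t (cm C) (mono C).
  have H x : e < x < r -> 0 <= (V x + C * U x) * expR (C * x).
    move=> xr; rewrite mulr_ge0 ?expR_ge0//; have := VC _ xr.
    by rewrite ler_norml => /andP[]; lra.
  move=> /(_ H es st tr) {}H.
  have : U s <= U t * expR (C * t) / expR (C * s) by rewrite ler_pdivlMr ?expR_gt0.
  move/le_trans; apply; rewrite -mulrA -expRB [leLHS]mulrC ler_wpM2r ?U0//.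
  rewrite ler_expR -mulrBr ler_wpM2l//; lra.
have := @is_derive_le _ (fun x => U x * expR (- C * x)) _ e r t s (cm _) (mono _).
have H x : e < x < r -> (V x + - C * U x) * expR (- C * x) <= 0.
  move=> xr; rewrite mulr_le0_ge0 ?expR_ge0//; have := VC _ xr.
  by rewrite ler_norml => /andP[]; lra.
move=> /(_ H et ts sr) {}H.
have : U s <= U t * expR (- C * t) / expR (- C * s) by rewrite ler_pdivlMr ?expR_gt0.
move/le_trans; apply; rewrite -mulrA -expRB [leLHS]mulrC ler_wpM2r ?U0//.
rewrite ler_expR -mulrBr mulNr -mulrN ler_wpM2l//; lra.
Qed.

Lemma energy0 : energy 0 = Y 0 / p - U 0 ^+ 2 / 2.
Proof. by rewrite /energy (profile_derivative0 UV); ring. Qed.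

(** A zero at a positive radius spreads by Harnack's inequality. A zero at the origin, where
    Harnack's constant degenerates, is handled by the energy: it vanishes at 0, hence is nonpositive
    afterwards, which gives [V^2 <= U^2], and [U e^(-s)] cannot leave 0. *)
Lemma profile_zero s t : 0 <= s <= r -> U s = 0 -> 0 < t <= r -> U t = 0.
Proof.
move=> /andP[s0 sr] Us /andP[t0 tr].
have Ut : 0 <= U t by rewrite U_ge0// ltW.
apply/eqP; rewrite eq_le Ut andbT.
move: s0; rewrite [0 <= s]le_eqVlt => /predU1P[s0|s0]; last first.
  pose e := Num.min s t.
  have e0 : 0 < e by rewrite lt_min s0.
  have := @harnack e t s e0; rewrite Us mulr0; apply; rewrite ?sr ?tr andbT.
  - by rewrite ge_min lexx orbT.
  - by rewrite ge_min lexx.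
rewrite -{}s0 in Us sr.
have E0 : energy 0 = 0.
  by rewrite energy0 Us Y_E ?lexx ?ltW// Us; ring.
have VU x : 0 < x < r -> V x <= U x.
  move=> /[dup] xr /andP[x0 x1].
  have Ux : 0 <= U x by rewrite U_ge0// !ltW.
  have := @energy_nonincreasing 0 x (lexx _) (ltW x0) (ltW x1).
  rewrite E0 /energy => H.
  have Yx : 0 <= Y x / p by rewrite divr_ge0// ltW.
  have {}H : V x ^+ 2 <= U x ^+ 2 by lra.
  rewrite leNgt; apply/negP => h.
  by move: H; rewrite leNgt ltr_sqr ?nnegrE// ?(le_trans Ux) ?ltW// h.
have D x : 0 < x < r ->
    is_derive x 1 (fun x => U x * expR (- 1 * x)) ((V x - U x) * expR (- 1 * x)).
  move=> xr; have := dU xr => ?; have := is_derive_expRM (- 1) x => ?.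
  by apply: is_derive_eq; rewrite /GRing.scale/=; ring.
have cm : {within `[0, r], continuous (fun x => U x * expR (- 1 * x))}.
  by have := @within_continuous_expRM `[0, r]%classic (- 1) => ?; within_cont.
have := @is_derive_le _ _ _ 0 r 0 t cm D.
rewrite Us mul0r pmulr_lle0 ?expR_gt0//; apply => //; last exact: ltW.
by move=> x /VU h; rewrite mulr_le0_ge0 ?expR_ge0// subr_le0.
Qed.

(** A small start has nonpositive energy, and so has every later radius: [Y s / p <= U^2 / 2]. Where
    [U > 1], [U^3 <= Y s] turns this into [U <= p / 2]. Together with blow-up it forces the
    solutions to start above 1/2. *)
Lemma profile_le_small_start s : U 0 <= 1 / 2 -> 0 <= s <= r -> U s <= p / 2.
Proof.
move=> U0 /andP[s0 sr].
have U00 : 0 <= U 0 by rewrite U_ge0// lexx ltW.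
have Us : 0 <= U s by rewrite U_ge0// s0.
have [U1|U1] := leP (U s) 1; first by rewrite (le_trans U1)//; have := p3; lra.
have E0 : energy 0 <= 0.
  rewrite energy0 subr_le0.
  have Y0 : Y 0 <= U 0 ^+ 2.
    rewrite /Y ppowE// -powR_mulrn//.
    move: U00; rewrite [0 <= U 0]le_eqVlt => /predU1P[<-|U00]; first by rewrite !powR0.
    by apply: ger_powR => //; rewrite U00/=; lra.
  apply: (@le_trans _ _ (U 0 ^+ 2 / p)); first by rewrite ler_wpM2r// invr_ge0 ltW.
  by rewrite ler_wpM2l ?sqr_ge0// lef_pV2 ?posrE.
have := le_trans (@energy_nonincreasing 0 s (lexx _) s0 sr) E0.
rewrite /energy => H.
have {}H : Y s / p <= U s ^+ 2 / 2 by have := sqr_ge0 (V s); lra.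
have U3 : U s ^+ 3 <= Y s.
  rewrite /Y ppowE// -powR_mulrn//; apply: ler_powR => //; exact: ltW.
move: H; rewrite ler_pdivrMr// => H.
have := le_trans U3 H; rewrite exprS => {}H.
have U20 : 0 < U s ^+ 2 by rewrite exprn_gt0// (lt_trans _ U1).
by rewrite -(ler_pM2r U20) (le_trans H)// le_eqVlt; apply/orP; left; apply/eqP; ring.
Qed.

End profile_ode.

(** * Dimension six: solutions that stay above one half *)

Section dimension6.
Context {R : realType}.

(* [s ^+ 5 * shifted_defect p (U s)] is the derivative of the Pohozaev
   functional of [U - 1 / 2] in dimension 6. *)
Definition shifted_defect (p y : R) :=
  6 * (ppow p y / p - y ^+ 2 / 2 - (ppow p (1 / 2) / p - (1 / 2) ^+ 2 / 2)) -
  2 * ((y - 1 / 2) * (ppow (p - 1) y - y)).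

Lemma is_derive_shifted_defect (p y : R) : 3 <= p ->
  is_derive y 1 (shifted_defect p)
    (4 * (ppow (p - 1) y - y) - 2 * ((y - 1 / 2) * ((p - 1) * ppow (p - 2) y - 1))).
Proof.
move=> p3; have p2 : 2 <= p by lra.
have p12 : 2 <= p - 1 by lra.
have pn0 : p != 0 by rewrite gt_eqF; lra.
have := is_derive_ppow y p2 => ?; have := is_derive_ppow y p12.
rewrite (_ : p - 1 - 1 = p - 2) => [?|]; last by ring.
by rewrite /shifted_defect; apply: is_derive_eq; rewrite /GRing.scale/=; field.
Qed.

(** For [p = 3] the expression is the constant -1. For larger [p] the factor [w = y^(p-3)] is
    controlled by [1/w = exp(-(p-3) ln y) >= 1 - (p-3)(y-1)], and the other new term, [-(p-3) y w],
    has the good sign. *)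
Lemma shifted_defect_derivative_lt0 (p y : R) : 3 <= p -> 0 < y ->
  4 * (ppow (p - 1) y - y) - 2 * ((y - 1 / 2) * ((p - 1) * ppow (p - 2) y - 1)) < 0.
Proof.
move=> p3 y0; rewrite !ppowE ?ltW//.
set w := y `^ (p - 3).
have w0 : 0 < w by rewrite powR_gt0.
have y2 : y `^ (p - 2) = y * w.
  by rewrite /w -[in RHS](_ : p - 2 - 1 = p - 3) ?mulr_powRB1 ?ltW//; lra.
have y1 : y `^ (p - 1) = y * (y * w).
  rewrite -y2 -[in RHS](_ : p - 1 - 1 = p - 2) ?mulr_powRB1 ?ltW//; lra.
have wV : 1 - (p - 3) * (y - 1) <= w^-1.
  rewrite /w -powRN /powR gt_eqF//.
  have ly : ln y <= y - 1.
    by have := expR_ge1Dx (ln y); rewrite lnK ?posrE//; lra.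
  apply: le_trans (expR_ge1Dx _); rewrite mulNr lerD2l lerN2 ler_wpM2l//; lra.
have H : w * (1 - (p - 3) * (y - 1)) <= 1.
  by rewrite mulrC -ler_pdivlMr// div1r.
have H2 : y * (w * (1 - (p - 3) * (y - 1))) <= y by rewrite -[leRHS]mulr1 ler_wpM2l// ltW.
have H3 : 0 <= (p - 3) * (y * w) by apply: mulr_ge0; [lra|apply: mulr_ge0; exact: ltW].
rewrite y1 y2.
rewrite (_ : _ - _ = 2 * (y * (w * (1 - (p - 3) * (y - 1)))) - (p - 3) * (y * w) - 2 * y - 1); last by field.
lra.
Qed.

Lemma shifted_defect_lt0 (p y : R) : 3 <= p -> 1 / 2 < y -> shifted_defect p y < 0.
Proof.
move=> p3 y12.
have <- : shifted_defect p (1 / 2) = 0 by rewrite /shifted_defect; ring.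
have D z := is_derive_shifted_defect z p3.
apply: (is_derive_lt y12 _ (fun z _ => D z)).
  apply: continuous_subspaceT => z; apply: differentiable_continuous; apply/derivable1_diffP.
  by have := D z => ?; exact: ex_derive.
by move=> z /andP[z1 _]; apply: shifted_defect_derivative_lt0 => //; lra.
Qed.

Lemma profile_gt_half (r p : R) (U V : R -> R) s : 0 < r -> 3 <= p ->
  radial_profile 6 r p U V -> 1 / 2 < U 0 -> 0 <= s <= r -> 1 / 2 < U s.
Proof.
move=> r0 p3 UV U0 srw; rewrite ltNge; apply/negP => Us.
have cU := profile_continuous UV; have cV := profile_derivative_continuous UV.
have p2 : 2 <= p by lra.
have pn0 : p != 0 by rewrite gt_eqF; lra.
pose Z := [set t | 0 <= t <= r /\ U t <= 1 / 2].
have Z0 : Z s by [].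
have hZ : has_inf Z by split; [exists s|exists 0 => t [/andP[]]].
(* The first radius at which [U] is at most 1/2; by continuity it is positive and [U z = 1 / 2]. *)
pose z := inf Z.
have z0 : 0 <= z by apply: lb_le_inf; [exists s|move=> t [/andP[]]].
have zs : z <= s by apply: inf_lbound => //; case: hZ.
have zr : z <= r by rewrite (le_trans zs)//; case/andP: srw.
have below t : 0 <= t -> t < z -> 1 / 2 < U t.
  move=> t0 tz; rewrite ltNge; apply/negP => Ut.
  move: (tz); rewrite ltNge => /negP; apply; apply: inf_lbound; first by case: hZ.
  by split => //; rewrite t0 (le_trans (ltW tz) zr).
have Uz : U z <= 1 / 2.
  rewrite leNgt; apply/negP => Uz.
  have /subspace_continuousP/(_ z) := cU; rewrite /= in_itv/= z0 zr => /(_ isT) cz.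
  have g1 : nbhs z [set x | `[0, r]%classic x -> 1 / 2 < U x].
    by apply: (@cvgr_gt _ _ (within `[0, r] (nbhs z)) _ U (U z) cz).
  have /nbhs_ballP[e /= e0 He] := g1.
  have : z + e <= z.
    apply: lb_le_inf; first by exists s.
    move=> t [/andP[t0 tr] Ut]; rewrite leNgt; apply/negP => tze.
    have zt : z <= t by apply: inf_lbound; [case: hZ|split => //; rewrite t0].
    have : 1 / 2 < U t.
      apply: He; last by rewrite /= in_itv/= t0.
      by rewrite /ball/= distrC ger0_norm ?subr_ge0// ltrBlDl.
    by rewrite ltNge Ut.
  by rewrite gerDl leNgt e0.
have {}z0 : 0 < z.
  rewrite lt_neqAle z0 andbT; apply/eqP => zE.
  by move: Uz; rewrite -zE leNgt U0.
have cz A : {within `[0, r], continuous A} -> {within `[0, z], continuous (A : R -> R)}.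
  by apply: continuous_subspaceW => t; rewrite /= !in_itv/= => /andP[-> /le_trans]; exact.
have cUz := cz _ cU; have cVz := cz _ cV.
have {}Uz : U z = 1 / 2.
  apply/eqP; rewrite eq_le Uz/=.
  have /(continuous_within_itvP _ z0)[_ _ cr'] := cUz.
  apply: (cvgr_to_ge cr'); near=> x; apply/ltW/below.
    by near: x; exact: nbhs_left_ge.
  by near: x; exact: nbhs_left_lt.
(* The potential is normalized to vanish at the value 1/2, so that only the kinetic term of [Q]
   remains at [z]. *)
pose W t := ppow p (U t) / p - U t ^+ 2 / 2 - (ppow p (1 / 2) / p - (1 / 2) ^+ 2 / 2).
pose Q t := t ^+ 6 * (V t ^+ 2 / 2 + W t) + 2 * (t ^+ 5 * ((U t - 1 / 2) * V t)).
have zr' t : 0 < t < z -> 0 < t < r by move=> /andP[-> tz]; exact: lt_le_trans zr.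
have DQ t : 0 < t < z -> is_derive t 1 Q (t ^+ 5 * shifted_defect p (U t)).
  move=> /[dup] tz /andP[t0 _].
  have dU := profile_derive UV (zr' _ tz).
  have := profile_derive2 UV (zr' _ tz).
  have Ut : 0 <= U t.
    by apply: (profile_ge0 UV); have /andP[/ltW -> /ltW ->] := zr' _ tz.
  rewrite -(ppowE (p - 1) Ut) => dV.
  have dY : is_derive t 1 (fun t => ppow p (U t)) (p * ppow (p - 1) (U t) * V t).
    by apply: (@is_derive1_comp _ (ppow p) U) => //; exact: is_derive_ppow.
  have := is_derive_exprn 5 t => ?; have := is_derive_exprn 4 t => ?.
  have tn0 : t != 0 by rewrite gt_eqF.
  rewrite /Q /W /shifted_defect; apply: is_derive_eq; rewrite /GRing.scale/=; field.
  by rewrite ?tn0 ?pn0.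
have cQ : {within `[0, z], continuous Q}.
  have cY : {within `[0, z], continuous (fun t => ppow p (U t))}.
    apply: within_continuous_post => // x.
    apply: differentiable_continuous; apply/derivable1_diffP.
    by have := is_derive_ppow x p2 => ?; exact: ex_derive.
  by rewrite /Q /W; within_cont.
have := is_derive_lt z0 cQ DQ.
have -> : Q 0 = 0 by rewrite /Q; ring.
have -> : Q z = z ^+ 6 * (V z ^+ 2 / 2) by rewrite /Q /W Uz; ring.
rewrite ltNge mulr_ge0 ?exprn_ge0 ?divr_ge0 ?sqr_ge0 ?(ltW z0)//.
move=> /(_ _)/negP; apply => // t /andP[t0 tz].
by rewrite nmulr_llt0 ?exprn_gt0//; apply: shifted_defect_lt0 => //; apply: below => //; exact: ltW.
Unshelve. all: by end_near. Qed.

End dimension6.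

Ltac nonneg := repeat first
  [ assumption | done | exact: sqr_ge0 | exact: expR_ge0 | exact: ltW | apply: exprn_ge0
  | apply: divr_ge0 | apply: mulr_ge0 | apply: addr_ge0 ].

(** * Solutions that are small away from the origin, in dimension at least four *)

Section small_profiles.
Context {R : realType}.

(** The nonlinearity is a small multiple of the unknown, uniformly in [p >= 3], because
    [y^(p-1) <= y^2] on [0, 1]. *)
Lemma ppow_small (p c y : R) : 3 <= p -> c <= 1 -> 0 <= y <= c -> ppow (p - 1) y <= c * y.
Proof.
move=> p3 c1 /andP[]; rewrite le_eqVlt => /predU1P[<- _|y0 yc].
  by rewrite ppowE// powR0 ?mulr0//; lra.
rewrite (ppowE _ (ltW y0)); apply: (@le_trans _ _ (y ^+ 2)).
  rewrite -(powR_mulrn _ (ltW y0)); apply: ger_powR; last lra.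
  by rewrite y0 (le_trans yc).
by rewrite expr2 ler_wpM2r// ltW.
Qed.

Section fixed_profile.
Variables (n : nat) (r p : R) (U V : R -> R).
Hypotheses (r0 : 0 < r) (UV : radial_profile n.+3 r p U V) (p3 : 3 <= p).
Hypothesis pd : n.+3%:R / p <= (n.+3%:R - 2) / 2.

Lemma profile_derive_ppow s : 0 < s < r -> is_derive s 1 V
  (U s - ppow (p - 1) (U s) - (n.+3%:R - 1) / s * V s).
Proof.
move=> /[dup] /andP[s0 sr] h; have := profile_derive2 UV h.
by rewrite -ppowE// (profile_ge0 UV)// !ltW.
Qed.

(** At the fixed radius [h] everything is comparable with [U r]: the derivative bound controls [V h]
    by [U h], and Harnack's inequality controls [U h] by [U r]. *)
Lemma pohozaev_lower_bound (h := r / 2) (C := (n.+3%:R - 2) / h + 1) :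
  - (h ^+ n.+3 / 2 + (n.+3%:R - 2) / 2 * h ^+ n.+2 * C) * (expR (C * r) * U r) ^+ 2
    <= pohozaev n p U V h.
Proof.
have h0 : 0 < h by rewrite /h divr_gt0.
have hr : h <= r by rewrite /h; have := r0; lra.
have Uh : 0 <= U h by rewrite (profile_ge0 UV)// ltW.
have dV : `|V h| <= C * U h.
  by apply: (profile_derivative_bound UV p3 pd); rewrite h0.
have HU : U h <= expR (C * r) * U r.
  by apply: (harnack UV p3 pd h0); rewrite ?lexx ?hr.
have d2 : 0 <= (n.+3%:R - 2) / 2 :> R by rewrite divr_ge0// subr_ge0 ler_nat.
have C0 : 0 <= C by rewrite /C addr_ge0// divr_ge0 ?(ltW h0)// subr_ge0 ler_nat.
have P1 : 0 <= ppow p (U h) / p by rewrite divr_ge0 ?ppow_ge0//; have := p3; lra.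
have P2 : - (C * U h ^+ 2) <= U h * V h.
  move: dV; rewrite ler_norml => /andP[+ _] => /(ler_wpM2l Uh).
  by rewrite mulrN expr2 mulrCA.
set k := h ^+ n.+3 / 2 + _.
have k0 : 0 <= k.
  by rewrite /k; nonneg.
have U2 : U h ^+ 2 <= (expR (C * r) * U r) ^+ 2 by rewrite lerXn2r ?nnegrE// (le_trans Uh).
apply: (@le_trans _ _ (- k * U h ^+ 2)).
  by rewrite !mulNr lerN2 ler_wpM2l.
rewrite /pohozaev /energy.
have hn3 : 0 <= h ^+ n.+3 by rewrite exprn_ge0// ltW.
have hn2 : 0 <= (n.+3%:R - 2) / 2 * h ^+ n.+2 by rewrite mulr_ge0// exprn_ge0// ltW.
have e1 : - (U h ^+ 2 / 2) <= V h ^+ 2 / 2 - U h ^+ 2 / 2 + ppow p (U h) / p.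
  have := sqr_ge0 (V h); lra.
have := ler_wpM2l hn3 e1; have := ler_wpM2l hn2 P2; rewrite /k.
move: (h ^+ n.+3) (h ^+ n.+2) => x y; lra.
Qed.

End fixed_profile.

Lemma profile_not_small_ge4 (m : nat) (r : R) : 0 < r ->
  exists2 e, 0 < e < r & forall p (U V : R -> R), radial_profile m.+4 r p U V ->
    3 <= p -> m.+4%:R / p <= (m.+4%:R - 2) / 2 -> 0 < U r ->
    exists2 s, e <= s <= r & 1 / 2 < U s.
Proof.
move=> r0; set d := m.+4%:R.
pose h := r / 2; pose C := (d - 2) / h + 1.
(* [e] is small enough for a contradiction: if U <= 1/2 on [e, r], then
   c3 U(r) s^(2 - N) <= U(s), hence P(s) + k U(r)^2 ln s is nonincreasing on
   [e, h], although P(e) <= 0 and - M U(r)^2 <= P(h). *)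
pose M := (h ^+ m.+4 / 2 + (d - 2) / 2 * h ^+ m.+3 * C) * expR (C * r) ^+ 2.
(* [c0] is the integral of [s^(d-1) / 2] over [h, r], a lower bound for the flux in units of [U r].
   Division by [d - 2 + r] converts flux into size, [U(r) c3 <= s^(d-2) U(s)]. Squaring, [s^(d-1)
   U^2 >= c3^2 U(r)^2 s^(-m-1) >= k U(r)^2 / s] with [m = d - 4]: this is where dimension at least 4
   makes the integral diverge at 0. *)
pose c0 := (r ^+ m.+4 - h ^+ m.+4) / (2 * d).
pose c3 := c0 / (d - 2 + r).
pose k := c3 ^+ 2 / r ^+ m.
(* With this value [k ln (h / e) = M + k], which exceeds the drop [M] that the Pohozaev functional
   can afford. *)
pose e := h * expR (- (M / k) - 1).
have h0 : 0 < h by rewrite divr_gt0.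
have hr : h < r by rewrite /h; lra.
have d0 : 0 < d by rewrite ltr0n.
have d2 : 0 < d - 2 by rewrite subr_gt0 ltr_nat.
have C0 : 0 <= C by rewrite /C addr_ge0// divr_ge0// ltW.
have M0 : 0 <= M.
  by rewrite /M; nonneg.
have c00 : 0 < c0.
  rewrite /c0 divr_gt0 ?mulr_gt0// subr_gt0.
  by rewrite ltrXn2r ?nnegrE ?ltW.
have c30 : 0 < c3 by rewrite /c3 divr_gt0// addr_gt0.
have k0 : 0 < k by rewrite /k divr_gt0// exprn_gt0.
have eh : e < h.
  rewrite /e -[ltRHS]mulr1 ltr_pM2l// expR_lt1.
  have : 0 <= M / k by rewrite divr_ge0// ltW.
  lra.
have e0 : 0 < e by rewrite /e mulr_gt0// expR_gt0.
exists e; first by rewrite e0 (lt_trans eh).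
move=> p U V UV p3 pd a0; apply: contrapT => nsmall.
have small s : e <= s -> s <= r -> U s <= 1 / 2.
  by move=> es sr; rewrite leNgt; apply/negP => us; apply: nsmall; exists s; rewrite ?es.
have cU := profile_continuous UV; have cV := profile_derivative_continuous UV.
have sub s : e < s < r -> 0 < s < r by move=> /andP[/(lt_trans e0) -> ->].
have dU s : e < s < r -> is_derive s 1 U (V s) by move=> /sub h'; exact: (profile_derive UV h').
have dV s (sr : e < s < r) := profile_derive_ppow UV (sub s sr).
have Uge s : e <= s -> s <= r -> 0 <= U s.
  by move=> es sr; rewrite (profile_ge0 UV)// (le_trans (ltW e0) es).
have Xle s : e <= s -> s <= r -> ppow (p - 1) (U s) <= 1 / 2 * U s.
  by move=> es sr; apply: ppow_small => //; [lra|rewrite Uge//= small].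
have cw (A : R -> R) : {within `[0, r], continuous A} -> {within `[e, r], continuous A}.
  by apply: continuous_subspaceW => s; rewrite /= !in_itv/= => /andP[/(le_trans (ltW e0)) -> ->].
have cUe := cw _ cU; have cVe := cw _ cV.
(* The radial flux: its derivative contains no friction term, and the Neumann condition makes it
   vanish at [r]. *)
pose F s := s ^+ m.+3 * V s.
have dF s : e < s < r -> is_derive s 1 F (s ^+ m.+3 * (U s - ppow (p - 1) (U s))).
  move=> /[dup] sr /andP[es _]; have := dV s sr => ?; have := is_derive_exprn m.+2 s => ?.
  have sn0 : s != 0 by rewrite gt_eqF// (lt_trans e0).
  rewrite /F; apply: is_derive_eq; rewrite /GRing.scale/=.
  rewrite (_ : m.+3%:R = d - 1); last by rewrite /d [m.+4%:R]mulrSr addrK.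
  by rewrite -/d !exprS; field; rewrite sn0.
have cF : {within `[e, r], continuous F} by rewrite /F; within_cont.
have Fr : F r = 0 by rewrite /F (profile_derivative_end UV) mulr0.
have V_le0 s : e <= s -> s <= r -> V s <= 0.
  move=> es sr.
  have : F s <= F r.
    apply: (is_derive_ge cF dF) => // x /andP[/ltW ex /ltW xr].
    rewrite mulr_ge0 ?exprn_ge0 ?(le_trans (ltW e0) ex)//.
    have := Xle _ ex xr; have := Uge _ ex xr; lra.
  by rewrite Fr /F pmulr_rle0// exprn_gt0// (lt_le_trans e0).
have Ua s : e <= s -> s <= r -> U r <= U s.
  move=> es sr; apply: (is_derive_le cUe dU) => // x /andP[/ltW ex /ltW xr].
  exact: V_le0.
(* Since [U - U^(p-1) >= U / 2 >= U(r) / 2], the flux grows at least as fast as the primitive of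
   [U(r) / 2 * s^(d-1)] that is subtracted here. *)
pose G s := F s - U r / (2 * d) * s ^+ m.+4.
have F_le s : e <= s -> s <= h -> F s <= - (U r * c0).
  move=> es sh.
  have : G s <= G r.
    apply: (@is_derive_ge _ G (fun s => s ^+ m.+3 * (U s - ppow (p - 1) (U s)) -
        U r / 2 * s ^+ m.+3) e r) => //; last by rewrite (le_trans sh)// ltW.
    - by rewrite /G; within_cont.
    - move=> x xr; have := dF x xr => ?; have := is_derive_exprn m.+3 x => ?.
      by rewrite /G; apply: is_derive_eq; rewrite /GRing.scale/= -/d; field; rewrite gt_eqF.
    - move=> x /andP[/ltW ex /ltW xr].
      rewrite [X in _ - X]mulrC -mulrBr mulr_ge0 ?exprn_ge0 ?(le_trans (ltW e0) ex)//.
      have := Xle _ ex xr; have := Ua _ ex xr; lra.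
  rewrite /G Fr => H.
  have sh' : s ^+ m.+4 <= h ^+ m.+4 by rewrite lerXn2r ?nnegrE ?(ltW h0)// (le_trans (ltW e0)).
  have q0 : 0 <= U r / (2 * d) by nonneg.
  have := ler_wpM2l q0 sh'.
  rewrite (_ : U r * c0 = U r / (2 * d) * (r ^+ m.+4 - h ^+ m.+4)); last by rewrite /c0; field; rewrite gt_eqF.
  move: H; rewrite mulrBr; move: (U r / (2 * d)) (F s) (s ^+ _) (h ^+ _) (r ^+ _) => q f x y z; lra.
(* The derivative bound is used backwards: a large flux forces a large [U], of the order of the
   fundamental solution [s^(2-d)]. *)
have U_low s : e <= s -> s <= h -> U r * c3 <= s ^+ m.+2 * U s.
  move=> es sh; have s0 := lt_le_trans e0 es.
  have sr : s <= r by rewrite (le_trans sh)// ltW.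
  have dr : 0 < d - 2 + r by exact: addr_gt0.
  rewrite /c3 mulrA ler_pdivrMr//.
  have := @profile_derivative_bound _ _ _ _ _ _ UV p3 pd s; rewrite s0 sr => /(_ isT).
  rewrite ler0_norm ?V_le0// => /(ler_wpM2l (exprn_ge0 m.+3 (ltW s0))).
  rewrite mulrN -/(F s) => H.
  have E : s ^+ m.+3 * (((m.+4%:R - 2) / s + 1) * U s) = s ^+ m.+2 * U s * (d - 2 + s).
    by rewrite -/d [s ^+ m.+3]exprS; field; rewrite gt_eqF.
  rewrite E in H.
  have H2 : s ^+ m.+2 * U s * (d - 2 + s) <= s ^+ m.+2 * U s * (d - 2 + r).
    by rewrite ler_wpM2l ?lerD2l// mulr_ge0 ?exprn_ge0 ?Uge// ltW.
  apply: le_trans H2; apply: le_trans H; rewrite lerNr.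
  exact: F_le.
pose Phi s := pohozaev m.+1 p U V s + U r ^+ 2 * k * ln s.
have Phi_le : Phi h <= Phi e.
  pose dPhi s := - (s ^+ m.+3 * U s ^+ 2) +
      (d / p - (d - 2) / 2) * (s ^+ m.+3 * ppow p (U s)) + U r ^+ 2 * k * s^-1.
  have DPhi s : 0 < s < r -> is_derive s 1 Phi (dPhi s).
    move=> sr; have := is_derive_pohozaev UV p3 sr => ?.
    have /andP[s0 _] := sr; have := is_derive1_ln s0 => ?.
    by rewrite /Phi /dPhi; apply: is_derive_eq; rewrite /GRing.scale/=; ring.
  apply: (@is_derive_le _ Phi dPhi e h) => //; last exact: ltW.
  - apply: derivable_within_continuous => s; rewrite in_itv/= => /andP[es sh].
    have := DPhi s; rewrite (lt_le_trans e0 es) (le_lt_trans sh hr) => /(_ isT) ?.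
    exact: ex_derive.
  - by move=> s /andP[es sh]; apply: DPhi; rewrite (lt_trans e0 es) (lt_trans sh hr).
  - move=> s /andP[es sh]; have s0 := lt_trans e0 es; have sn0 : s != 0 by rewrite gt_eqF.
    have t1 : (d / p - (d - 2) / 2) * (s ^+ m.+3 * ppow p (U s)) <= 0.
      rewrite mulr_le0_ge0 ?subr_le0//; apply: mulr_ge0; [nonneg|exact: ppow_ge0].
    suff : U r ^+ 2 * k * s^-1 <= s ^+ m.+3 * U s ^+ 2 by rewrite /dPhi; lra.
    rewrite ler_pdivrMr// /k mulrA ler_pdivrMr ?exprn_gt0//.
    have Ul := U_low _ (ltW es) (ltW sh).
    apply: (@le_trans _ _ ((s ^+ m.+2 * U s) ^+ 2)).
      rewrite -exprMn lerXn2r ?nnegrE//; first by rewrite mulr_ge0 ?ltW.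
      by rewrite (le_trans _ Ul)// mulr_ge0 ?ltW.
    rewrite (_ : (_ * _) ^+ 2 = s ^+ m.+3 * U s ^+ 2 * s * s ^+ m); last by rewrite !exprS; ring.
    rewrite ler_wpM2l//; first by nonneg.
    by rewrite lerXn2r ?nnegrE ?ltW// (lt_trans sh hr).
have Pe : pohozaev m.+1 p U V e <= 0.
  by apply: (pohozaev_le0 UV p3 pd); rewrite (ltW e0) ltW// (lt_trans eh).
have Ph : - (h ^+ m.+4 / 2 + (d - 2) / 2 * h ^+ m.+3 * C) * (expR (C * r) * U r) ^+ 2 <=
    pohozaev m.+1 p U V h := pohozaev_lower_bound r0 UV p3 pd.
move: Phi_le; rewrite /Phi.
have -> : ln e = ln h + (- (M / k) - 1) by rewrite /e lnM ?posrE ?expR_gt0// expRK.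
have {}Ph : - (M * U r ^+ 2) <= pohozaev m.+1 p U V h.
  by apply: le_trans Ph; rewrite [(expR _ * _) ^+ 2]exprMn mulNr lerN2 [leLHS]mulrA.
rewrite (_ : _ * k * (ln h + _) = U r ^+ 2 * k * ln h - M * U r ^+ 2 - U r ^+ 2 * k); last first.
  by field; rewrite gt_eqF.
have : 0 < U r ^+ 2 * k by rewrite mulr_gt0// exprn_gt0.
lra.
Qed.

End small_profiles.

(** * Dimension three *)

Section hyperbolic.
Context {R : realType}.
Implicit Types s : R.

Definition cosh s : R := (expR s + expR (- s)) / 2.
Definition sinh s : R := (expR s - expR (- s)) / 2.

Lemma is_derive_expRN s : is_derive s 1 (fun t : R => expR (- t)) (- expR (- s)).
Proof.
rewrite -mulrN1; apply: (@is_derive1_comp _ expR -%R).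
Qed.

Lemma is_derive_cosh s : is_derive s 1 cosh (sinh s).
Proof.
have := is_derive_expRN s => ?; have := is_derive_expR s => ?.
by rewrite /cosh; apply: is_derive_eq; rewrite /GRing.scale/= /sinh; ring.
Qed.

Lemma is_derive_sinh s : is_derive s 1 sinh (cosh s).
Proof.
have := is_derive_expRN s => ?; have := is_derive_expR s => ?.
by rewrite /sinh; apply: is_derive_eq; rewrite /GRing.scale/= /cosh; ring.
Qed.

Lemma continuous_cosh : continuous cosh.
Proof.
move=> s; apply: differentiable_continuous; apply/derivable1_diffP.
by have := is_derive_cosh s => ?; exact: ex_derive.
Qed.

Lemma continuous_sinh : continuous sinh.
Proof.
move=> s; apply: differentiable_continuous; apply/derivable1_diffP.
by have := is_derive_sinh s => ?; exact: ex_derive.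
Qed.

Lemma sqr_cosh s : cosh s ^+ 2 - sinh s ^+ 2 = 1.
Proof.
rewrite (_ : _ - _ = expR s * expR (- s)); first exact: expRxMexpNx_1.
by rewrite /cosh /sinh; field.
Qed.

Lemma sinh0 : sinh 0 = 0. Proof. by rewrite /sinh oppr0; ring. Qed.
Lemma cosh0 : cosh 0 = 1. Proof. by rewrite /cosh oppr0 expR0; field. Qed.

Lemma sinh_gt0 s : 0 < s -> 0 < sinh s.
Proof. by move=> s0; rewrite divr_gt0// subr_gt0 ltr_expR; lra. Qed.

Lemma sinh_lt_cosh s : sinh s < cosh s.
Proof. by rewrite /sinh /cosh; have := expR_gt0 (- s); lra. Qed.

Lemma cosh_gt0 s : 0 < cosh s.
Proof. by rewrite divr_gt0// addr_gt0// expR_gt0. Qed.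

Lemma cosh_ge1 s : 1 <= cosh s.
Proof.
by rewrite /cosh; have := expR_ge1Dx s; have := expR_ge1Dx (- s); lra.
Qed.

Lemma cosh_le_expR s : 0 <= s -> cosh s <= expR s.
Proof.
move=> s0; rewrite /cosh.
have : expR (- s) <= expR s by rewrite ler_expR; lra.
lra.
Qed.

(** This turns the sign of [cosh s - s * sinh s] into a comparison of radii: nonpositive at the
    critical radius, it is negative at every larger one. *)
Lemma cosh_sub_decreasing s t : 0 < s -> s < t ->
  cosh t - t * sinh t < cosh s - s * sinh s.
Proof.
move=> s0 st.
have D (x : R) : is_derive x 1 (fun x => cosh x - x * sinh x) (- (x * cosh x)).
  have := is_derive_cosh x => ?; have := is_derive_sinh x => ?.
  by apply: is_derive_eq; rewrite /GRing.scale/=; ring.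
apply: (is_derive_lt st _ (fun x _ => D x)).
  apply: continuous_subspaceT => x; apply: differentiable_continuous; apply/derivable1_diffP.
  by have := D x => ?; exact: ex_derive.
by move=> x /andP[x1 _]; rewrite oppr_lt0 mulr_gt0 ?cosh_gt0// (lt_trans s0).
Qed.

End hyperbolic.

(** * Solutions that are small away from the origin, in dimension three *)

Section dimension3.
Context {R : realType}.

(** The numerical contradiction with Pohozaev's inequality, where [s], [c] stand for [sinh e],
    [cosh e]. The first factor is at least [P / 4] and the second at most [- Q / 4], so the product
    is at most [- P Q / 16], whereas the right-hand side is at least [- e P^2], which is larger. *)
Lemma mul_lt_diff_sqr (P Q e c s w1 w2 : R) : 0 < P -> 0 < Q -> 0 < e -> 1 <= c -> 0 < s ->
  P * s <= Q / 4 -> Q * s <= P / 4 -> e * P < Q / 16 ->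
  - Q <= w1 <= - Q / 2 -> - P <= w2 <= - P / 2 ->
  (w1 * s - w2 * c) * (w1 * c - w2 * s) < e * (w1 ^+ 2 - w2 ^+ 2).
Proof.
move=> P0 Q0 e0 c1 s0 Ps Qs eP /andP[w1Q w1Q2] /andP[w2P w2P2].
have x_ge : P / 4 <= w1 * s - w2 * c.
  have h1 : - Q * s <= w1 * s by rewrite ler_wpM2r// ltW.
  have h2 : P / 2 * 1 <= - w2 * c by clear -P0 c1 w2P2; rewrite ler_pM//; lra.
  clear -Qs h1 h2; lra.
have y_le : Q / 4 <= - (w1 * c - w2 * s).
  have h1 : Q / 2 * 1 <= - w1 * c by clear -Q0 c1 w1Q2; rewrite ler_pM//; lra.
  have h2 : - w2 * s <= P * s by rewrite ler_wpM2r ?(ltW s0)// lerNl.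
  clear -Ps h1 h2; lra.
have xy : P / 4 * (Q / 4) <= (w1 * s - w2 * c) * - (w1 * c - w2 * s).
  by rewrite ler_pM// divr_ge0// ltW.
have ew2 : e * w2 ^+ 2 <= e * P ^+ 2.
  by rewrite ler_wpM2l ?(ltW e0)// -sqrrN lerXn2r ?nnegrE//; clear -P0 w2P w2P2; lra.
have ew1 : 0 <= e * w1 ^+ 2 by rewrite mulr_ge0 ?sqr_ge0 ?ltW.
have ePQ : e * P ^+ 2 < P / 4 * (Q / 4).
  rewrite (_ : e * _ = P * (e * P)); last by ring.
  by rewrite (_ : P / 4 * _ = P * (Q / 16)) ?ltr_pM2l//; field.
rewrite mulrN in xy; move: xy ew2 ew1 ePQ; rewrite [e * (_ - _)]mulrBr.
by move: (_ * (w1 * c - _)) (e * w2 ^+ 2) (e * w1 ^+ 2) (e * P ^+ 2) (P / 4 * _); clear => *; lra.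
Qed.

Lemma profile_not_small_3 (r : R) : 0 < r -> cosh r < r * sinh r ->
  exists2 e, 0 < e < r & exists2 del, 0 < del &
    forall p (U V : R -> R), radial_profile 3 r p U V ->
    3 <= p -> 3%:R / p <= (3%:R - 2) / 2 -> 0 < U r ->
    exists2 s, e <= s <= r & del < U s.
Proof.
move=> r0 hB.
(* The solution of the linear equation with value 1 and slope 0 at [r] is
   [(A cosh s - B sinh s) / s]; this [B] has the sign opposite to that of the overview. *)
pose A := r * cosh r - sinh r; pose B := r * sinh r - cosh r.
have B0 : 0 < B by rewrite /B subr_gt0.
have r1 : 1 < r.
  rewrite ltNge; apply/negP => r1; have := sinh_gt0 r0; have := sinh_lt_cosh r.
  have : r * sinh r <= 1 * sinh r by rewrite ler_wpM2r// ltW// sinh_gt0.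
  lra.
have A0 : 0 < A.
  rewrite /A subr_gt0 (lt_trans (sinh_lt_cosh r))// -[ltLHS]mul1r ltr_pM2r//.
  exact: cosh_gt0.
(* The smallness conditions of [mul_lt_diff_sqr], up to the common factor [U r]. *)
have [e [e0 er eA eB eAB]] : exists e, [/\ 0 < e, e < r, A * sinh e <= B / 4,
    B * sinh e <= A / 4 & e * A < B / 16].
  have sh_small c : 0 < c -> \forall x \near (0 : R)^'+, sinh x < c.
    move=> c0; apply: (@cvgr_lt _ _ _ _ sinh (sinh 0)); last by rewrite sinh0.
    by apply: cvg_at_right_filter; exact: continuous_sinh.
  near (0 : R)^'+ => e; exists e; split.
  - by near: e; exact: nbhs_right_gt.
  - by near: e; exact: nbhs_right_lt.
  - rewrite mulrC -ler_pdivlMr//; apply: ltW; near: e; apply: sh_small; rewrite !divr_gt0//.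
  - rewrite mulrC -ler_pdivlMr//; apply: ltW; near: e; apply: sh_small; rewrite !divr_gt0//.
  - rewrite -ltr_pdivlMr//; near: e; apply: nbhs_right_lt; rewrite !divr_gt0//.
exists e; first by rewrite e0.
pose H := expR (((3%:R - 2) / e + 1) * r).
(* [K * del * U r] bounds the nonlinear source [s U^(p-1)] multiplied by [cosh s] or [sinh s]; [del]
   is then chosen so that its integral over [e, r] moves the coefficients [A] and [B] by at most one
   half of their values. *)
pose K := r * expR r * H.
have H0 : 0 < H by exact: expR_gt0.
have K0 : 0 < K by rewrite /K mulr_gt0// mulr_gt0// expR_gt0.
pose del := Num.min 1 (Num.min (B / (2 * (K * r))) (A / (2 * (K * r)))).
have Kr0 : 0 < 2 * (K * r) by rewrite mulr_gt0// mulr_gt0.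
have del0 : 0 < del by rewrite !lt_min ltr01 !divr_gt0.
have del1 : del <= 1 by rewrite ge_min lexx.
have delB : K * del * r <= B / 2.
  have : del <= B / (2 * (K * r)) by rewrite !ge_min lexx !orbT.
  rewrite ler_pdivlMr// => h; lra.
have delA : K * del * r <= A / 2.
  have : del <= A / (2 * (K * r)) by rewrite !ge_min lexx !orbT.
  rewrite ler_pdivlMr// => h; lra.
exists del => // p U V UV p3 pd a0; apply: contrapT => nsmall.
have small s : e <= s -> s <= r -> U s <= del.
  by move=> es sr; rewrite leNgt; apply/negP => us; apply: nsmall; exists s; rewrite ?es.
have cU := profile_continuous UV; have cV := profile_derivative_continuous UV.
have sub s : e < s < r -> 0 < s < r by move=> /andP[/(lt_trans e0) -> ->].
have dU s : e < s < r -> is_derive s 1 U (V s) by move=> /sub h; exact: (profile_derive UV h).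
have dV s (sr : e < s < r) := profile_derive_ppow UV (sub s sr).
have Uge s : e <= s -> s <= r -> 0 <= U s.
  by move=> es sr; rewrite (profile_ge0 UV)// (le_trans (ltW e0) es).
pose X s := ppow (p - 1) (U s).
have X0 s : 0 <= X s by exact: ppow_ge0.
have Xle s : e <= s -> s <= r -> s * X s * expR r <= K * del * U r.
  move=> es sr.
  have h1 : X s <= del * U s by apply: ppow_small => //; rewrite Uge//= small.
  have h2 : U s <= H * U r by apply: (harnack UV p3 pd e0); rewrite ?es ?sr ?lexx ?(ltW er).
  have h3 : X s <= del * (H * U r) by apply: (le_trans h1); rewrite ler_wpM2l// ltW.
  have h4 : s * X s <= r * (del * (H * U r)) by rewrite ler_pM// (le_trans (ltW e0)).
  rewrite (_ : K * del * U r = r * (del * (H * U r)) * expR r); last by rewrite /K; ring.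
  by rewrite ler_wpM2r ?expR_ge0.
have cw (f : R -> R) : {within `[0, r], continuous f} -> {within `[e, r], continuous f}.
  by apply: continuous_subspaceW => s; rewrite /= !in_itv/= => /andP[/(le_trans (ltW e0)) -> ->].
have cUe := cw _ cU; have cVe := cw _ cV.
have cch : {within `[e, r], continuous (@cosh R)} by apply: continuous_subspaceT; exact: continuous_cosh.
have csh : {within `[e, r], continuous (@sinh R)} by apply: continuous_subspaceT; exact: continuous_sinh.
(* Variation of constants: [g = s U] solves [g'' = g - s U^(p-1)], and [W1], [W2] are its Wronskians
   with [cosh] and [sinh], which would be constant for the linear equation. *)
pose W1 s := (U s + s * V s) * cosh s - s * U s * sinh s.
pose W2 s := (U s + s * V s) * sinh s - s * U s * cosh s.
have dW1 s : e < s < r -> is_derive s 1 W1 (- (s * X s * cosh s)).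
  move=> /[dup] sr /andP[es _]; have := dU s sr => ?; have := dV s sr => ?.
  have := is_derive_cosh s => ?; have := is_derive_sinh s => ?.
  have sn0 : s != 0 by rewrite gt_eqF// (lt_trans e0).
  by rewrite /W1; apply: is_derive_eq; rewrite /GRing.scale/= /X; field.
have dW2 s : e < s < r -> is_derive s 1 W2 (- (s * X s * sinh s)).
  move=> /[dup] sr /andP[es _]; have := dU s sr => ?; have := dV s sr => ?.
  have := is_derive_cosh s => ?; have := is_derive_sinh s => ?.
  have sn0 : s != 0 by rewrite gt_eqF// (lt_trans e0).
  by rewrite /W2; apply: is_derive_eq; rewrite /GRing.scale/= /X; field.
have cW1 : {within `[e, r], continuous W1} by rewrite /W1; within_cont.
have cW2 : {within `[e, r], continuous W2} by rewrite /W2; within_cont.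
have W1r : W1 r = - (U r * B) by rewrite /W1 (profile_derivative_end UV) /B; ring.
have W2r : W2 r = - (U r * A) by rewrite /W2 (profile_derivative_end UV) /A; ring.
have bound (W f : R -> R) : {within `[e, r], continuous W} ->
    (forall s, e < s < r -> is_derive s 1 W (- (s * X s * f s))) ->
    (forall s, 0 < s < r -> 0 <= f s <= expR r) ->
    W r <= W e /\ W e <= W r + K * del * r * U r.
  move=> cW dW hf; split.
    apply: (is_derive_le cW dW) => //; last exact: ltW.
    move=> s /[dup] /sub /hf /andP[f0 _] /andP[es _].
    by rewrite oppr_le0 !mulr_ge0// ltW// (lt_trans e0).
  pose W' s := W s + K * del * U r * s.
  have : W' e <= W' r.
    apply: (@is_derive_ge _ W' (fun s => - (s * X s * f s) + K * del * U r) e r) => //; last exact: ltW.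
    - by rewrite /W'; within_cont.
    - by move=> s /dW ?; rewrite /W'; apply: is_derive_eq; rewrite /GRing.scale/=; ring.
    - move=> s /[dup] /sub /hf /andP[f0 f1] /andP[es sr].
      rewrite addrC subr_ge0; apply: le_trans (Xle s (ltW es) (ltW sr)).
      by rewrite ler_wpM2l// mulr_ge0// ltW// (lt_trans e0).
  have : 0 <= K * del * U r * e by rewrite !mulr_ge0// ltW.
  rewrite /W'; lra.
have [b1 b2] : W1 r <= W1 e /\ W1 e <= W1 r + K * del * r * U r.
  apply: (bound _ _ cW1 dW1) => s /andP[s0 sr]; rewrite ltW ?cosh_gt0//=.
  by rewrite (le_trans (cosh_le_expR (ltW s0)))// ler_expR ltW.
have [b3 b4] : W2 r <= W2 e /\ W2 e <= W2 r + K * del * r * U r.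
  apply: (bound _ _ cW2 dW2) => s /andP[s0 sr]; rewrite ltW ?sinh_gt0//=.
  by rewrite (le_trans (ltW (sinh_lt_cosh s)))// (le_trans (cosh_le_expR (ltW s0)))// ler_expR ltW.
have kB : K * del * r * U r <= B / 2 * U r by rewrite ler_wpM2r// ltW.
have kA : K * del * r * U r <= A / 2 * U r by rewrite ler_wpM2r// ltW.
pose g := e * U e; pose g' := U e + e * V e.
have gE : g = W1 e * sinh e - W2 e * cosh e.
  rewrite -[LHS]mulr1 -(sqr_cosh e) /W1 /W2 /g; ring.
have g'E : g' = W1 e * cosh e - W2 e * sinh e.
  rewrite -[LHS]mulr1 -(sqr_cosh e) /W1 /W2 /g'; ring.
(* Twice Pohozaev's inequality at [e], with the nonnegative term in [U^p] dropped, written in terms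
   of [g = s U] and its derivative. *)
have Poh : e * (g' ^+ 2 - g ^+ 2) <= g * g'.
  have er' : 0 <= e <= r by rewrite !ltW.
  have := pohozaev_le0 UV p3 pd er'.
  rewrite /pohozaev /energy.
  have Y0 : 0 <= e ^+ 3 * (ppow p (U e) / p).
    rewrite mulr_ge0 ?exprn_ge0 ?(ltW e0)// divr_ge0 ?ppow_ge0//; lra.
  rewrite /g /g'; lra.
have WW : g' ^+ 2 - g ^+ 2 = W1 e ^+ 2 - W2 e ^+ 2.
  rewrite gE g'E (_ : _ - _ = (W1 e ^+ 2 - W2 e ^+ 2) * (cosh e ^+ 2 - sinh e ^+ 2)); last by ring.
  by rewrite sqr_cosh mulr1.
rewrite WW in Poh.
move: Poh; rewrite gE g'E leNgt => /negP; apply.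
have aA : 0 < U r * A by exact: mulr_gt0.
have aB : 0 < U r * B by exact: mulr_gt0.
have a_ge0 := ltW a0.
apply: (mul_lt_diff_sqr aA aB) => //; first exact: cosh_ge1.
- exact: sinh_gt0.
- by rewrite -!mulrA ler_wpM2l.
- by rewrite -!mulrA ler_wpM2l.
- by rewrite mulrCA -mulrA ltr_pM2l.
- rewrite -W1r b1/= (le_trans b2)// W1r; move: kB; clear.
  by move: (K * _ * _ * _) => k; lra.
- rewrite -W2r b3/= (le_trans b4)// W2r; move: kA; clear.
  by move: (K * _ * _ * _) => k; lra.
Unshelve. all: by end_near. Qed.

End dimension3.

(** * The Green function *)

Section maximum_principle.
Context {R : realType}.

(** Were [l] positive, [f'] would be positive just to the right of 0 and [f] would exceed its
    maximum there. *)
Lemma second_derivative_le0 (f f' : R -> R) (l : R) :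
  (\forall t \near (0 : R), is_derive (t : R) 1 f (f' t)) -> is_derive (0 : R) 1 f' l ->
  (\forall t \near (0 : R), f t <= f 0) -> l <= 0.
Proof.
move=> df df' fmax; rewrite leNgt; apply/negP => l0.
have /nbhs_ballP[d /= d0 Hd] :
    nbhs (0 : R) [set t : R | is_derive t 1 f (f' t) /\ f t <= f 0].
  exact: filterI df fmax.
have Hball (t : R) : `|t| < d -> is_derive t 1 f (f' t) /\ f t <= f 0.
  by move=> td; apply: Hd; rewrite /ball/= sub0r normrN.
have f'0 : f' 0 = 0.
  have d00 : `|0 : R| < d by rewrite normr0.
  have [D0 _] := Hball 0 d00.
  suff D1 : is_derive (0 : R) 1 f 0.
    by rewrite -(@derive_val _ _ _ _ _ _ _ D0) (@derive_val _ _ _ _ _ _ _ D1).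
  apply: (@derive1_at_max _ f (- d) d 0).
  - lra.
  - move=> t; rewrite in_itv/= -ltr_norml => /Hball[? _]; exact: ex_derive.
  - by rewrite in_itv/= oppr_lt0 d0.
  - by move=> t; rewrite in_itv/= -ltr_norml => /Hball[].
have [D DE] := df'.
have /nbhs_ballP[d' /= d'0 Hd'] : nbhs (0 : R)
    [set t : R | t != 0 -> 0 < t^-1 *: ((f' \o shift 0) (t *: 1) - f' 0)].
  have lim : t^-1 *: ((f' \o shift 0) (t *: 1) - f' 0) @[t --> (0 : R)^'] --> l.
    by rewrite -DE; exact: D.
  by apply: (@cvgr_gt _ _ _ _ _ _ lim).
pose t := Num.min d d' / 2.
have m0 : 0 < Num.min d d' by rewrite lt_min d0.
have t0 : 0 < t by rewrite divr_gt0.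
have tm : t < Num.min d d' by rewrite /t; lra.
have [tdd tdd'] : t < d /\ t < d' by move: tm; rewrite lt_min => /andP[].
have f'pos c : 0 < c -> c <= t -> 0 < f' c.
  move=> c0 ct.
  have : 0 < c^-1 *: ((f' \o shift 0) (c *: 1) - f' 0).
    apply: Hd'; last by rewrite gt_eqF.
    by rewrite /ball/= sub0r normrN gtr0_norm// (le_lt_trans ct).
  by rewrite f'0 subr0 /= addr0 [_%:A]mulr1 pmulr_rgt0// invr_gt0.
have : f 0 < f t.
  have cf : {within `[0, t], continuous (fun s => - f s)}.
    apply: derivable_within_continuous => s; rewrite in_itv/= => /andP[s0 st].
    apply: derivableN.
    have [|? _] := Hball s; last exact: ex_derive.
    by rewrite ger0_norm// (le_lt_trans st).
  rewrite -ltrN2; apply: (is_derive_lt t0 cf (df := fun s => - f' s)).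
    move=> s /andP[s0 st]; apply: is_deriveN.
    by have [|? _] := Hball s; first by rewrite gtr0_norm// (lt_trans st).
  by move=> s /andP[s0 st]; rewrite oppr_lt0 f'pos// ltW.
rewrite ltNge => /negP; apply.
by have [|_] := Hball t; first by rewrite gtr0_norm.
Qed.

Lemma laplacian_le0_at_max n (f : 'rV[R]_n -> R) x :
  (forall i, \forall y \near x, derivable f y (basis_vec i)) ->
  (forall i, derivable (partial i f) x (basis_vec i)) ->
  (\forall y \near x, f y <= f x) -> laplacian f x <= 0.
Proof.
move=> df ddf fmax; apply: sumr_le0 => i _.
pose L (t : R) := x + t *: basis_vec i.
have cL : L t @[t --> (0 : R)] --> x.
  rewrite -[X in _ --> X]addr0 -[X in _ --> _ + X](scale0r (basis_vec i)).
  by apply: cvgD; [exact: cvg_cst|exact: scalel_continuous].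
have L0 : L 0 = x by rewrite /L scale0r addr0.
apply: (@second_derivative_le0 (fun t => f (L t)) (fun t => partial i f (L t))).
- have := cL _ (df i); apply: (@filterS _ (nbhs (0 : R))) => t.
  rewrite /= line_derivable => ?; split => //.
  by rewrite /partial line_derive.
- by apply/(is_derive_line (partial i f) x (basis_vec i)); exact: (derivableP (ddf i)).
- have := cL _ fmax; apply: (@filterS _ (nbhs (0 : R))) => t /=.
  by rewrite L0.
Qed.

End maximum_principle.

(** * Comparison of the Green function with radial solutions of the linear equation *)

Section green_comparison.
Context {R : realType}.

(* The radial solutions of [Delta f = f] on the punctured ball in dimension 3. *)
Definition yukawa (a b s : R) : R := (a * cosh s + b * sinh s) / s.
Definition yukawa' (a b s : R) : R :=
  (a * sinh s + b * cosh s) / s - (a * cosh s + b * sinh s) / s ^+ 2.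

Lemma is_derive_yukawa (a b s : R) : s != 0 -> is_derive s 1 (yukawa a b) (yukawa' a b s).
Proof.
move=> s0; have := is_derive_cosh s => ?; have := is_derive_sinh s => ?.
have dV := is_deriveV (f := id) s0 (is_derive_id s 1).
by rewrite /yukawa; apply: is_derive_eq; rewrite /GRing.scale/= /yukawa'; field.
Qed.

Lemma is_derive_yukawa' (a b s : R) : s != 0 ->
  is_derive s 1 (yukawa' a b) (yukawa a b s - 2 / s * yukawa' a b s).
Proof.
move=> s0; have := is_derive_cosh s => ?; have := is_derive_sinh s => ?.
have dV := is_deriveV (f := id) s0 (is_derive_id s 1).
have s20 : s ^+ 2 != 0 by rewrite expf_neq0.
have dX : is_derive s 1 (fun t : R => t ^+ 2) (2 * s).
  by apply: is_derive_eq; rewrite /GRing.scale/=; ring.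
have dV2 := is_deriveV (f := fun t : R => t ^+ 2) s20 dX.
by rewrite /yukawa'; apply: is_derive_eq; rewrite /GRing.scale/= /yukawa /yukawa'; field.
Qed.

Lemma coord_le_enorm n (x : 'rV[R]_n) i : `|x ord0 i| <= enorm x.
Proof.
rewrite -(@ler_pXn2r _ 2)// ?nnegrE ?enorm_ge0//.
rewrite enorm_sq (bigD1 i)//= real_normK ?num_real// lerDl.
by apply: sumr_ge0 => j _; exact: sqr_ge0.
Qed.

Lemma near_punctured0 n (P : set 'rV[R]_n) : (\forall x \near (0 : 'rV[R]_n)^', P x) ->
  exists2 d, 0 < d & forall x, 0 < enorm x < d -> P x.
Proof.
rewrite near_withinE => H.
have /nbhs_rVP[d d0 Hd] : nbhs (0 : 'rV[R]_n) [set x | x != 0 -> P x] by exact: H.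
exists d => // x /andP[x0 xd]; apply: Hd => [i|].
  by rewrite mxE subr0 (le_lt_trans (coord_le_enorm _ _)).
by apply/eqP => x0'; move: x0; rewrite x0' enorm0 ltxx.
Qed.

Section comparison.
Variables (r a0 : R) (G : 'rV[R]_3 -> R).
Hypotheses (r0 : 0 < r) (a00 : 0 < a0).
Hypothesis (CG : C2_upto (eball r `\ 0) (eclosed_ball r `\ 0) G).
Hypothesis (eqG : forall x, eball r x -> x != 0 -> laplacian G x = G x).
Hypothesis (bdG : forall x, esphere r x -> is_normal_derivative r G x 0).
Hypothesis (mG : G x - a0 / enorm x @[x --> (0 : 'rV[R]_3)^'] --> 0).

(** Maximum principle for the difference [M]. The strict inequality [a < a0] makes [M] negative near
    the pole, and the strictly negative slope excludes a positive maximum on the sphere. At an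
    interior one, [laplacian M = M > 0] contradicts maximality. *)
Lemma green_ge_yukawa (a b : R) : a < a0 -> yukawa' a b r < 0 ->
  forall x, eball r x -> x != 0 -> yukawa a b (enorm x) <= G x.
Proof.
move=> aa0 kr x1 x1r x10; rewrite leNgt; apply/negP => Gx1.
pose M x := yukawa a b (enorm x) - G x.
have M1 : 0 < M x1 by rewrite subr_gt0.
have [d d0 Hd] : exists2 d, 0 < d & forall x : 'rV[R]_3, 0 < enorm x < d -> M x < 0.
  have [d1 d10 Hd1] : exists2 d, 0 < d &
      forall x : 'rV[R]_3, 0 < enorm x < d -> `|G x - a0 / enorm x| < 1.
    apply: near_punctured0.
    by move/cvgrPdist_lt : mG => /(_ 1 ltr01); apply: filterS => x; rewrite sub0r normrN.
  have [d2 d20 Hd2] : exists2 d, 0 < d & forall s, 0 < s < d ->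
      a * cosh s + b * sinh s < (a + a0) / 2.
    have c0 : a * cosh s + b * sinh s @[s --> (0 : R)] --> a.
      rewrite -[X in _ --> X](_ : a * cosh 0 + b * sinh 0 = a); last first.
        by rewrite cosh0 sinh0; ring.
      by apply: cvgD; apply: cvgMr; [exact: continuous_cosh|exact: continuous_sinh].
    have aa : a < (a + a0) / 2 by lra.
    have /nbhs_ballP[d /= dd0 Hd] : nbhs (0 : R)
        [set s | a * cosh s + b * sinh s < (a + a0) / 2] by exact: (cvgr_lt _ c0).
    exists d => // s /andP[s0 sd]; apply: Hd.
    by rewrite /ball/= sub0r normrN gtr0_norm.
  exists (Num.min d1 (Num.min d2 ((a0 - a) / 2))).
    by rewrite !lt_min d10 d20 divr_gt0// subr_gt0.
  move=> x; rewrite !lt_min => /and4P[x0 x1' x2' x3'].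
  have := Hd1 x; rewrite x0 x1' => /(_ isT); rewrite ltr_norml => /andP[h1 _].
  have := Hd2 (enorm x); rewrite x0 x2' => /(_ isT) h2.
  have k_lt : yukawa a b (enorm x) < (a + a0) / 2 / enorm x.
    by rewrite /yukawa ltr_pM2r ?invr_gt0.
  have : 1 < (a0 - a) / 2 / enorm x by rewrite ltr_pdivlMr// mul1r.
  move: k_lt; rewrite /M; lra.
have M_lo (x : 'rV[R]_3) : 0 < M x -> 0 < enorm x -> d <= enorm x.
  move=> Mx x0; rewrite leNgt; apply/negP => xd.
  by have := Hd x; rewrite x0 xd => /(_ isT); rewrite ltNge (ltW Mx).
pose S : set 'rV[R]_3 := [set x | d <= enorm x <= r].
have S1 : S x1.
  by apply/andP; split; [apply: M_lo => //; exact: enorm_gt0|exact: ltW].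
have cS : compact S.
  apply: bounded_closed_compact.
    exists r; split; first exact: num_real.
    move=> y ry x /andP[_ xr].
    suff : `|x| <= y by [].
    rewrite [leLHS]/Num.norm /= mx_normrE; apply/bigmax_leP; split => [|[i j] _ /=].
      by rewrite (le_trans (ltW r0))// ltW.
    by rewrite ord1 (le_trans (coord_le_enorm _ _))// (le_trans xr)// ltW.
  rewrite (_ : S = @enorm R 3 @^-1` [set y | d <= y] `&` @enorm R 3 @^-1` [set y | y <= r]).
    apply: closedI; apply: closed_comp => //; try by move=> ? _; exact: continuous_enorm.
  apply/seteqP; split => y; first by move=> /andP[].
  by move=> [h1 h2]; apply/andP.
have [cG _ _ _ _] := CG.
have SK : S `<=` eclosed_ball r `\ 0.
  move=> x /andP[x0 xr]; split => // x0'.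
  by move: x0; rewrite x0' enorm0 leNgt d0.
have dk (s : R) : 0 < s -> is_derive s 1 (yukawa a b) (yukawa' a b s).
  by move=> s0; apply: is_derive_yukawa; rewrite gt_eqF.
have cM : {within S, continuous M}.
  have cGS := continuous_subspaceW SK cG.
  move=> x; apply: cvgB; last exact: cGS.
  have : {within S, continuous (fun x : 'rV[R]_3 => yukawa a b (enorm x))}.
    apply: continuous_in_subspaceT => y; rewrite inE => /andP[y0 _].
    apply: (@continuous_comp _ _ _ (@enorm R 3) (yukawa a b)); first exact: continuous_enorm.
    apply: differentiable_continuous; apply/derivable1_diffP.
    by have := dk _ (lt_le_trans d0 y0) => ?; exact: ex_derive.
  exact.
have [x Sx maxS] : exists2 x, S x & forall y, S y -> M y <= M x.
  have [|x xS H] := EVT_max_rV _ cS cM; first by exists x1.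
  by exists x => [|y Sy]; [rewrite inE in xS|apply: H; rewrite inE].
have Mx : 0 < M x by rewrite (lt_le_trans M1)// maxS.
have /andP[dx xr] := Sx.
have x0 : 0 < enorm x by rewrite (lt_le_trans d0).
have maxK (y : 'rV[R]_3) : 0 < enorm y -> enorm y <= r -> M y <= M x.
  move=> y0 yr; have [My|My] := leP (M y) 0; first by rewrite (le_trans My)// ltW.
  by apply: maxS; apply/andP; split => //; exact: M_lo.
(* At a maximum on the sphere the difference quotients from inside are nonnegative; they tend to
   [yukawa' a b r], because the normal derivative of [G] is zero. *)
move: xr; rewrite le_eqVlt => /predU1P[xr|xr].
  have dGx := bdG (xr : esphere r x).
  have dkr : h^-1 * (yukawa a b (r + h) - yukawa a b r) @[h --> (0 : R)^'-] --> yukawa' a b r.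
    have [D DE] := dk _ r0.
    have lim : h^-1 *: ((yukawa a b \o shift r) (h *: 1) - yukawa a b r) @[h --> (0 : R)^'] -->
        yukawa' a b r by rewrite -DE; exact: D.
    have := cvg_dnbhs_at_left lim; apply: cvg_trans; apply: near_eq_cvg.
    by near=> h; rewrite /= [_%:A]mulr1 [r + h]addrC.
  have lim : h^-1 * (yukawa a b (r + h) - yukawa a b r) - h^-1 * (G (x + (h / r) *: x) - G x)
      @[h --> (0 : R)^'-] --> yukawa' a b r.
    by rewrite -[X in _ --> X]subr0; exact: cvgB dkr dGx.
  have : 0 <= yukawa' a b r.
    apply: (cvgr_to_ge lim); near=> h.
    have h0 : h < 0 by near: h; exact: nbhs_left_lt.
    have hr : - r < h by near: h; apply: nbhs_left_gt; rewrite oppr_lt0.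
    have Eh : enorm (x + (h / r) *: x) = r + h.
      rewrite -{1}[x]scale1r -scalerDl enormZ xr ger0_norm.
        by field; rewrite gt_eqF.
      by rewrite -(ler_pM2r r0) mul0r mulrDl mul1r divfK ?gt_eqF//; lra.
    have : M (x + (h / r) *: x) <= M x by apply: maxK; rewrite Eh; lra.
    rewrite /M Eh xr => H.
    by rewrite -mulrBr nmulr_rge0 ?invr_lt0//; lra.
  by rewrite leNgt kr.
pose kf := fun y : 'rV[R]_3 => yukawa a b (enorm y).
have nearO : \forall y \near x, 0 < enorm y /\ eball r y.
  near=> y; split.
    by near: y; exact: (cvgr_gt (enorm x) (@continuous_enorm R 3 x)).
  by near: y; apply: open_nbhs_nbhs; split => //; exact: open_eball.
have oO : open (eball r `\ (0 : 'rV[R]_3)).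
  rewrite setDE; apply: openI; [exact: open_eball|apply: closed_openC].
  by apply: accessible_closed_set1; apply: hausdorff_accessible; exact: norm_hausdorff.
have CO : C2_in (eball r `\ (0 : 'rV[R]_3)) G.
  by apply: (C2_upto_in oO _ CG) => y [ry y0]; split => //; exact: eball_sub_closed.
have [_ dG _ ddG _] := CO.
have inO (y : 'rV[R]_3) : 0 < enorm y -> eball r y -> (eball r `\ (0 : 'rV[R]_3)) y.
  by move=> y0 yr; split => // y0'; move: y0; rewrite y0' enorm0 ltxx.
have kk (y : 'rV[R]_3) : \forall z \near y, kf z = yukawa a b (enorm z) by near=> z.
have dkf i (y : 'rV[R]_3) : 0 < enorm y -> is_derive y (basis_vec i) kf (yukawa' a b (enorm y) * (y ord0 i / enorm y)).
  by move=> y0; apply: (is_derive_radial _ y0 (kk y)); exact: dk.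
have dkn : \forall s \near enorm x, is_derive (s : R) 1 (yukawa a b) (yukawa' a b s).
  by near=> s; apply: dk; near: s; exact: lt_nbhsr.
have dk2 : is_derive (enorm x) 1 (yukawa' a b)
    (yukawa a b (enorm x) - 2 / enorm x * yukawa' a b (enorm x)).
  by apply: is_derive_yukawa'; rewrite gt_eqF.
have ddkf i := is_derive2_radial i x0 (kk x) dkn dk2.
have dM i (y : 'rV[R]_3) : 0 < enorm y -> eball r y -> derivable M y (basis_vec i).
  move=> y0 yr; have ? := dkf i _ y0.
  by apply: derivableB; [exact: ex_derive|apply: dG; exact: inO].
have pM i : \forall y \near x, partial i kf y - partial i G y = partial i M y.
  move: nearO; apply: (@filterS _ (nbhs x)) => y [y0 yr].
  have ? := dkf i _ y0; rewrite /partial [RHS]deriveB//.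
  by apply: dG; exact: inO.
have dpM i : is_derive x (basis_vec i) (partial i M)
    (partial i (partial i kf) x - partial i (partial i G) x).
  apply: (near_eq_is_derive (pM i)).
  have ? := ddkf i; apply: is_deriveB; first by apply: derivableP; exact: ex_derive.
  by apply: derivableP; apply: ddG; exact: inO.
have : laplacian M x <= 0.
  apply: laplacian_le0_at_max => [i|i|].
  - by move: nearO; apply: (@filterS _ (nbhs x)) => y [y0 yr]; exact: dM.
  - by have ? := dpM i; exact: ex_derive.
  - by move: nearO; apply: (@filterS _ (nbhs x)) => y [y0 yr]; apply: maxK => //; exact: ltW.
have -> : laplacian M x = laplacian kf x - laplacian G x.
  rewrite /laplacian -sumrB; apply: eq_bigr => i _.
  by have ? := dpM i; rewrite [LHS]derive_val.
rewrite (laplacian_radial x0 (kk x) dkn dk2) eqG//; last by apply/eqP => x0'; move: x0; rewrite x0' enorm0 ltxx.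
rewrite (_ : _ - _ = M x); first by rewrite leNgt Mx.
rewrite /M (_ : 3%:R - 1 = 2); last by ring.
by ring.
Unshelve. all: by end_near. Qed.

End comparison.
Lemma sinh_lt_mul_cosh (s : R) : 0 < s -> sinh s < s * cosh s.
Proof.
move=> s0.
have D (x : R) : is_derive x 1 (fun x => sinh x - x * cosh x) (- (x * sinh x)).
  have := is_derive_cosh x => ?; have := is_derive_sinh x => ?.
  by apply: is_derive_eq; rewrite /GRing.scale/=; ring.
have : sinh s - s * cosh s < sinh 0 - 0 * cosh 0.
  apply: (is_derive_lt s0 _ (fun x _ => D x)).
    apply: continuous_subspaceT => x; apply: differentiable_continuous; apply/derivable1_diffP.
    by have := D x => ?; exact: ex_derive.
  by move=> x /andP[x0 _]; rewrite oppr_lt0 mulr_gt0 ?sinh_gt0.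
by rewrite sinh0 mul0r subr0 subr_lt0.
Qed.

(** If [cosh r] were larger, some comparison function with the exact singularity [a0 / s] and a
    coefficient [b > 0] would lie below [G]. It behaves like [a0 / s + b] near 0, so the mass of [G]
    would be positive. *)
Lemma green_mass0_cosh_le (r : R) : 0 < r -> green_mass r 0 -> cosh r <= r * sinh r.
Proof.
move=> r0 [G gG mG]; rewrite leNgt; apply/negP => B0.
pose A := r * cosh r - sinh r; pose B := cosh r - r * sinh r.
have {}B0 : 0 < B by rewrite subr_gt0.
have A0 : 0 < A by rewrite subr_gt0 sinh_lt_mul_cosh.
pose a0 : R := (4 * pi)^-1.
have a00 : 0 < a0 by rewrite invr_gt0 mulr_gt0// pi_gt0.
(* Chosen so that [b A = a0 B / 2]: the slope [(b A - a B) / r^2] at [r] is negative for every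
   [a > a0 / 2]. *)
pose b := a0 * B / (2 * A).
have b0 : 0 < b by rewrite divr_gt0// mulr_gt0.
have mG' : G x - a0 / enorm x @[x --> (0 : 'rV[R]_3)^'] --> 0.
  rewrite (_ : (fun x => _) = (fun x => G x - (4 * pi * enorm x)^-1))//.
  by apply/funext => x; rewrite [in RHS]invfM.
have [_ CG _ bdG] := gG.
have lower a (x : 'rV[R]_3) : a0 / 2 < a -> a < a0 -> eball r x -> x != 0 ->
    yukawa a b (enorm x) <= G x.
  move=> a1 a2; apply: (green_ge_yukawa r0 CG (green_pde gG) bdG mG' a2).
  rewrite /yukawa' (_ : _ - _ = (b * A - a * B) / r ^+ 2); last by rewrite /A /B; field; rewrite gt_eqF.
  rewrite pmulr_llt0 ?invr_gt0 ?exprn_gt0// subr_lt0.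
  rewrite (_ : b * A = a0 / 2 * B); last by rewrite /b; field; rewrite gt_eqF.
  by rewrite ltr_pM2r.
(* The comparison needs [a < a0] strictly; the limit case follows by taking [a = a0 - dl] with [dl]
   small compared with the gap [eta] at [x]. *)
have lower0 (x : 'rV[R]_3) : eball r x -> x != 0 -> yukawa a0 b (enorm x) <= G x.
  move=> xr xn0; rewrite leNgt; apply/negP => Gx.
  have x0 := enorm_gt0 xn0.
  pose eta := yukawa a0 b (enorm x) - G x.
  have eta0 : 0 < eta by rewrite subr_gt0.
  pose dl := Num.min (a0 / 4) (eta * enorm x / (2 * cosh (enorm x))).
  have c0 := cosh_gt0 (enorm x).
  have c20 : 0 < 2 * cosh (enorm x) by exact: mulr_gt0.
  have dl0 : 0 < dl.
    by rewrite lt_min divr_gt0//=; apply: divr_gt0 => //; exact: mulr_gt0.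
  have dl1 : dl <= a0 / 4 by rewrite ge_min lexx.
  have dl2 : dl * cosh (enorm x) / enorm x <= eta / 2.
    have : dl <= eta * enorm x / (2 * cosh (enorm x)) by rewrite ge_min lexx orbT.
    rewrite ler_pdivlMr// => h; rewrite ler_pdivrMr//; lra.
  have h1 : a0 / 2 < a0 - dl by lra.
  have h2 : a0 - dl < a0 by lra.
  have := lower _ x h1 h2 xr xn0.
  have -> : yukawa (a0 - dl) b (enorm x) = yukawa a0 b (enorm x) - dl * cosh (enorm x) / enorm x.
    by rewrite /yukawa; field; rewrite gt_eqF.
  move: dl2; rewrite /eta; lra.
have [d d0 Hd] : exists2 d, 0 < d &
    forall x : 'rV[R]_3, 0 < enorm x < d -> `|G x - a0 / enorm x| < b / 2.
  apply: near_punctured0.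
  have b20 : 0 < b / 2 by rewrite divr_gt0.
  by move/cvgrPdist_lt : mG' => /(_ _ b20); apply: filterS => x; rewrite sub0r normrN.
pose t := Num.min d r / 2.
have m0 : 0 < Num.min d r by rewrite lt_min d0.
have t0 : 0 < t by rewrite divr_gt0.
have tm : t < Num.min d r by rewrite /t; lra.
have [td tr] : t < d /\ t < r by move: tm; rewrite lt_min => /andP[].
pose x : 'rV[R]_3 := t *: basis_vec ord0.
have xt : enorm x = t by rewrite enormZ enorm_basis mulr1 gtr0_norm.
have xn0 : x != 0 by apply/eqP => x0'; move: t0; rewrite -xt x0' enorm0 ltxx.
have := Hd x; rewrite xt t0 td => /(_ isT); rewrite ltr_norml => /andP[_].
have xr : eball r x by rewrite /eball/= xt.
have := lower0 x xr xn0; rewrite xt.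
have sh : t / 2 <= sinh t.
  have := expR_ge1Dx t; have : expR (- t) <= 1 by rewrite expR_le1; lra.
  rewrite /sinh; lra.
have ch := cosh_ge1 t.
have : a0 / t + b / 2 <= yukawa a0 b t.
  rewrite /yukawa ler_pdivlMr// mulrDl divfK ?gt_eqF//.
  have := ler_wpM2l (ltW a00) ch; have := ler_wpM2l (ltW b0) sh; lra.
lra.
Qed.

End green_comparison.

(** * Conclusion *)

Section sequences_of_solutions.
Context {R : realType}.

(** The restriction to dimensions at most 6 enters here; equality holds in dimension 6. *)
Lemma critical_exponent_ge3 n : (n <= 3)%N -> 3 <= critical_exponent n.+3 :> R.
Proof.
move=> n3; have : n%:R <= 3 :> R by rewrite ler_nat.
have : 0 <= n%:R :> R by [].
rewrite /critical_exponent -[n.+3]addn3 natrD => n0 h; rewrite ler_pdivlMr; lra.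
Qed.

Lemma supercritical_ratio n (p : R) : critical_exponent n.+3 <= p ->
  n.+3%:R / p <= (n.+3%:R - 2) / 2.
Proof.
have : 0 <= n%:R :> R by [].
rewrite /critical_exponent -[n.+3]addn3 natrD => n0 h.
have d1 : 0 < (n%:R + 3 - 2 : R) by lra.
have p0 : 0 < p by apply: lt_le_trans h; rewrite divr_gt0// mulr_gt0//; lra.
move: h; rewrite ler_pdivrMr// ler_pdivrMr// => h; lra.
Qed.

Lemma lebesgue_norm_le n (O : set 'rV[R]_n) (f : 'rV[R]_n -> R) (c : R) :
  0 <= c -> (forall x, O x -> `|f x| <= c) -> (lebesgue_norm O +oo f <= c%:E)%E.
Proof.
move=> c0 fc; rewrite /lebesgue_norm unlock /Lnorm; case: ifPn => [_|_]; last by rewrite lee_fin.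
apply/ess_supP; apply: nearW => x /=; rewrite lee_fin patchE; case: ifPn => [|_].
  by rewrite inE => /fc.
by rewrite normr0.
Qed.

Lemma subsequence_cvg (s : nat -> nat) : (forall i j, (i < j)%N -> (s i < s j)%N) ->
  s k @[k --> \oo] --> \oo.
Proof.
move=> sinc; have sge k : (k <= s k)%N.
  by elim: k => // k IH; rewrite (leq_ltn_trans IH)// sinc.
move=> A [m _ Am]; exists m => // k /= mk; apply: Am => /=.
exact: leq_trans (sge k).
Qed.

(** * Sequences whose weak limit vanishes *)

Section vanishing.
Variables (n : nat) (r q : R) (p : nat -> R) (u : nat -> 'rV[R]_n.+3 -> R)
  (u0 : 'rV[R]_n.+3 -> R).
Local Notation e0 := (basis_vec ord0 : 'rV[R]_n.+3).
Hypotheses (r0 : 0 < r) (q1 : 1 < q) (p3 : forall k, 3 <= p k)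
  (pd : forall k, n.+3%:R / p k <= (n.+3%:R - 2) / 2) (pq : p k @[k --> \oo] --> q)
  (su : forall k, neumann_solution r (p k) (u k)) (su0 : neumann_solution r q u0)
  (ru : forall k, radial_on (eclosed_ball r) (u k)) (uu0 : weak_cvg_H1 (eball r) u u0).

Let p1 k : 1 <= p k. Proof. by have := p3 k; lra. Qed.

Lemma radial_ray (f : 'rV[R]_n.+3 -> R) x : radial_on (eclosed_ball r) f ->
  eclosed_ball r x -> f x = f (enorm x *: e0).
Proof.
have E : enorm (enorm x *: e0) = enorm x by rewrite enormZ enorm_basis mulr1 ger0_norm// enorm_ge0.
by move=> rf xr; apply: rf => //; rewrite /eclosed_ball/= E.
Qed.

(** Otherwise each solution exceeds [del] somewhere on [e, r]; Harnack's inequality spreads this to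
    a common lower bound on the whole annulus, which the weak limit would inherit. *)
Lemma weak_vanishing e del : (forall x, 0 < enorm x < r -> u0 x = 0) ->
  0 < e < r -> 0 < del -> exists k, forall s, e <= s <= r -> u k (s *: e0) <= del.
Proof.
move=> u00 /andP[e00 er] del0; apply: contrapT => H.
have big k : exists2 s, e <= s <= r & del < u k (s *: e0).
  apply: contrapT => Hk; apply: H; exists k => s sr.
  by rewrite leNgt; apply/negP => us; apply: Hk; exists s.
pose C := expR (((n.+3%:R - 2) / e + 1) * r).
have C0 : 0 < C by exact: expR_gt0.
pose O : set 'rV[R]_n.+3 := [set x | e < enorm x < r].
have oO : open O.
  rewrite (_ : O = @enorm R n.+3 @^-1` [set t | e < t] `&` eball r).
    apply: openI; last exact: open_eball.
    by apply: open_comp; [move=> x _; exact: continuous_enorm|exact: open_gt].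
  by apply/seteqP; split => x; [move=> /andP|move=> xO; apply/andP].
have Or : O `<=` eball r by move=> x /andP[].
have c0 : 0 < del / C by rewrite divr_gt0.
have low : \forall k \near \oo, forall x, O x -> del / C <= u k x.
  apply: nearW => k x /andP[ex xr].
  have xr' : eclosed_ball r x by exact: ltW.
  rewrite (radial_ray (ru k) xr') ler_pdivrMr//.
  have [s sr us] := big k; apply: (le_trans (ltW us)).
  have UV := neumann_profile r0 (su k) (ru k).
  by rewrite mulrC; apply: (harnack UV (p3 k) (pd k) e00) => //; rewrite !ltW.
have := weak_lower_bound q1 p1 pq su su0 uu0 oO Or c0 low.
pose x := ((e + r) / 2) *: e0.
have xE : enorm x = (e + r) / 2.
  by rewrite enormZ enorm_basis mulr1 gtr0_norm// divr_gt0// addr_gt0.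
move=> /(_ x); rewrite u00; last by rewrite xE; apply/andP; split; lra.
have Ox : O x by rewrite /O/= xE; apply/andP; split; lra.
by move=> /(_ Ox); rewrite leNgt c0.
Qed.

End vanishing.
End sequences_of_solutions.

Theorem theorem1p5 (R : realType) (N : nat) (r : R)
  (hN : (3 <= N <= 6)%N) (hr : 0 < r)
  (p : nat -> R)
  (hp : forall k, critical_exponent N <= p k)
  (p_cvg : p k @[k --> \oo] --> (critical_exponent N : R))
  (u : nat -> 'rV[R]_N -> R)
  (u_sol : forall k, neumann_solution r (p k) (u k))
  (u_pos : forall k x, eball r x -> 0 < u k x)
  (u_radial : forall k, radial_on (eclosed_ball r) (u k))
  (u_bounded : exists C : R, 0 < C /\ forall k,
     (lebesgue_norm (eball r)
        (Num.max (critical_exponent N) (N%:R / 2 * p k - N%:R))%:E (u k)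
      <= C%:E)%E)
  (u0 : 'rV[R]_N -> R)
  (u0_sol : neumann_solution r (critical_exponent N) u0)
  (u0_radial : radial_on (eclosed_ball r) u0)
  (u0_lim : exists2 s : nat -> nat,
     (forall i j, (i < j)%N -> (s i < s j)%N) &
     weak_cvg_H1 (eball r) (u \o s) u0)
  (u_blowup : lebesgue_norm (eball r) +oo%E (u k) @[k --> \oo] --> +oo%E) :
  ((4 <= N)%N ->
     (forall x, eclosed_ball r x -> 0 < u0 x) /\
     (N = 6%N -> 1 / 2 <= u0 0)) /\
  (N = 3%N -> (forall x, eball r x -> u0 x = 0) ->
     forall Rstar : R, is_critical_radius Rstar -> r <= Rstar).
Proof.
case: N hN p_cvg u u_sol u_pos u_radial u_bounded u0 u0_sol u0_radial u0_lim u_blowup hp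
  => [|[|[|n]]]// hN p_cvg u u_sol u_pos u_radial u_bounded u0 u0_sol u0_radial u0_lim
  u_blowup hp.
have n3 : (n <= 3)%N by case/andP: hN.
have q3 : 3 <= critical_exponent n.+3 :> R := critical_exponent_ge3 n3.
have q1 : 1 < critical_exponent n.+3 :> R by lra.
have p3 k : 3 <= p k by rewrite (le_trans q3).
have pd k := supercritical_ratio (hp k).
have prof k := neumann_profile hr (u_sol k) (u_radial k).
have prof0 := neumann_profile hr u0_sol u0_radial.
have pd0 := supercritical_ratio (lexx (critical_exponent n.+3 : R)).
have [s sinc uu0] := u0_lim.
have sc := subsequence_cvg sinc.
have ps_cvg : (p \o s) k @[k --> \oo] --> (critical_exponent n.+3 : R).
  exact: (cvg_comp _ _ sc p_cvg).
set e0 := basis_vec ord0 : 'rV[R]_n.+3.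
have e0E (t : R) : enorm (t *: e0) = `|t| by rewrite enormZ enorm_basis mulr1.
(* Positivity is given in the open ball only. It extends to the boundary because a zero at [r] would
   spread inwards; [U r] is the unit of measure in the smallness lemmas. *)
have end_gt0 k : 0 < u k (r *: e0).
  have [_ u_ge0 _ _] := u_sol k.
  have Ur : 0 <= u k (r *: e0) by apply: (profile_ge0 (prof k)); rewrite lexx ltW.
  rewrite lt_neqAle Ur andbT eq_sym; apply/eqP => Ur0.
  have r2 : 0 < r / 2 <= r by apply/andP; split; lra.
  have := @profile_zero _ _ _ _ _ _ hr (prof k) (p3 k) (pd k) r (r / 2) _ Ur0 r2.
  rewrite lexx (ltW hr) => /(_ isT) U0.
  have : 0 < u k ((r / 2) *: e0).
    by apply: u_pos; rewrite /eball/= e0E gtr0_norm; lra.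
  by rewrite U0 ltxx.
have vanish e del : (forall x, 0 < enorm x < r -> u0 x = 0) -> 0 < e < r -> 0 < del ->
    exists k, forall t, e <= t <= r -> u (s k) (t *: e0) <= del.
  exact: (@weak_vanishing _ _ _ _ (p \o s) (u \o s) u0 hr q1 (fun k => p3 (s k))
    (fun k => pd (s k)) ps_cvg (fun k => u_sol (s k)) u0_sol (fun k => u_radial (s k)) uu0).
split=> [N4|N3 u00 Rstar [[Rs0 gR] _]].
- split=> [x xr|N6].
  (* The profile of [u0] obeys the same inequalities, so a single zero in the closed ball makes [u0]
     vanish at all positive radii. *)
  + rewrite ltNge; apply/negP => ux.
    have xrE := radial_ray u0_radial xr.
    have x0r : 0 <= enorm x <= r by rewrite enorm_ge0.
    have U0x : u0 (enorm x *: e0) = 0.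
      apply/eqP; rewrite eq_le -xrE ux/= xrE.
      exact: (profile_ge0 prof0).
    have u00 y : 0 < enorm y < r -> u0 y = 0.
      move=> /andP[y0 yr].
      rewrite (radial_ray u0_radial); last exact: ltW.
      by apply: (profile_zero hr prof0 q3 pd0 x0r U0x); rewrite y0 ltW.
    (* The lemma counts dimensions from 4 and the theorem is now indexed from 3, with [n]
       positive. *)
    have := @profile_not_small_ge4 R n.-1 r hr; rewrite prednK// => -[e er He].
    have [|k Hk] := vanish e (1 / 2) u00 er; first by lra.
    have [t tr] := He _ _ _ (prof (s k)) (p3 _) (pd _) (end_gt0 _).
    by rewrite ltNge Hk.
  + have n3E : n = 3%N by case: N6.
    subst n.
    have q3E : critical_exponent 6 = 3 :> R by rewrite /critical_exponent; field.
    (* Once [p k < 4], a start at most 1/2 would keep the solution below 2, while blow-up makes its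
       sup norm exceed 2. *)
    have big : \forall k \near \oo, 1 / 2 < u k (0 *: e0).
      have h1 : \forall k \near \oo, p k < 4.
        have q4 : critical_exponent 6 < 4 :> R by rewrite q3E; lra.
        exact: (cvgr_lt _ p_cvg _ q4).
      have h2 : \forall k \near \oo, (2%:E < lebesgue_norm (eball r) +oo (u k))%E.
        have /cvgeyPgt/(_ 2) := u_blowup; exact.
      near=> k; rewrite ltNge; apply/negP => Uk.
      have : (lebesgue_norm (eball r) +oo (u k) <= 2%:E)%E.
        apply: lebesgue_norm_le => // x xr.
        have [_ u_ge0 _ _] := u_sol k.
        rewrite ger0_norm; last exact: u_ge0.
        rewrite (radial_ray (u_radial k)); last exact: ltW.
        apply: (le_trans (profile_le_small_start hr (prof k) (p3 k) Uk _)).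
          by rewrite enorm_ge0 ltW.
        have : p k < 4 by near: k.
        lra.
      by rewrite leNgt => /negP; apply; near: k.
    have low : \forall k \near \oo, forall x, eball r x -> 1 / 2 <= (u \o s) k x.
      apply: (@filterS _ \oo _ _ _ _ (sc _ big)) => k Uk x xr /=.
      rewrite (radial_ray (u_radial _)); last exact: ltW.
      by apply/ltW/(profile_gt_half hr (p3 (s k)) (prof (s k)) Uk); rewrite enorm_ge0 ltW.
    have half0 : 0 < 1 / 2 :> R by lra.
    have p1 k : 1 <= (p \o s) k by have := p3 (s k); rewrite /=; lra.
    apply: (@weak_lower_bound _ _ r _ (1 / 2) (p \o s) (u \o s) u0 (eball r) q1 p1 ps_cvg
      (fun k => u_sol (s k)) u0_sol uu0 (open_eball (r := r)) (@subset_refl _ _) half0 low).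
    by rewrite /eball/= enorm0.
- case: N3 => n0; subst n.
  rewrite leNgt; apply/negP => Rr.
  have hB : cosh r < r * sinh r.
    have := cosh_sub_decreasing Rs0 Rr; have := green_mass0_cosh_le Rs0 gR; lra.
  have [e er [del del0 He]] := profile_not_small_3 hr hB.
  have [|k Hk] := vanish e del _ er del0.
    by move=> x /andP[_ xr]; exact: u00.
  have [t tr] := He _ _ _ (prof (s k)) (p3 _) (pd _) (end_gt0 _).
  by rewrite ltNge Hk.
Unshelve. all: by end_near. Qed.
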